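(* The parametrization of the central ergodic measures on the branching graph of $\mathbb{C}[R_\infty]$ by pairs $(\delta,M_{\mathbb Y})$ determines a bijection between the set of pairs $(\delta,\chi^{S_\infty}_{\alpha,\beta,\gamma})$, where $\delta\in[0,1]$ and $\chi^{S_\infty}_{\alpha,\beta,\gamma}$ is an indecomposable character of the algebra $\mathbb{C}[S_\infty]$, and the set of indecomposable characters of the algebra $\mathbb{C}[R_\infty]$; it sends every pair $(\delta,\chi^{S_\infty}_{\alpha,\beta,\gamma})$ to the character $\chi^{R_\infty}_{\alpha,\beta,\gamma,\delta}$ of $\mathbb{C}[R_\infty]$.
   Context: $R_n$ is the symmetric inverse semigroup: all injective partial maps from $\{1,\dots,n\}$ to itself, under composition where defined. $R_n\subset R_{n+1}$ by letting $n+1$ be fixed, and $R_\infty=\bigcup_nR_n$; $S_\infty=\bigcup_nS_n\subset R_\infty$ is the group of finitary permutations. The branching graph of $\mathbb{C}[S_\infty]$ is the Young graph $\mathbb Y$ ($n$th level: Young diagrams with $n$ cells; edges join diagrams differing by one cell). The branching graph of $\mathbb{C}[R_\infty]$ is the slow Young graph $\tilde{\mathbb Y}$: the vertices of the $n$th level are pairs $(n,\lambda)$ with $\lambda$ a Young diagram with $|\lambda|\le n$ cells, and $(n,\lambda)$, $(n+1,\mu)$ are joined by an edge if $\mu=\lambda$ or $\mu$ is obtained from $\lambda$ by adding one cell. The Pascal graph $\mathbb P$ has vertices $(n,k)$, $0\le k\le n$, on level $n$, and $(n,k)$ is joined to $(n+1,k)$ and $(n+1,k+1)$. A probability measure on the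 space of infinite paths of a branching graph is central if the measure of the cylinder of a finite path starting at the root depends only on the final vertex $v$ of the path; $F_v$ denotes such a cylinder. Ergodic means ergodic with respect to tail equivalence (coincidence of paths from some level on). Central ergodic measures $M$ on the branching graph of an algebra $A=\bigcup_nA_n$ correspond to the indecomposable characters $\chi$ of $A$ by $\chi|_{A_n}=\sum_vM(F_v)\chi_v$, the sum being over vertices $v$ of level $n$ and $\chi_v$ being the irreducible character of $A_n$ indexed by $v$. The indecomposable characters $\chi^{S_\infty}_{\alpha,\beta,\gamma}$ of $\mathbb{C}[S_\infty]$ are indexed by the Thoma parameters $\alpha_1\ge\alpha_2\ge\dots\ge0$, $\beta_1\ge\beta_2\ge\dots\ge0$, $\gamma=1-\sum\alpha_i-\sum\beta_i\ge0$; let $M_{\mathbb Y}$ be the corresponding central ergodic measure. The central ergodic measures on $\mathbb P$ are the measures $M_{\mathbb P}^\delta$, $\delta\in[0,1]$, where $M_{\mathbb P}^\delta$ is concentrated on the paths $((f,k_f))_f$ with $\lim k_f/f=\delta$. The pair $(\delta,M_{\mathbb Y})$ parameterizes the central ergodic measure on $\tilde{\mathbb Y}$ given by $M_{\tilde{\mathbb Y}}(F_{(n,\lambda)})=M_{\mathbb Y}(F_\lambda)\cdot M^\delta_{\mathbb P}(F_{(n,|\lambda|)})$, and $\chi^{R_\infty}_{\alpha,\beta,\gamma,\delta}$ is the corresponding character of $\mathbb{C}[R_\infty]$.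
   Formalization: At δ = 0 all pairs (0, χ) give the same character of C[R_∞], so the map is not injective as claimed; the formal statement proves it is well defined and surjective, and injective exactly up to identifying all pairs with δ = 0. *)

(* Defs.v *)
From HB Require Import structures.
From mathcomp Require Import all_boot all_order all_fingroup all_algebra.
From mathcomp Require Import complex.
From mathcomp Require Import all_classical all_reals all_analysis.

Set Implicit Arguments.
Unset Strict Implicit.
Unset Printing Implicit Defensive.

Import Order.TTheory GRing.Theory Num.Theory.
Import numFieldNormedType.Exports.

Local Open Scope classical_set_scope.
Local Open Scope ring_scope.

(** The set {1, .., n} is encoded as {0, .., n - 1}.  An element of R_n extended
    by the identity is a partial injection of nat, [None] meaning "undefined". *)

Definition partial_inj (f : nat -> option nat) : Prop :=
  forall i j k, f i = Some k -> f j = Some k -> i = j.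

Definition fixes_from (n : nat) (f : nat -> option nat) : Prop :=
  forall i, (n <= i)%N -> f i = Some i.

Definition Rinf_pred : pred (nat -> option nat) :=
  fun f => `[< partial_inj f /\ exists n, fixes_from n f >].

Definition Rinf : Type := {f : nat -> option nat | Rinf_pred f}.

HB.instance Definition _ := Choice.on Rinf.

Definition Rinf_fun (x : Rinf) : nat -> option nat := val x.
Coercion Rinf_fun : Rinf >-> Funclass.

Section RinfTheory.
Implicit Types x y z : Rinf.

Lemma Rinf_inj x : partial_inj x.
Proof. by have /asboolP[] := valP x. Qed.

Lemma Rinf_fin x : exists n, fixes_from n x.
Proof. by have /asboolP[] := valP x. Qed.

Lemma RinfP x y : (forall i, x i = y i) -> x = y.
Proof. by move=> h; apply/val_inj/funext. Qed.

Definition Rone_fun (i : nat) : option nat := Some i.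

Lemma Rone_subproof : Rinf_pred Rone_fun.
Proof. by apply/asboolP; split=> [i j k [->] [->]|]; [|exists 0%N]. Qed.

Definition Rone : Rinf := exist _ Rone_fun Rone_subproof.

Definition Rmul_fun x y (i : nat) : option nat := obind x (y i).

Lemma Rmul_subproof x y : Rinf_pred (Rmul_fun x y).
Proof.
apply/asboolP; split=> [i j k|].
  rewrite /Rmul_fun; case Ei: (y i) => [a|//]; case Ej: (y j) => [b|//] /= xa xb.
  by apply: (@Rinf_inj y _ _ a) => //; rewrite Ej (Rinf_inj xb xa).
have [[m hm] [n hn]] := (Rinf_fin x, Rinf_fin y); exists (maxn m n) => i.
by rewrite geq_max /Rmul_fun => /andP[mi /hn ->] /=; exact: hm.
Qed.

Definition Rmul x y : Rinf := exist _ (Rmul_fun x y) (Rmul_subproof x y).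

Lemma RmulE x y i : Rmul x y i = obind x (y i).
Proof. by []. Qed.

Definition Rinv_fun x (j : nat) : option nat :=
  if pselect (exists i, x i == Some j) is left h then Some (ex_minn h) else None.

Lemma Rinv_funE x i j : Rinv_fun x j = Some i <-> x i = Some j.
Proof.
rewrite /Rinv_fun; case: pselect => [h|h]; last first.
  by split=> // xi; case: h; exists i; apply/eqP.
case: ex_minnP => k /eqP xk _; split=> [[<-] //|xi].
by rewrite (Rinf_inj xk xi).
Qed.

Lemma Rinv_subproof x : Rinf_pred (Rinv_fun x).
Proof.
apply/asboolP; split=> [i j k /Rinv_funE xi /Rinv_funE xj|].
  by move: xj; rewrite xi => -[].
by have [n hn] := Rinf_fin x; exists n => i /hn /Rinv_funE.
Qed.

Definition Rinv x : Rinf := exist _ (Rinv_fun x) (Rinv_subproof x).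

Lemma RinvE x i j : Rinv x j = Some i <-> x i = Some j.
Proof. exact: Rinv_funE. Qed.

Lemma RmulA : associative Rmul.
Proof.
by move=> x y z; apply: RinfP => i; rewrite !RmulE; case: (z i).
Qed.

Lemma Rmul1 : left_id Rone Rmul.
Proof. by move=> x; apply: RinfP => i; rewrite RmulE; case: (x i). Qed.

Lemma option_ext (u v : option nat) :
  (forall k, u = Some k <-> v = Some k) -> u = v.
Proof.
case: u => [a|]; case: v => [b|] // h; first by have [/(_ erefl) ->] := h a.
- by have [/(_ erefl)] := h a.
- by have [_ /(_ erefl)] := h b.
Qed.

Lemma RinvK : involutive Rinv.
Proof.
move=> x; apply: RinfP => i; apply: option_ext => j.
by split=> [/RinvE/RinvE //|xi]; apply/RinvE/RinvE.
Qed.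

Lemma RinvM : {morph Rinv : x y / Rmul x y >-> Rmul y x}.
Proof.
move=> x y; apply: RinfP => i; apply: option_ext => j; rewrite RmulE.
split=> [/RinvE|].
  rewrite RmulE; case Ej: (y j) => [a|//] /= xa.
  by have /RinvE -> := xa; apply/RinvE.
case Ei: (Rinv x i) => [a|//] /= /RinvE ya.
by apply/RinvE; rewrite RmulE ya /=; apply/RinvE.
Qed.

HB.instance Definition _ := isStarMonoid.Build Rinf RmulA Rmul1 RinvK RinvM.

End RinfTheory.

(** S_oo is the set of everywhere defined elements of R_oo: an everywhere
    defined injection fixing almost all points is a finitary permutation. *)

Definition total_pred : pred Rinf := fun x => `[< forall i, x i <> None >].

Definition Sinf : Type := {x : Rinf | total_pred x}.

HB.instance Definition _ := Choice.on Sinf.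

Section SinfTheory.
Implicit Types s t u : Sinf.

Lemma Sone_subproof : total_pred Rone.
Proof. exact/asboolP. Qed.

Definition Sone : Sinf := exist _ Rone Sone_subproof.

Lemma Smul_subproof s t : total_pred (Rmul (val s) (val t)).
Proof.
have [/asboolP hs /asboolP ht] := (valP s, valP t); apply/asboolP => i.
by rewrite RmulE; case E: (val t i) => [j|//=]; [exact: hs | case: (ht i)].
Qed.

Definition Smul s t : Sinf := exist _ (Rmul (val s) (val t)) (Smul_subproof s t).

Lemma Sinf_surj s j : exists i, val s i = Some j.
Proof.
have [n hn] := Rinf_fin (val s); have [/hn sj|jn] := leqP n j; first by exists j.
have /asboolP tot := valP s.
have lt_n (i : 'I_n) k : val s i = Some k -> (k < n)%N.
  move=> si; rewrite ltnNge; apply/negP => nk.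
  by have := ltn_ord i; rewrite (Rinf_inj si (hn _ nk)) ltnNge nk.
have ex (i : 'I_n) : exists k : 'I_n, val s i == Some (k : nat).
  case Ei: (val s i) => [k|]; last by case: (tot _ Ei).
  by exists (Ordinal (lt_n _ _ Ei)).
pose g (i : 'I_n) : 'I_n := xchoose (ex i).
have gP (i : 'I_n) : val s i = Some (g i : nat).
  by apply/eqP; exact: (xchooseP (ex i)).
have g_inj : injective g.
  move=> a b ab; apply/val_inj/(@Rinf_inj (val s) _ _ (g a)); first exact: gP.
  by rewrite ab; exact: gP.
have [h _ gh] := injF_bij g_inj.
by exists (h (Ordinal jn)); rewrite gP gh.
Qed.

Lemma Sinv_subproof s : total_pred (Rinv (val s)).
Proof.
by apply/asboolP => j; have [i /RinvE ->] := Sinf_surj s j.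
Qed.

Definition Sinv s : Sinf := exist _ (Rinv (val s)) (Sinv_subproof s).

Lemma SmulA : associative Smul.
Proof. by move=> s t u; apply/val_inj; exact: RmulA. Qed.

Lemma Smul1 : left_id Sone Smul.
Proof. by move=> s; apply/val_inj; exact: Rmul1. Qed.

Lemma SmulVs : left_inverse Sone Sinv Smul.
Proof.
move=> s; apply/val_inj/RinfP => i; rewrite [LHS]RmulE.
have /asboolP/(_ i) := valP s; case Ei: (val s i) => [j|//] _ /=.
exact/RinvE.
Qed.

Lemma SinvK : involutive Sinv.
Proof. by move=> s; apply/val_inj; exact: RinvK. Qed.

Lemma SinvM : {morph Sinv : s t / Smul s t >-> Smul t s}.
Proof. by move=> s t; apply/val_inj; exact: RinvM. Qed.

HB.instance Definition _ := isStarMonoid.Build Sinf SmulA Smul1 SinvK SinvM.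
HB.instance Definition _ := StarMonoid_isGroup.Build Sinf SmulVs.

End SinfTheory.

Definition Rn (n : nat) : set Rinf := [set x | fixes_from n x].
Definition Sn (n : nat) : set Sinf := [set s | Rn n (val s)].

(** A linear functional on C[G] is given by its values on G; the involution of
    C[G] extends [x |-> x^-1] antilinearly. *)

Section Characters.
Variables (R : realType) (G : starMonoidType).
Implicit Type chi : G -> R[i].

Definition is_character chi : Prop :=
  [/\ chi 1%g = 1,
      forall x y, chi (x * y)%g = chi (y * x)%g &
      forall (m : nat) (c : 'I_m -> R[i]) (x : 'I_m -> G),
        0 <= \sum_i \sum_j c i * (c j)^* * chi (x i * (x j)^-1)%g].

Definition indecomposable_character chi : Prop :=
  is_character chi /\
  forall (chi1 chi2 : G -> R[i]) (t : R),
    is_character chi1 -> is_character chi2 -> 0 < t < 1 ->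
    (forall x, chi x = t%:C%C * chi1 x + (1 - t)%:C%C * chi2 x) ->
    chi1 = chi2.

End Characters.

Record bgraph := BGraph {
  vert :> choiceType;
  root : vert;
  level : vert -> nat;
  edge : rel vert;
  edge_ex : forall v : vert, exists w, edge v w }.

Arguments root {_}.
Arguments level {_}.
Arguments edge {_}.

Section Paths.
Variable G : bgraph.

Definition is_ipath : pred (nat -> G) :=
  fun t => `[< t 0%N = root /\ forall n, edge (t n) (t n.+1) >].

Definition ipath : Type := {t : nat -> G | is_ipath t}.

Definition ipath_vertex (t : ipath) : nat -> G := val t.
Coercion ipath_vertex : ipath >-> Funclass.

Definition some_path (n : nat) : G := iter n (fun v => xchoose (edge_ex v)) root.

Lemma some_path_subproof : is_ipath some_path.
Proof. by apply/asboolP; split=> // n; exact: (xchooseP (edge_ex _)). Qed.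

HB.instance Definition _ := Choice.on ipath.
HB.instance Definition _ :=
  isPointed.Build ipath (exist _ some_path some_path_subproof).

(** A finite path starting at the root is given by the sequence [p] of its
    other vertices. *)
Definition fpath_to (v : G) : set (seq G) :=
  [set p | path edge root p /\ last root p = v].

Definition cylinder (p : seq G) : set ipath :=
  [set t | mkseq t (size p).+1 = root :: p].

Definition cylinders : set (set ipath) := range cylinder.

(** The finite path from the root to [v] is chosen arbitrarily: its choice does
    not affect the value of a central measure. *)
Definition F_ (v : G) : set ipath := cylinder (xget [::] (fpath_to v)).

Definition tail_equiv (t u : ipath) : Prop :=
  exists N, forall n, (N <= n)%N -> t n = u n.

Definition tail_invariant (A : set ipath) : Prop :=
  forall t u, tail_equiv t u -> A t -> A u.

End Paths.

Notation path_space G := (g_sigma_algebraType (@cylinders G)).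

Section CentralMeasures.
Variables (R : realType) (G : bgraph).
Implicit Type M : probability (path_space G) R.

Definition central M : Prop :=
  forall (v : G) (p q : seq G), fpath_to v p -> fpath_to v q ->
    M (cylinder p) = M (cylinder q).

Definition ergodic M : Prop :=
  forall A : set (path_space G), measurable A -> tail_invariant A ->
    M A = 0%E \/ M A = 1%E.

Definition central_ergodic M : Prop := central M /\ ergodic M.

(** The levels of the graphs below are finite, so that the sum is a genuine
    finite sum. *)
Definition corresponds (T : Type) (A : nat -> set T) (chi_ : G -> T -> R[i])
    M (chi : T -> R[i]) : Prop :=
  forall (n : nat) (x : T), A n x ->
    chi x = \sum_(v \in [set v : G | level v = n])
              (fine (M (F_ v)))%:C%C * chi_ v x.

End CentralMeasures.

Definition is_ydiag : pred (seq nat) := fun s => sorted geq s && (0%N \notin s).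

Definition ydiag : Type := {s : seq nat | is_ydiag s}.

HB.instance Definition _ := Choice.on ydiag.

Definition ncells (l : ydiag) : nat := sumn (val l).

Definition ydiag_contained (l m : ydiag) : bool :=
  all (fun i => nth 0 (val l) i <= nth 0 (val m) i)%N (iota 0 (size (val l))).

Definition add_cell (l m : ydiag) : bool :=
  ydiag_contained l m && (ncells m == (ncells l).+1).

Definition ydiag0 : ydiag := exist is_ydiag [::] isT.

Lemma add_cell_ex (l : ydiag) : exists m, add_cell l m.
Proof.
have s_ydiag : is_ydiag (incr_nth (val l) 0).
  case: l => -[//|a s] /= /andP[ss n0]; apply/andP; split=> /=.
    by case: s ss {n0} => //= b s /andP[ab ->]; rewrite andbT /geq/= ltnW.
  by move: n0; rewrite !inE !negb_or => /andP[_ ->].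
exists (exist is_ydiag _ s_ydiag); apply/andP; split; last first.
  have sumn_incr s : sumn (incr_nth s 0) = (sumn s).+1 by case: s.
  by apply/eqP; exact: sumn_incr.
by apply/allP => i _ /=; rewrite nth_incr_nth leq_addl.
Qed.

Definition young_graph : bgraph := BGraph ydiag0 ncells add_cell_ex.

Definition slow_vertex : Type := {v : nat * ydiag | (ncells v.2 <= v.1)%N}.

HB.instance Definition _ := Choice.on slow_vertex.

Definition slow_edge (v w : slow_vertex) : bool :=
  ((val w).1 == (val v).1.+1) &&
  (((val w).2 == (val v).2) || add_cell (val v).2 (val w).2).

Definition slow_root : slow_vertex := exist _ (0%N, ydiag0) isT.

Lemma slow_edge_ex (v : slow_vertex) : exists w, slow_edge v w.
Proof.
have le_v : (ncells (val v).2 <= (val v).1.+1)%N by exact: leqW (valP v).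
exists (exist (fun u : nat * ydiag => (ncells u.2 <= u.1)%N)
          ((val v).1.+1, (val v).2) le_v).
by rewrite /slow_edge /= !eqxx.
Qed.

Definition slow_young_graph : bgraph :=
  BGraph slow_root (fun v : slow_vertex => (val v).1) slow_edge_ex.

Definition pascal_vertex : Type := {v : nat * nat | (v.2 <= v.1)%N}.

HB.instance Definition _ := Choice.on pascal_vertex.

Definition pascal_edge (v w : pascal_vertex) : bool :=
  ((val w).1 == (val v).1.+1) &&
  (((val w).2 == (val v).2) || ((val w).2 == (val v).2.+1)).

Definition pascal_root : pascal_vertex := exist _ (0%N, 0%N) isT.

Lemma pascal_edge_ex (v : pascal_vertex) : exists w, pascal_edge v w.
Proof.
have le_v : ((val v).2 <= (val v).1.+1)%N by exact: leqW (valP v).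
exists (exist (fun u : nat * nat => (u.2 <= u.1)%N)
          ((val v).1.+1, (val v).2) le_v).
by rewrite /pascal_edge /= !eqxx.
Qed.

Definition pascal_graph : bgraph :=
  BGraph pascal_root (fun v : pascal_vertex => (val v).1) pascal_edge_ex.

Definition slow_diagram (v : slow_young_graph) : young_graph := (val v).2.

Definition slow_to_pascal (v : slow_young_graph) : pascal_graph :=
  exist (fun u : nat * nat => (u.2 <= u.1)%N)
    ((val v).1, ncells (val v).2) (valP v).

(** For a diagram l with k <= n cells let c_l be the Young symmetrizer in
    C[S_k].  The semigroup R_n acts on the space C[I(k, n)] spanned by the
    injections f : {1, .., k} -> {1, .., n}: x f is the composition of x and f
    if x is defined on the image of f, and 0 otherwise.  This action commutes
    with the right action of C[S_k], and the irreducible R_n-module indexed by l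
    is C[I(k, n)] c_l, i.e. the tensor product over C[S_k] of C[I(k, n)] with
    the Specht module C[S_k] c_l (Munn, Solomon).  For k = n, its restriction to
    S_n is the Specht module C[S_n] c_l itself.

    Linear maps are matrices acting on the right of row vectors. *)

Section IrreducibleCharacters.
Variables (R : realType) (n : nat) (l : ydiag).

Definition injections : Type :=
  {f : {ffun 'I_(ncells l) -> 'I_n} | injectiveb f}.

HB.instance Definition _ := Finite.on injections.

Definition injection_at (i : 'I_#|{: injections}|) : 'I_(ncells l) -> 'I_n :=
  val (enum_val i).

(** The cells of [l] are numbered row by row; [reshape_index] and
    [reshape_offset] give the row and the column of a cell. *)
Definition row_stabilizer : {set 'S_(ncells l)} :=
  [set p : 'S_(ncells l) |
    [forall i, reshape_index (val l) (p i) == reshape_index (val l) i]].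

Definition column_stabilizer : {set 'S_(ncells l)} :=
  [set q : 'S_(ncells l) |
    [forall i, reshape_offset (val l) (q i) == reshape_offset (val l) i]].

Definition young_symmetrizer_mx : 'M[R[i]]_#|{: injections}| :=
  \matrix_(a, b) \sum_(p in row_stabilizer) \sum_(q in column_stabilizer)
    (-1) ^+ (odd_perm q) *
    ([forall i, injection_at b i == injection_at a (p (q i))])%:R.

Definition action_mx (x : Rinf) : 'M[R[i]]_#|{: injections}| :=
  \matrix_(a, b)
    ([forall i, x (injection_at a i) == Some (injection_at b i : nat)])%:R.

Definition irr_character (x : Rinf) : R[i] :=
  \tr (restrictmx young_symmetrizer_mx (action_mx x)).

End IrreducibleCharacters.

Definition chi_Y (R : realType) (v : young_graph) (s : Sinf) : R[i] :=
  irr_character R (ncells v) v (val s).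

Definition chi_slowY (R : realType) (v : slow_young_graph) (x : Rinf) : R[i] :=
  irr_character R (val v).1 (val v).2 x.

Section Parametrization.
Variable R : realType.

Definition pascal_measure (delta : R)
    (M : probability (path_space pascal_graph) R) : Prop :=
  central_ergodic M /\
  {ae M, forall t : ipath pascal_graph,
    (fun f : nat => (val (t f)).2%:R / f%:R : R) @ \oo --> delta}.

Definition product_measure (MY : probability (path_space young_graph) R)
    (MP : probability (path_space pascal_graph) R)
    (MT : probability (path_space slow_young_graph) R) : Prop :=
  central_ergodic MT /\
  forall v : slow_young_graph,
    MT (F_ v) = (MY (F_ (slow_diagram v)) * MP (F_ (slow_to_pascal v)))%E.

(** [psi] is the character of C[R_oo] attached to the pair (delta, chi): if
    M_Y is the central ergodic measure on the Young graph corresponding to chi,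
    i.e. to the Thoma parameters of chi, then psi corresponds to the central
    ergodic measure on the slow Young graph parameterized by (delta, M_Y). *)
Definition character_of_pair (delta : R) (chi : Sinf -> R[i])
    (psi : Rinf -> R[i]) : Prop :=
  exists (MY : probability (path_space young_graph) R)
         (MP : probability (path_space pascal_graph) R)
         (MT : probability (path_space slow_young_graph) R),
    [/\ central_ergodic MY /\ corresponds Sn (@chi_Y R) MY chi,
        pascal_measure delta MP,
        product_measure MY MP MT &
        corresponds Rn (@chi_slowY R) MT psi].

Definition pairs : set (R * (Sinf -> R[i])) :=
  [set a | 0 <= a.1 <= 1 /\ indecomposable_character a.2].

(** At delta = 0 the measure M_P^delta is carried by the single path
    ((f, 0))_f, so that the measure parameterized by (0, M_Y) does not depend on
    M_Y: it is carried by the path of empty diagrams.  Hence a pair is determined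
    by its measure only up to the identification of all the pairs (0, chi). *)
Definition same_pair (a b : R * (Sinf -> R[i])) : Prop :=
  a = b \/ a.1 = 0 /\ b.1 = 0.

End Parametrization.

(* Main.v *)
From HB Require Import structures.
From mathcomp Require Import all_boot all_order all_fingroup all_algebra complex.
From mathcomp Require Import all_classical all_reals all_analysis.
From mathcomp Require Import zify ring lra.
Require Import Defs.

(** Both kinds of characters are described by nonnegative normalized harmonic
    functions, of the Young graph for S_oo and of the slow Young graph for R_oo,
    through chi = sum_l f(l) chi_l on each level, and indecomposable characters
    are the extreme harmonic functions.  For S_oo this is the branching rule of
    S_k, obtained from Young symmetrizers and from the identity
    sum_l (f^l)^2 = k!.  For R_oo one expands a character by inclusion-exclusion
    over the sets of points that are killed: the terms are induced from positive
    definite class functions of the groups S_k.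

    A harmonic function is turned into a central measure by cutting [0, 1[ into
    nested intervals and pushing the Lebesgue measure forward; extremality gives
    ergodicity because conditioning on a tail invariant event preserves
    centrality.

    On the slow Young graph, phi(n+1, l) and phi(n, l) - phi(n+1, l) are harmonic
    in (n, l), hence both proportional to an extreme phi, which forces
    phi(n, l) = f(l) d^|l| (1 - d)^(n - |l|).  Conversely a product of this form
    with f extreme is extreme, since a Pascal harmonic function dominated by a
    Bernoulli one is Bernoulli, by a second moment argument.  The Pascal
    component is M_P^d by the strong law of large numbers (fourth moments and
    Borel-Cantelli) and is unique by convergence in probability and the same
    second moment argument. *)

Set Implicit Arguments.
Unset Strict Implicit.
Unset Printing Implicit Defensive.

Import Order.TTheory GRing.Theory Num.Theory.
Local Open Scope ring_scope.

(** * Group algebras *)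

(** The branching rule comes out of counting. Restriction multiplicities are ranks of idempotents,
    hence naturals, and they are nonzero along the edges of the Young graph, so each degree is at
    least the number f^l of standard tableaux. Bessel's inequality bounds the sum of the squared
    degrees by k!, which the (f^l)^2 already exhaust, and every inequality becomes an equality.

    The terms of the expansion over R_n inherit positive definiteness because the alternating sum of
    the partial identities on the subsets of a finite set is a self-adjoint idempotent of the
    semigroup algebra.

    The second moment argument compares orders of growth: a Pascal harmonic function dominated by a
    Bernoulli one has a second moment about N d of order N, whereas a wrong mean would force order
    N^2.

    The value d = 0 is exceptional: the product then forgets f, so that this case is treated apart
    in extremality, in the decomposition of extreme functions and in injectivity. *)

Definition galg (C : numClosedFieldType) (gT : finGroupType) : Type :=
  {ffun gT -> C^o}.

Section GroupAlgebra.
Variables (C : numClosedFieldType) (gT : finGroupType).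
Local Notation A := (galg C gT).
Implicit Types (u v w : A) (x y : gT).

HB.instance Definition _ := GRing.Lmodule.on A.

Definition galg_fun (u : A) : gT -> C := (u : {ffun gT -> C^o}).
Coercion galg_fun : galg >-> Funclass.

Definition gmul u v : A := [ffun x => \sum_y u y * v (y^-1 * x)%g].

Definition gelt x : A := [ffun y => (y == x)%:R].

Lemma galgP u v : u =1 v <-> u = v.
Proof. exact: ffunP. Qed.

Lemma gaddE u v x : galg_fun (u + v) x = u x + v x.
Proof. by rewrite /galg_fun ffunE. Qed.
Lemma gscaleE a u x : galg_fun (a *: u) x = a * u x.
Proof. by rewrite /galg_fun ffunE. Qed.
Lemma goppE u x : galg_fun (- u) x = - u x.
Proof. by rewrite /galg_fun ffunE. Qed.
Lemma gzeroE x : galg_fun (0 : A) x = 0.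
Proof. by rewrite /galg_fun ffunE. Qed.
Lemma gsumE I (r : seq I) (P : pred I) (F : I -> A) x :
  galg_fun (\sum_(i <- r | P i) F i) x = \sum_(i <- r | P i) F i x.
Proof.
exact: (big_morph (fun u : A => galg_fun u x) (fun u v => gaddE u v x) (gzeroE x)).
Qed.
Lemma geltE x y : gelt x y = (y == x)%:R.
Proof. by rewrite /galg_fun ffunE. Qed.

Lemma gmul_def u v x : gmul u v x = \sum_y u y * v (y^-1 * x)%g.
Proof. by rewrite /galg_fun ffunE. Qed.

Lemma gmulA : associative gmul.
Proof.
move=> u v w; apply/galgP => x; rewrite !gmul_def.
under eq_bigr => y _ do rewrite gmul_def mulr_sumr.
under [RHS]eq_bigr => z _ do rewrite gmul_def mulr_suml.
rewrite [RHS]exchange_big /=; apply: eq_bigr => y _.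
rewrite (reindex_inj (mulgI y^-1)%g) /=; apply: eq_bigr => z _.
by rewrite mulrA invMg invgK -!mulgA mulKVg.
Qed.

Lemma gmul1l : left_id (gelt 1) gmul.
Proof.
move=> u; apply/galgP => x; rewrite gmul_def (bigD1 1%g) //= big1 => [|y yn1].
  by rewrite geltE eqxx mul1r invg1 mul1g addr0.
by rewrite geltE (negPf yn1) mul0r.
Qed.

Lemma gmul1r : right_id (gelt 1) gmul.
Proof.
move=> u; apply/galgP => x; rewrite gmul_def (bigD1 x) //= big1 => [|y yx].
  by rewrite geltE mulVg eqxx mulr1 addr0.
rewrite geltE -eq_mulVg1 (negPf yx) mulr0 //.
Qed.

Lemma gmulDl : left_distributive gmul +%R.
Proof.
move=> u v w; apply/galgP => x; rewrite gaddE !gmul_def -big_split /=.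
by apply: eq_bigr => y _; rewrite gaddE mulrDl.
Qed.

Lemma gmulDr : right_distributive gmul +%R.
Proof.
move=> u v w; apply/galgP => x; rewrite gaddE !gmul_def -big_split /=.
by apply: eq_bigr => y _; rewrite gaddE mulrDr.
Qed.

Lemma gone_neq0 : gelt 1 != 0.
Proof.
apply/eqP => /galgP/(_ 1%g); rewrite geltE gzeroE eqxx => /eqP.
by rewrite oner_eq0.
Qed.

HB.instance Definition _ :=
  GRing.Zmodule_isNzRing.Build A gmulA gmul1l gmul1r gmulDl gmulDr gone_neq0.

Lemma gscaleAl a u v : a *: (u * v) = (a *: u) * v.
Proof.
apply/galgP => x; rewrite gscaleE !gmul_def mulr_sumr.
by apply: eq_bigr => y _; rewrite gscaleE mulrA.
Qed.

HB.instance Definition _ := GRing.Lmodule_isLalgebra.Build C A gscaleAl.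

Lemma gscaleAr a u v : a *: (u * v) = u * (a *: v).
Proof.
apply/galgP => x; rewrite gscaleE !gmul_def mulr_sumr.
by apply: eq_bigr => y _; rewrite gscaleE mulrCA.
Qed.

HB.instance Definition _ := GRing.Lalgebra_isAlgebra.Build C A gscaleAr.

Lemma gmulE u v x : galg_fun (u * v) x = \sum_y u y * v (y^-1 * x)%g.
Proof. exact: gmul_def. Qed.

Lemma gelt1 : gelt 1 = 1. Proof. by []. Qed.

Lemma gone1 : galg_fun (1 : A) 1%g = 1.
Proof. by rewrite -gelt1 geltE eqxx. Qed.

Lemma geltMl x u y : galg_fun (gelt x * u) y = u (x^-1 * y)%g.
Proof.
rewrite gmulE (bigD1 x) //= big1 => [|z zx].
  by rewrite geltE eqxx mul1r addr0.
by rewrite geltE (negPf zx) mul0r.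
Qed.

Lemma geltMr x u y : galg_fun (u * gelt x) y = u (y * x^-1)%g.
Proof.
rewrite gmulE (bigD1 (y * x^-1)%g) //= big1 => [|z zx].
  by rewrite geltE invMg invgK mulgKV eqxx mulr1 addr0.
rewrite geltE; case: eqP => [E|_]; last by rewrite mulr0.
by move: zx; rewrite -E invMg invgK mulKVg eqxx.
Qed.

Lemma geltM x y : gelt (x * y) = gelt x * gelt y.
Proof.
apply/galgP => z; rewrite geltMl !geltE; congr (nat_of_bool _)%:R.
by apply/eqP/eqP => [->|<-]; rewrite ?mulKg ?mulKVg.
Qed.

Lemma gelt_sum u : u = \sum_x u x *: gelt x.
Proof.
apply/galgP => y; rewrite gsumE (bigD1 y) //= big1 => [|z zx].
  by rewrite gscaleE geltE eqxx mulr1 addr0.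
by rewrite gscaleE geltE eq_sym (negPf zx) mulr0.
Qed.

Definition gtrace u : C := u 1%g.

Lemma gtraceD u v : gtrace (u + v) = gtrace u + gtrace v.
Proof. exact: gaddE. Qed.
Lemma gtraceN u : gtrace (- u) = - gtrace u.
Proof. exact: goppE. Qed.
Lemma gtraceZ a u : gtrace (a *: u) = a * gtrace u.
Proof. exact: gscaleE. Qed.
Lemma gtrace0 : gtrace 0 = 0. Proof. exact: gzeroE. Qed.
Lemma gtrace_sum I (r : seq I) (P : pred I) (F : I -> A) :
  gtrace (\sum_(i <- r | P i) F i) = \sum_(i <- r | P i) gtrace (F i).
Proof. exact: gsumE. Qed.

Lemma gtraceC u v : gtrace (u * v) = gtrace (v * u).
Proof.
rewrite /gtrace !gmulE (reindex_inj invg_inj) /=.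
by apply: eq_bigr => y _; rewrite !mulg1 invgK mulrC.
Qed.

Lemma gtrace1 : gtrace 1 = 1. Proof. exact: gone1. Qed.

Definition gstar u : A := [ffun x => (u x^-1%g)^*].

Lemma gstarE u x : gstar u x = (u x^-1%g)^*.
Proof. by rewrite /gstar /galg_fun ffunE. Qed.

Lemma gstarK : involutive gstar.
Proof. by move=> u; apply/galgP => x; rewrite !gstarE invgK conjCK. Qed.

Lemma gstarM u v : gstar (u * v) = gstar v * gstar u.
Proof.
apply/galgP => x; rewrite gstarE !gmulE rmorph_sum /=.
rewrite (reindex_inj (mulgI x^-1)%g) /=.
by apply: eq_bigr => y _; rewrite !gstarE rmorphM mulrC !invMg !invgK mulgK.
Qed.

Lemma gstarD u v : gstar (u + v) = gstar u + gstar v.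
Proof. by apply/galgP => x; rewrite gaddE !gstarE gaddE rmorphD. Qed.
Lemma gstarB u v : gstar (u - v) = gstar u - gstar v.
Proof. by apply/galgP => x; rewrite gaddE goppE !gstarE gaddE goppE rmorphB. Qed.
Lemma gstarZ a u : gstar (a *: u) = a^* *: gstar u.
Proof. by apply/galgP => x; rewrite gscaleE !gstarE gscaleE rmorphM. Qed.
Lemma gstar_elt x : gstar (gelt x) = gelt x^-1.
Proof.
apply/galgP => y; rewrite gstarE !geltE conjC_nat.
by rewrite -(can2_eq (@invgK gT) (@invgK gT)).
Qed.
Lemma gstar1 : gstar 1 = 1.
Proof. by rewrite -gelt1 gstar_elt invg1. Qed.
Lemma gstar_sum I (r : seq I) (P : pred I) (F : I -> A) :
  gstar (\sum_(i <- r | P i) F i) = \sum_(i <- r | P i) gstar (F i).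
Proof.
apply: (big_morph gstar gstarD).
by apply/galgP => x; rewrite gstarE !gzeroE conjC0.
Qed.

Lemma gtrace_star u : gtrace (u * gstar u) = \sum_x `|u x| ^+ 2.
Proof.
rewrite /gtrace gmulE; apply: eq_bigr => x _.
by rewrite gstarE mulg1 invgK normCK.
Qed.

Lemma gtrace_star_ge0 u : 0 <= gtrace (u * gstar u).
Proof. by rewrite gtrace_star sumr_ge0 // => x _; rewrite exprn_ge0. Qed.

Lemma gtrace_star_eq0 u : gtrace (u * gstar u) = 0 -> u = 0.
Proof.
rewrite gtrace_star => /eqP; rewrite psumr_eq0 => [|x _]; last exact: exprn_ge0.
move=> /allP u0; apply/galgP => x; rewrite gzeroE; apply/eqP.
by have := u0 x (mem_index_enum _); rewrite /= sqrf_eq0 normr_eq0.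
Qed.

(** The linear extension of [theta] from the group to its algebra. *)
Definition gpair (theta : gT -> C) u : C := \sum_x theta x * u x.

(** Not normalized: this is the order of the group times the projection onto the centre. *)
Definition gavg u : A := \sum_x gelt x^-1 * u * gelt x.

Lemma gavgE u y : gavg u y = \sum_x u (x * y * x^-1)%g.
Proof.
rewrite gsumE; apply: eq_bigr => x _.
by rewrite geltMr geltMl invgK mulgA.
Qed.

Lemma gavgD u v : gavg (u + v) = gavg u + gavg v.
Proof.
by rewrite -big_split; apply: eq_bigr => x _; rewrite mulrDr mulrDl.
Qed.
Lemma gavgZ a u : gavg (a *: u) = a *: gavg u.
Proof. by rewrite scaler_sumr; apply: eq_bigr => x _; rewrite scalerAl scalerAr. Qed.

Lemma gavg_sum I (r : seq I) (P : pred I) (F : I -> A) :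
  gavg (\sum_(i <- r | P i) F i) = \sum_(i <- r | P i) gavg (F i).
Proof.
apply: (big_morph gavg gavgD).
by apply: big1 => x _; rewrite mulr0 mul0r.
Qed.

Lemma gavg_eltC x v : gavg (gelt x * v) = gavg (v * gelt x).
Proof.
apply/galgP => y; rewrite !gavgE (reindex_inj (mulgI x)%g) /=.
apply: eq_bigr => z _; rewrite geltMl geltMr invMg.
by rewrite !mulgA mulVg mul1g.
Qed.

Lemma gavgC u v : gavg (u * v) = gavg (v * u).
Proof.
rewrite {1}(gelt_sum u) [in RHS](gelt_sum u) mulr_suml mulr_sumr !gavg_sum.
by apply: eq_bigr => x _; rewrite -scalerAl -scalerAr !gavgZ gavg_eltC.
Qed.

Definition gcentral u := forall v, u * v = v * u.

Lemma gcentral_elt u : (forall x, u * gelt x = gelt x * u) -> gcentral u.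
Proof.
move=> h v; rewrite (gelt_sum v) mulr_sumr mulr_suml.
by apply: eq_bigr => x _; rewrite -scalerAl -scalerAr h.
Qed.

Lemma gavg_central u : gcentral (gavg u).
Proof.
apply: gcentral_elt => y; rewrite mulr_suml mulr_sumr.
rewrite (reindex_inj (mulIg y^-1)%g) /=; apply: eq_bigr => x _.
by rewrite -!mulrA -geltM mulgKV invMg invgK geltM !mulrA.
Qed.

Definition class_fun (theta : gT -> C) :=
  forall x y, theta (x * y)%g = theta (y * x)%g.

Definition gof (theta : gT -> C) : A := [ffun x => theta x].

Lemma gofE theta x : gof theta x = theta x.
Proof. by rewrite /gof /galg_fun ffunE. Qed.

Lemma class_fun_central theta : class_fun theta -> gcentral (gof theta).
Proof.
move=> ct; apply: gcentral_elt => x; apply/galgP => y.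
by rewrite geltMl geltMr !gofE ct.
Qed.

Lemma central_class_fun u : gcentral u -> class_fun u.
Proof.
move=> cu x y; have /galgP/(_ (y * x * y)%g) := cu (gelt y).
by rewrite geltMl geltMr mulgK !mulgA mulVg mul1g.
Qed.

Lemma gavg_mull z u : gcentral z -> gavg (z * u) = z * gavg u.
Proof.
move=> cz; rewrite /gavg mulr_sumr; apply: eq_bigr => x _.
by rewrite !mulrA cz.
Qed.

Lemma gtrace_avg u : gtrace (gavg u) = #|gT|%:R * gtrace u.
Proof.
rewrite gtrace_sum.
under eq_bigr => x _ do rewrite gtraceC mulrA -geltM mulgV gelt1 mul1r.
by rewrite sumr_const mulr_natl.
Qed.

Lemma gpairD theta u v : gpair theta (u + v) = gpair theta u + gpair theta v.
Proof. by rewrite -big_split; apply: eq_bigr => x _; rewrite gaddE mulrDr. Qed.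
Lemma gpairZ theta a u : gpair theta (a *: u) = a * gpair theta u.
Proof. by rewrite mulr_sumr; apply: eq_bigr => x _; rewrite gscaleE mulrCA. Qed.
Lemma gpair_sum theta I (r : seq I) (P : pred I) (F : I -> A) :
  gpair theta (\sum_(i <- r | P i) F i) = \sum_(i <- r | P i) gpair theta (F i).
Proof.
apply: (big_morph (gpair theta) (gpairD theta)).
by apply: big1 => x _; rewrite gzeroE mulr0.
Qed.
Lemma gpair_elt theta x : gpair theta (gelt x) = theta x.
Proof.
rewrite /gpair (bigD1 x) //= big1 => [|y yx].
  by rewrite geltE eqxx mulr1 addr0.
by rewrite geltE (negPf yx) mulr0.
Qed.

Lemma gpairM theta u v :
  gpair theta (u * v) = \sum_x \sum_y u x * v y * theta (x * y)%g.
Proof.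
rewrite {1}(gelt_sum u) {1}(gelt_sum v) mulr_suml gpair_sum.
apply: eq_bigr => x _; rewrite mulr_sumr gpair_sum; apply: eq_bigr => y _.
by rewrite -scalerAl -scalerAr -geltM !gpairZ gpair_elt mulrA.
Qed.

Lemma gpairC theta u v : class_fun theta ->
  gpair theta (u * v) = gpair theta (v * u).
Proof.
move=> ct; rewrite !gpairM exchange_big /=.
by apply: eq_bigr => x _; apply: eq_bigr => y _; rewrite ct mulrAC [_ * u y]mulrC mulrAC.
Qed.

Definition pos_def (theta : gT -> C) := forall u, 0 <= gpair theta (u * gstar u).

Definition greal u := forall x, (u x)^* = u x.

Lemma gpair_trace u v : greal v -> gpair u v = gtrace (u * gstar v).
Proof.
move=> rv; rewrite /gtrace gmulE; apply: eq_bigr => x _.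
by rewrite gstarE mulg1 invgK rv.
Qed.

End GroupAlgebra.

(** * Young symmetrizers *)

Section Stabilizers.
Variables (C : numClosedFieldType) (k : nat).
Implicit Types (r s : 'I_k -> nat) (p q g : 'S_k).
Local Notation A := (galg C 'S_k).
Local Notation elt := (@gelt C 'S_k).

(** The Young subgroup preserving the fibres of [r]. Rows and columns are treated at once: [r] will
    be the row or the column of a cell. *)
Definition fstab r : {set 'S_k} := [set p : 'S_k | [forall i, r (p i) == r i]].

Lemma fstabP r p : reflect (forall i, r (p i) = r i) (p \in fstab r).
Proof. by rewrite inE; apply: (iffP forallP) => h i; apply/eqP. Qed.

Lemma fstab1 r : 1%g \in fstab r.
Proof. by apply/fstabP => i; rewrite perm1. Qed.

Lemma fstabM r p q : p \in fstab r -> q \in fstab r -> (p * q)%g \in fstab r.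
Proof. by move=> /fstabP hp /fstabP hq; apply/fstabP => i; rewrite permM hq hp. Qed.

Lemma fstabV r p : (p^-1 \in fstab r)%g = (p \in fstab r).
Proof.
have h q : q \in fstab r -> q^-1%g \in fstab r.
  by move=> /fstabP hq; apply/fstabP => i; rewrite -[in RHS](permKV q i) hq.
by apply/idP/idP => [/h|/h //]; rewrite invgK.
Qed.

Lemma fstabMl r p q : p \in fstab r -> ((p * q)%g \in fstab r) = (q \in fstab r).
Proof.
move=> hp; apply/idP/idP => [h|]; last exact: fstabM.
by rewrite -(mulKg p q) fstabM ?fstabV.
Qed.

Lemma fstabMr r p q : p \in fstab r -> ((q * p)%g \in fstab r) = (q \in fstab r).
Proof.
move=> hp; apply/idP/idP => [h|h]; last exact: fstabM.
by rewrite -(mulgK p q) fstabM ?fstabV.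
Qed.

Definition rsym r : A := \sum_(p in fstab r) elt p.
Definition csym r : A := \sum_(q in fstab r) (-1) ^+ (odd_perm q) *: elt q.

Lemma rsymMr r p : p \in fstab r -> rsym r * elt p = rsym r.
Proof.
move=> hp; rewrite mulr_suml [RHS](reindex_inj (mulIg p)) /=.
by apply: eq_big => [q|q _]; rewrite ?fstabMr ?geltM.
Qed.

Lemma csymMl r p : p \in fstab r ->
  elt p * csym r = (-1) ^+ (odd_perm p) *: csym r.
Proof.
move=> hp; rewrite mulr_sumr scaler_sumr [RHS](reindex_inj (mulgI p)) /=.
apply: eq_big => [q|q _]; rewrite ?fstabMl // geltM odd_permM signr_addb.
by rewrite scalerA signrMK -scalerAr.
Qed.

Lemma rsym_sub r s : fstab s \subset fstab r ->
  rsym r * rsym s = #|fstab s|%:R *: rsym r.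
Proof.
move=> /fintype.subsetP ss; rewrite {2}/rsym mulr_sumr.
under eq_bigr => p /ss hp do rewrite rsymMr //.
by rewrite sumr_const -scaler_nat.
Qed.

Lemma csym_sub r s : fstab s \subset fstab r ->
  csym s * csym r = #|fstab s|%:R *: csym r.
Proof.
move=> /fintype.subsetP ss; rewrite {1}/csym mulr_suml.
under eq_bigr => p /ss hp do
  rewrite -scalerAl csymMl // scalerA -expr2 sqrr_sign scale1r.
by rewrite sumr_const -scaler_nat.
Qed.

Lemma rsym_idem r : rsym r * rsym r = #|fstab r|%:R *: rsym r.
Proof. exact: rsym_sub. Qed.
Lemma csym_idem r : csym r * csym r = #|fstab r|%:R *: csym r.
Proof. exact: csym_sub. Qed.

Lemma gstar_rsym r : gstar (rsym r) = rsym r.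
Proof.
rewrite gstar_sum [RHS](reindex_inj invg_inj) /=.
by apply: eq_big => [p|p _]; rewrite ?fstabV ?gstar_elt.
Qed.

Lemma gstar_csym r : gstar (csym r) = csym r.
Proof.
rewrite gstar_sum [RHS](reindex_inj invg_inj) /=.
apply: eq_big => [p|p _]; rewrite ?fstabV // gstarZ gstar_elt odd_permV.
by rewrite rmorph_sign.
Qed.

Lemma rsymE r p : rsym r p = (p \in fstab r)%:R.
Proof.
rewrite gsumE; have [pP|pP] := boolP (p \in fstab r).
  rewrite (bigD1 p) //= big1 => [|q /andP[_ qp]]; rewrite geltE ?eqxx ?addr0 //.
  by rewrite eq_sym (negPf qp).
by rewrite big1 // => q qP; rewrite geltE; case: eqP pP qP => // -> /negP.
Qed.

Lemma csymE r p : csym r p = (-1) ^+ (odd_perm p) *+ (p \in fstab r).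
Proof.
rewrite gsumE; have [pP|pP] := boolP (p \in fstab r).
  rewrite (bigD1 p) //= big1 => [|q /andP[_ qp]]; rewrite gscaleE geltE.
    by rewrite eqxx mulr1 addr0.
  by rewrite eq_sym (negPf qp) mulr0.
rewrite big1 // => q qP; rewrite gscaleE geltE; case: eqP pP qP => [-> /negP //|].
by rewrite mulr0.
Qed.

Lemma real_rsym r : greal (rsym r).
Proof. by move=> p; rewrite rsymE conjC_nat. Qed.
Lemma real_csym r : greal (csym r).
Proof. by move=> p; rewrite csymE rmorphMn rmorph_sign. Qed.

Lemma grealM (u v : A) : greal u -> greal v -> greal (u * v).
Proof.
move=> ru rv p; rewrite gmulE rmorph_sum; apply: eq_bigr => q _.
by rewrite rmorphM -[in RHS](ru q) -[in RHS](rv (q^-1 * p)%g).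
Qed.

(** The transposition of i and j is absorbed by the row symmetrizer with sign +1 and, once
    conjugated by g, by the column antisymmetrizer with sign -1; so the product equals its
    opposite. *)
Lemma sym_vanish r s g i j : i != j -> r i = r j -> s (g i) = s (g j) ->
  rsym r * elt g * csym s = 0.
Proof.
move=> ij rij sij; pose t := tperm i j.
have tr : t \in fstab r.
  by apply/fstabP => x; rewrite /t; case: tpermP => // ->.
have ts : (t ^ g)%g \in fstab s.
  by apply/fstabP => x; rewrite /t tpermJ; case: tpermP => // ->.
have E : rsym r * elt g * csym s = - (rsym r * elt g * csym s).
  rewrite -{1}(rsymMr tr) -(mulrA _ (elt t)) -geltM conjgC geltM mulrA.
  rewrite -(mulrA _ _ (csym s)) csymMl //.
  by rewrite odd_permJ odd_tperm ij expr1 scaleN1r mulrN.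
move: E => /eqP; rewrite -subr_eq0 opprK -mulr2n -scaler_nat scaler_eq0.
by rewrite pnatr_eq0 /= => /eqP.
Qed.

End Stabilizers.

(** * Rows and columns of the cells of a diagram *)

Section Cells.
Variables (k : nat) (l : seq nat).
Hypothesis lk : sumn l = k.

Definition crow (i : 'I_k) : nat := reshape_index l i.
Definition ccol (i : 'I_k) : nat := reshape_offset l i.

Lemma crow_lt i : (crow i < size l)%N.
Proof. by apply: reshape_indexP; rewrite lk. Qed.
Lemma ccol_lt i : (ccol i < nth 0 l (crow i))%N.
Proof. by apply: reshape_offsetP; rewrite lk. Qed.

Lemma cell_inj i j : crow i = crow j -> ccol i = ccol j -> i = j.
Proof.
rewrite /crow /ccol => rij cij; apply/val_inj => /=.
by rewrite -(reshape_indexK l i) rij cij reshape_indexK.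
Qed.

Lemma cell_ex x y : (y < nth 0 l x)%N -> exists i, crow i = x /\ ccol i = y.
Proof.
move=> yx; have h := flatten_indexP yx; rewrite lk in h.
by exists (Ordinal h); rewrite /crow /ccol /= flatten_indexKl ?flatten_indexKr.
Qed.

Lemma fstab_cellI p : p \in fstab crow -> p \in fstab ccol -> p = 1%g.
Proof.
move=> /fstabP hr /fstabP hc; apply/permP => i; rewrite perm1.
exact: cell_inj.
Qed.

Lemma card_row x t :
  #|[set i | (crow i == x) && (ccol i < t)%N]| = minn (nth 0 l x) t.
Proof.
have ex (j : 'I_(minn (nth 0 l x) t)) : exists i, (crow i == x) && (ccol i == j).
  have := ltn_ord j; rewrite leq_min => /andP[/cell_ex[i [ix iy]] _].
  by exists i; rewrite ix iy !eqxx.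
pose f j := xchoose (ex j).
have fP j : crow (f j) = x /\ ccol (f j) = j.
  by have /andP[/eqP ? /eqP ?] := xchooseP (ex j).
rewrite -[RHS](card_ord) -(@card_imset _ _ f) => [|a b ab]; last first.
  by apply/val_inj; rewrite /= -(proj2 (fP a)) ab (proj2 (fP b)).
apply: eq_card => i; rewrite inE; apply/andP/imsetP => [[/eqP ix it]|[j _ ->]].
  have h : (ccol i < minn (nth 0 l x) t)%N by rewrite leq_min it -ix ccol_lt.
  exists (Ordinal h) => //; have [e1 e2] := fP (Ordinal h).
  by apply: cell_inj; rewrite ?e1 ?e2.
have [-> ->] := fP j; split => //.
by have := ltn_ord j; rewrite leq_min => /andP[].
Qed.

Lemma card_row_pred (P : pred 'I_k) :
  #|[set i | P i]| = (\sum_(x < size l) #|[set i | (crow i == x) && P i]|)%N.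
Proof.
rewrite -sum1_card (partition_big (fun i => Ordinal (crow_lt i)) xpredT) //=.
apply: eq_bigr => x _; rewrite -sum1_card; apply: eq_bigl => i.
by rewrite !inE andbC.
Qed.

Lemma card_ccol_lt t :
  #|[set i | (ccol i < t)%N]| = (\sum_(x < size l) minn (nth 0 l x) t)%N.
Proof.
rewrite card_row_pred; apply: eq_bigr => x _.
by rewrite -card_row.
Qed.

End Cells.

(** * Von Neumann's lemma and dominance *)

Section VonNeumann.
Variables (k : nat) (l m : seq nat).
Hypotheses (lk : sumn l = k) (mk : sumn m = k).
Variable g : 'S_k.
Hypothesis ginj : forall i j, crow l i = crow l j ->
  ccol m (g i) = ccol m (g j) -> i = j.

(** By [ginj] the cells of row x go to distinct columns, so at most t of them land in the first t
    columns, and never more than the length of the row. *)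
Lemma vn_row x t : (#|[set i | (crow l i == x) && (ccol m (g i) < t)%N]|
  <= #|[set i : 'I_k | (crow l i == x) && (ccol l i < t)%N]|)%N.
Proof.
rewrite card_row // leq_min; apply/andP; split.
  rewrite -[nth _ _ _]minnn -(card_row lk); apply: subset_leq_card.
  apply/fintype.subsetP => i; rewrite !inE => /andP[/eqP <- _].
  by rewrite eqxx ccol_lt.
case: t => [|t]; first by rewrite leqn0 cards_eq0; apply/eqP/setP => i;
  rewrite !inE ltn0 andbF.
apply: (@leq_trans #|'I_t.+1|); last by rewrite card_ord.
rewrite -(@card_in_imset _ _ (fun i => inord (ccol m (g i)) : 'I_t.+1)).
  exact: max_card.
move=> i j; rewrite !inE => /andP[/eqP ix it] /andP[/eqP jx jt] /(congr1 val) /=.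
rewrite !inordK // => cij; apply: ginj => //.
by rewrite ix jx.
Qed.

Lemma card_ccol_perm t :
  #|[set i | (ccol m (g i) < t)%N]| = #|[set i : 'I_k | (ccol m i < t)%N]|.
Proof.
rewrite -(card_imset _ (@perm_inj _ g)); apply: eq_card => i; rewrite !inE.
apply/imsetP/idP => [[j]|it]; first by rewrite inE => jt ->.
by exists (g^-1%g i); rewrite ?inE permKV.
Qed.

(** Summing min(row length, t) over the rows counts the cells in the first t columns, so this is
    dominance between conjugate diagrams. The permutation g does not change the count for m. *)
Lemma vn_dominance t : (\sum_(x < size m) minn (nth 0 m x) t
  <= \sum_(x < size l) minn (nth 0 l x) t)%N.
Proof.
rewrite -(card_ccol_lt mk) -(card_ccol_lt lk) -card_ccol_perm !(card_row_pred lk).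
by apply: leq_sum => x _; exact: vn_row.
Qed.

End VonNeumann.

(** For m = l the totals in [vn_row] agree, hence so do the counts row by row. Thus the row of i is
    long enough to contain a cell in the column of g(i); the permutation p sends i to that cell, and
    the rest of g preserves columns. *)
Lemma vn_factor k l (g : 'S_k) : sumn l = k ->
  (forall i j, crow l i = crow l j -> ccol l (g i) = ccol l (g j) -> i = j) ->
  exists p q : 'S_k,
    [/\ p \in fstab (@crow k l), q \in fstab (@ccol k l) & g = (p * q)%g].
Proof.
move=> lk ginj.
have lt i : (ccol l (g i) < nth 0 l (crow l i))%N.
  set x := crow l i; set t := nth 0 l x.
  have tot : (\sum_(x < size l) #|[set i | (crow l i == x) && (ccol l (g i) < t)%N]| =
    \sum_(x < size l) #|[set i : 'I_k | (crow l i == x) && (ccol l i < t)%N]|)%N.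
    by rewrite -!(card_row_pred lk) card_ccol_perm.
  have [_] := leqif_sum (fun (x : 'I_(size l)) (_ : true) => leqif_eq (vn_row lk ginj x t)).
  rewrite tot eqxx => /esym/forallP/(_ (Ordinal (crow_lt lk i))) /=.
  rewrite eq_sym -/x => /eqP E.
  have sub : [set i | (crow l i == x) && (ccol l (g i) < t)%N] \subset
             [set i : 'I_k | (crow l i == x) && (ccol l i < t)%N].
    apply/fintype.subsetP => j; rewrite !inE => /andP[/eqP jx _]; rewrite jx eqxx.
    by rewrite /t -jx ccol_lt.
  have /eqP/setP/(_ i) : [set i | (crow l i == x) && (ccol l (g i) < t)%N] ==
             [set i : 'I_k | (crow l i == x) && (ccol l i < t)%N].
    by rewrite eqEcard sub E leqnn.
  by rewrite !inE -/x eqxx /= => ->; rewrite /t ccol_lt.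
have ex (i : 'I_k) : exists j : 'I_k,
    (crow l j == crow l i) && (ccol l j == ccol l (g i)).
  by have [j [<- <-]] := cell_ex lk (lt i); exists j; rewrite !eqxx.
pose f i := xchoose (ex i).
have fP i : crow l (f i) = crow l i /\ ccol l (f i) = ccol l (g i).
  by have /andP[/eqP ? /eqP ?] := xchooseP (ex i).
have finj : injective f.
  move=> i j ij; apply: ginj; first by rewrite -(proj1 (fP i)) ij (proj1 (fP j)).
  by rewrite -(proj2 (fP i)) ij (proj2 (fP j)).
exists (perm finj), ((perm finj)^-1 * g)%g; split; last by rewrite mulKVg.
  by apply/fstabP => i; rewrite permE; case: (fP i).
apply/fstabP => i; rewrite permM -[in RHS](permKV (perm finj) i).
by rewrite [perm finj _]permE (proj2 (fP _)).
Qed.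

(** The increments in t count the rows longer than t, and these counts determine a sorted sequence
    without zeros. *)
Lemma sum_minn_inj (l m : seq nat) :
  sorted geq l -> 0%N \notin l -> sorted geq m -> 0%N \notin m ->
  (forall t, \sum_(x < size m) minn (nth 0 m x) t =
             \sum_(x < size l) minn (nth 0 l x) t)%N -> l = m.
Proof.
move=> sl l0 sm m0 E.
have E' t : (\sum_(x <- m) minn x t = \sum_(x <- l) minn x t)%N.
  by rewrite [LHS](big_nth 0%N) [RHS](big_nth 0%N) !big_mkord.
have cnt (s : seq nat) t : (\sum_(x <- s) minn x t.+1 =
    \sum_(x <- s) minn x t + count (fun x => t < x) s)%N.
  rewrite -sum1_count [in X in (_ + X)%N]big_mkcond -big_split.
  apply: eq_bigr => x _ /=; case: ltnP => h.
    by rewrite !(minn_idPr _) ?addn1 // ltnW.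
  by rewrite !(minn_idPl _) ?addn0 // ltnW.
have gt t : count (fun x => t < x)%N l = count (fun x => t < x)%N m.
  by apply/eqP; rewrite -(eqn_add2l (\sum_(x <- l) minn x t)) -cnt -E' -E' cnt.
have split (s : seq nat) t : (count (fun x => t < x) s =
    count (fun x => t.+1 < x) s + count_mem t.+1 s)%N.
  elim: s => //= x s ->; rewrite addnACA; congr (_ + _)%N.
  by rewrite leq_eqVlt eq_sym; case: ltngtP.
apply: (@sorted_eq _ geq) => //.
- by move=> a b c /= h1 h2; apply: leq_trans h2 h1.
- by move=> a b /= h; apply/eqP; rewrite eqn_leq andbC.
apply/allP => x _ /=; case: x => [|t].
  by rewrite (count_memPn l0) (count_memPn m0).
by rewrite -(eqn_add2l (count (fun x => t.+1 < x)%N l)) -split gt split gt.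
Qed.

(* The lock prevents unification from unfolding products of symmetrizers. *)
Fact ysym_key : unit. Proof. exact: tt. Qed.

(** * Young symmetrizers and central idempotents *)

Section Symmetrizer.
Variables (C : numClosedFieldType) (k : nat).
Local Notation A := (galg C 'S_k).

Definition rowsym (l : seq nat) : A := rsym C (@crow k l).
Definition colsym (l : seq nat) : A := csym C (@ccol k l).
Definition ysym (l : seq nat) : A := locked_with ysym_key (rowsym l * colsym l).
Lemma ysymE l : ysym l = rowsym l * colsym l.
Proof. by rewrite /ysym unlock. Qed.
(* The scalar h with c * c = h c for c = ysym l, that is k! / f^l. *)
Definition yhook (l : seq nat) : C := gtrace (ysym l * ysym l).
Definition nrow (l : seq nat) : C := #|fstab (@crow k l)|%:R.
Definition ncol (l : seq nat) : C := #|fstab (@ccol k l)|%:R.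

Lemma nrow_gt0 l : 0 < nrow l.
Proof. by rewrite ltr0n; apply/card_gt0P; exists 1%g; exact: fstab1. Qed.
Lemma ncol_gt0 l : 0 < ncol l.
Proof. by rewrite ltr0n; apply/card_gt0P; exists 1%g; exact: fstab1. Qed.

Lemma rowsym_idem l : rowsym l * rowsym l = nrow l *: rowsym l.
Proof. exact: rsym_idem. Qed.
Lemma colsym_idem l : colsym l * colsym l = ncol l *: colsym l.
Proof. exact: csym_idem. Qed.
Lemma gstar_rowsym l : gstar (rowsym l) = rowsym l.
Proof. exact: gstar_rsym. Qed.
Lemma gstar_colsym l : gstar (colsym l) = colsym l.
Proof. exact: gstar_csym. Qed.
Lemma gstar_ysym l : gstar (ysym l) = colsym l * rowsym l.
Proof. by rewrite ysymE gstarM gstar_rowsym gstar_colsym. Qed.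
Lemma real_ysym l : greal (ysym l).
Proof. by rewrite ysymE; apply: grealM; [exact: real_rsym|exact: real_csym]. Qed.

Lemma ysym_trace l : sumn l = k -> gtrace (ysym l) = 1.
Proof.
move=> lk; rewrite /gtrace ysymE gmulE (bigD1 1%g) //= big1 => [|p p1].
  by rewrite invg1 mul1g rsymE csymE !fstab1 odd_perm1 addr0 mulr1.
rewrite mulg1 rsymE csymE fstabV; have [pr|] := boolP (_ \in _); last by rewrite mul0r.
rewrite mul1r; have [pc|] := boolP (_ \in _); last by [].
by move: p1; rewrite (fstab_cellI pr pc) eqxx.
Qed.

Definition collide (l m : seq nat) (g : 'S_k) :=
  [exists i : 'I_k, exists j : 'I_k,
    [&& i != j, crow l i == crow l j & ccol m (g i) == ccol m (g j)]].

Lemma collide_vanish l m g : collide l m g -> rowsym l * gelt C g * colsym m = 0.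
Proof.
move=> /existsP[i /existsP[j /and3P[ij /eqP rij /eqP cij]]].
exact: sym_vanish ij rij cij.
Qed.

Lemma ncollide l m g : ~~ collide l m g ->
  forall i j : 'I_k, crow l i = crow l j -> ccol m (g i) = ccol m (g j) -> i = j.
Proof.
move=> /existsPn h i j rij cij; apply/eqP; apply: contraT => ij.
by have /existsPn/(_ j) := h i; rewrite ij rij cij !eqxx.
Qed.

Lemma sandwich (l m : seq nat) (u : A) :
  rowsym l * u * colsym m = \sum_g u g *: (rowsym l * gelt C g * colsym m).
Proof.
move: (rowsym l) (colsym m) => a b.
rewrite {1}(gelt_sum u) mulr_sumr mulr_suml; apply: eq_bigr => g _.
by rewrite -scalerAr -scalerAl.
Qed.

(** By linearity u is a permutation g. Either g collides and contributes 0, or [vn_factor] writes it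
    as p q and both factors are absorbed, leaving the symmetrizer up to sign. *)
Lemma ysym_sandwich l (u : A) : sumn l = k ->
  rowsym l * u * colsym l = gtrace (rowsym l * u * colsym l) *: ysym l.
Proof.
move=> lk; rewrite sandwich gtrace_sum scaler_suml; apply: eq_bigr => g _.
rewrite gtraceZ -scalerA; congr (_ *: _).
have [/collide_vanish ->|/ncollide/(vn_factor lk)[p [q [hp hq ->]]]] :=
  boolP (collide l l g); first by rewrite gtrace0 scale0r.
have -> : rowsym l * gelt C (p * q)%g * colsym l = (-1) ^+ (odd_perm q) *: ysym l.
  rewrite geltM -mulrA -(mulrA _ (gelt C q)) csymMl // -scalerAr -scalerAr mulrA.
  by rewrite rsymMr // ysymE.
by rewrite gtraceZ ysym_trace // mulr1.
Qed.

Lemma ysymM_scalar l (u : A) : sumn l = k ->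
  ysym l * u * ysym l = gtrace (ysym l * u * ysym l) *: ysym l.
Proof.
move=> lk; have -> : ysym l * u * ysym l = rowsym l * (colsym l * u * rowsym l) * colsym l.
  by rewrite ysymE !mulrA.
exact: ysym_sandwich.
Qed.

Lemma ysym_idem l : sumn l = k -> ysym l * ysym l = yhook l *: ysym l.
Proof. by move=> lk; have := ysymM_scalar 1 lk; rewrite mulr1. Qed.

(** If neither product vanished, noncolliding permutations in both directions would give dominance
    both ways, hence l = m. Which order vanishes depends on l and m, whence the disjunction. *)
Lemma ysym_orth_sym l m : sumn l = k -> sumn m = k ->
  sorted geq l -> 0%N \notin l -> sorted geq m -> 0%N \notin m -> l != m ->
  (forall u : A, rowsym l * u * colsym m = 0) \/
  (forall u : A, rowsym m * u * colsym l = 0).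
Proof.
move=> lk mk sl l0 sm m0 lm.
have key a b : [forall g, collide a b g] -> forall u : A, rowsym a * u * colsym b = 0.
  move=> /forallP h u; rewrite sandwich big1 // => g _.
  by rewrite collide_vanish ?scaler0.
have [/key|/forallPn[g /ncollide hg]] := boolP [forall g, collide l m g]; first by left.
have [/key|/forallPn[g' /ncollide hg']] := boolP [forall g, collide m l g]; first by right.
case/eqP: lm; apply: sum_minn_inj => // t; apply/eqP; rewrite eqn_leq.
by rewrite (vn_dominance lk mk hg) (vn_dominance mk lk hg').
Qed.

(** Source of all positivity: under [gavg] factors rotate cyclically, so the symmetrizer, which need
    not be self-adjoint, may be traded for a multiple of c times its adjoint. *)
Lemma ysym_avgE l : gavg (ysym l) = (nrow l * ncol l)^-1 *: gavg (ysym l * gstar (ysym l)).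
Proof.
have h : nrow l * ncol l != 0 by rewrite mulf_neq0 ?gt_eqF ?nrow_gt0 ?ncol_gt0.
apply: (scalerI h); rewrite scalerA mulfV // scale1r gstar_ysym.
rewrite (mulrA (ysym l)) gavgC ysymE.
have -> : rowsym l * (rowsym l * colsym l * colsym l) =
    (rowsym l * rowsym l) * (colsym l * colsym l) by rewrite !mulrA.
by rewrite rowsym_idem colsym_idem -scalerAr -scalerAl scalerA gavgZ mulrC.
Qed.

Lemma ysym_avgE' l : gavg (ysym l) = (nrow l * ncol l)^-1 *: gavg (gstar (ysym l) * ysym l).
Proof. by rewrite ysym_avgE gavgC. Qed.

Lemma gstar_avg (u : A) : gstar (gavg u) = gavg (gstar u).
Proof.
rewrite gstar_sum; apply: eq_bigr => x _.
by rewrite !gstarM !gstar_elt invgK mulrA.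
Qed.

Lemma gstar_avg_ysym l : gstar (gavg (ysym l)) = gavg (ysym l).
Proof. by rewrite gstar_avg gstar_ysym gavgC -ysymE. Qed.

Section Hook.
Variables (l : seq nat).
Hypothesis lk : sumn l = k.
Hypothesis h_gt0 : 0 < yhook l.
Let h0 : yhook l != 0. Proof. by rewrite gt_eqF. Qed.

(** A form of Schur's lemma: with c the symmetrizer and h its hook scalar, h c z = c c z = c z c,
    which is a multiple of c. *)
Lemma ysym_central (z : A) : gcentral z ->
  ysym l * z = gtrace (ysym l * z) *: ysym l.
Proof.
move=> cz; apply: (scalerI h0).
have E : yhook l *: (ysym l * z) = ysym l * z * ysym l.
  by rewrite scalerAl -ysym_idem // -(mulrA _ z) cz mulrA.
rewrite E ysymM_scalar // scalerA; congr (_ *: _).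
by rewrite -E gtraceZ.
Qed.

Lemma ysym_avg_ysym : ysym l * gavg (ysym l) = yhook l ^+ 2 *: ysym l.
Proof.
rewrite ysym_central; last exact: gavg_central.
congr (_ *: _); rewrite /gavg mulr_sumr gtrace_sum.
(* The sandwich of [gelt x^-1] between two symmetrizers is a multiple of the symmetrizer, so a
   further factor [gelt x] under the trace only evaluates it at [x^-1]. Summed over x, these values
   reassemble the symmetrizer. *)
have E (x : 'S_k) : gtrace (ysym l * (gelt C x^-1 * ysym l * gelt C x)) =
    gtrace (ysym l * (ysym l (x^-1)%g *: gelt C x^-1) * ysym l).
  rewrite !mulrA ysymM_scalar // -scalerAl gtraceZ.
  rewrite -scalerAr -scalerAl gtraceZ mulrC; congr (_ * _).
  by rewrite gtraceC /gtrace geltMl mulg1.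
under eq_bigr => x _ do rewrite E.
rewrite -gtrace_sum -mulr_suml -mulr_sumr.
have -> : \sum_(x : 'S_k) ysym l (x^-1)%g *: gelt C x^-1 = ysym l.
  by rewrite {2}(gelt_sum (ysym l)) [RHS](reindex_inj invg_inj).
rewrite ysym_idem // -scalerAl ysym_idem // !gtraceZ ysym_trace //.
by rewrite mulr1 expr2.
Qed.

(** The irreducible character of S_k as an element of the algebra. One more division by the hook
    scalar k!/f^l makes it the central idempotent [yidem]. *)
Definition ychar : A := (yhook l)^-1 *: gavg (ysym l).
Definition yidem : A := (yhook l)^-1 *: ychar.

Lemma ychar_central : gcentral ychar.
Proof.
by move=> u; rewrite -scalerAl -scalerAr gavg_central.
Qed.

Lemma yidem_central : gcentral yidem.
Proof. by move=> u; rewrite -scalerAl -scalerAr ychar_central. Qed.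

Lemma ysym_yidem : ysym l * yidem = ysym l.
Proof.
rewrite -scalerAr -scalerAr ysym_avg_ysym !scalerA -expr2 exprVn mulVf ?scale1r //.
by rewrite expf_neq0.
Qed.

Lemma yidem_idem : yidem * yidem = yidem.
Proof.
rewrite {1}/yidem /ychar -!scalerAl -yidem_central -gavg_mull; last exact: yidem_central.
by rewrite yidem_central ysym_yidem.
Qed.

Lemma yhook_real : (yhook l)^* = yhook l.
Proof. by apply: conj_Creal; apply: gtr0_real. Qed.

Lemma gstar_yidem : gstar yidem = yidem.
Proof. by rewrite !gstarZ gstar_avg_ysym !fmorphV /= yhook_real. Qed.

Lemma ychar_trace : gtrace ychar = (k`!)%:R / yhook l.
Proof. by rewrite gtraceZ gtrace_avg ysym_trace // mulr1 mulrC card_Sn. Qed.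

Lemma ychar_trace_gt0 : 0 < gtrace ychar.
Proof. by rewrite ychar_trace divr_gt0 // ltr0n fact_gt0. Qed.

Lemma yidem_trace : gtrace yidem = gtrace ychar ^+ 2 / (k`!)%:R.
Proof.
have k0 : (k`!)%:R != 0 :> C by rewrite pnatr_eq0 -lt0n fact_gt0.
rewrite gtraceZ ychar_trace; move: (k`!)%:R k0 => K k0.
by rewrite expr_div_n mulrAC expr2 mulfK // mulrCA -invfM expr2.
Qed.

Lemma real_ychar : greal ychar.
Proof.
move=> x; rewrite gscaleE rmorphM fmorphV /= yhook_real; congr (_ * _).
rewrite gavgE rmorph_sum; apply: eq_bigr => y _; exact: real_ysym.
Qed.

Lemma ychar_star : gstar ychar = ychar.
Proof. by rewrite gstarZ gstar_avg_ysym fmorphV /= yhook_real. Qed.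

Lemma gpair_ychar (u : A) : gpair ychar u = gtrace (ychar * u).
Proof.
have -> : gpair ychar u = gpair u ychar by apply: eq_bigr => x _; rewrite mulrC.
by rewrite (gpair_trace _ real_ychar) ychar_star; exact: gtraceC.
Qed.

(** Positive definiteness as an explicit sum of squared norms, so that strict positivity follows
    from a single nonzero term. *)
Lemma gpair_ychar_star (w : A) :
  gpair ychar (w * gstar w) = (yhook l * (nrow l * ncol l))^-1 *
     \sum_x gtrace (ysym l * gelt C x * w * gstar (ysym l * gelt C x * w)).
Proof.
rewrite gpair_ychar -scalerAl gtraceZ ysym_avgE' -scalerAl gtraceZ mulrA -invfM.
congr (_ * _); rewrite mulr_suml gtrace_sum; apply: eq_bigr => x _.
rewrite 2!gstarM gstar_elt; move: (ysym l) (gelt C x) (gelt C x^-1) => c y z.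
transitivity (gtrace ((z * gstar c) * (c * y * w * gstar w))).
  by rewrite !mulrA.
by rewrite gtraceC !mulrA.
Qed.

(** A class function allows cyclic rotation, which turns R C C R into R R C C; so pairing with the
    symmetrizer is, up to a positive factor, pairing with a positive element. *)
Lemma gpair_ysym_star theta : class_fun theta ->
  gpair theta (ysym l * gstar (ysym l)) = (nrow l * ncol l) * gpair theta (ysym l).
Proof.
move=> ct; rewrite gstar_ysym mulrA gpairC // ysymE !mulrA rowsym_idem -!scalerAl -mulrA.
by rewrite colsym_idem -scalerAr scalerA gpairZ.
Qed.

Lemma gpair_ysym_ge0 theta : class_fun theta -> pos_def theta ->
  0 <= gpair theta (ysym l).
Proof.
move=> ct pt; have := pt (ysym l); rewrite gpair_ysym_star //.
by rewrite pmulr_rge0 ?mulr_gt0 ?nrow_gt0 ?ncol_gt0.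
Qed.

End Hook.
End Symmetrizer.

(** * The irreducible characters of R_n as matrix traces *)

Lemma quasi_idem_base (F : fieldType) n (E : 'M[F]_n) (h : F) :
  E *m E = h *: E -> row_base E *m col_base E = h%:M.
Proof.
move=> EE; apply: (row_full_inj (col_base_full E)).
apply: (row_free_inj (row_base_free E)).
rewrite /mulmxr mulmxA mulmx_base -mulmxA mulmx_base EE.
by rewrite mul_mx_scalar -scalemxAl mulmx_base.
Qed.

Lemma mxtrace_quasi_idem (F : fieldType) n (E : 'M[F]_n) (h : F) :
  E *m E = h *: E -> \tr E = h * (\rank E)%:R.
Proof.
move=> EE; have RC := quasi_idem_base EE.
by rewrite -{1}(mulmx_base E) mxtrace_mulC RC mxtrace_scalar mulr_natr.
Qed.

(** Removes [restrictmx], hence the chosen basis of the image: E / h is a projection onto the image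
    commuting with A. *)
Lemma mxtrace_restrict (F : fieldType) n (E A : 'M[F]_n) (h : F) :
  h != 0 -> E *m E = h *: E -> E *m A = A *m E ->
  \tr (restrictmx E A) = h^-1 * \tr (E *m A).
Proof.
move=> h0 EE EA; have RC := quasi_idem_base EE.
have sub : (row_base E *m A <= row_base E)%MS.
  rewrite (eqmxMr A (eq_row_base E)) EA (submx_trans (submxMl A E)) //.
  by rewrite eq_row_base.
have ER : restrictmx E A *m row_base E = row_base E *m A.
  by rewrite /conjmx mulmxKpV.
have -> : E *m A = col_base E *m (row_base E *m A) by rewrite mulmxA mulmx_base.
rewrite -ER [in RHS]mxtrace_mulC -[in RHS]mulmxA RC.
by rewrite mul_mx_scalar mxtraceZ mulrA mulVf // mul1r.
Qed.

(** * The action of C[S_k] on injections *)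

Section Injections.
Variables (R : realType) (n : nat) (l : ydiag).
Local Notation k := (ncells l).
Local Notation I := (injections n l).
Local Notation N := #|{: injections n l}|.
Local Notation C := R[i].
Local Notation A := (galg C 'S_k).
Local Notation "f @" := (injection_at f) (at level 2).

Definition ifun (f : I) : 'I_k -> 'I_n := val f.

Lemma ifun_inj (f : I) : injective (ifun f).
Proof. by apply/injectiveP; exact: (valP f). Qed.

Lemma ifunP (f f' : I) : ifun f =1 ifun f' -> f = f'.
Proof. by move=> h; apply/val_inj/ffunP. Qed.

Lemma icomp_subproof (f : I) (g : 'S_k) : injectiveb ([ffun i => ifun f (g i)] : {ffun 'I_k -> 'I_n}).
Proof.
by apply/injectiveP => i j; rewrite !ffunE => /ifun_inj/perm_inj.
Qed.

Definition icomp (f : I) (g : 'S_k) : I :=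
  exist (fun f : {ffun 'I_k -> 'I_n} => injectiveb f) _ (icomp_subproof f g).

Lemma icompE f g i : ifun (icomp f g) i = ifun f (g i).
Proof. by rewrite /ifun /= ffunE. Qed.

Lemma icompM f g h : icomp f (g * h) = icomp (icomp f h) g.
Proof. by apply: ifunP => i; rewrite !icompE permM. Qed.

Lemma icomp1 f : icomp f 1 = f.
Proof. by apply: ifunP => i; rewrite !icompE perm1. Qed.

Lemma icompK g : cancel (icomp^~ g) (icomp^~ g^-1%g).
Proof. by move=> f; rewrite -icompM mulVg icomp1. Qed.

Lemma sum_enum (F : I -> C) : \sum_(a < N) F (enum_val a) = \sum_f F f.
Proof. by rewrite [RHS](reindex_onto (@enum_val _ _) enum_rank) /=; [apply: eq_bigl => a; rewrite enum_valK eqxx | move=> a _; rewrite enum_rankK]. Qed.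

Definition moves (x : Rinf) (f f' : I) : bool :=
  [forall i, x (ifun f i) == Some (ifun f' i : nat)].

Lemma action_mxE x a b : action_mx R n l x a b =
  (moves x (enum_val a) (enum_val b))%:R.
Proof. by rewrite mxE. Qed.

(** On row vectors g acts by precomposition with its inverse, which makes [rho] multiplicative
    rather than antimultiplicative. *)
Definition rho (u : A) : 'M[C]_N :=
  \matrix_(a, b) \sum_g u g * (enum_val a == icomp (enum_val b) g)%:R.

Lemma rhoE u a b : rho u a b =
  \sum_g u g * (enum_val a == icomp (enum_val b) g)%:R.
Proof. by rewrite mxE. Qed.

Lemma rhoZ c u : rho (c *: u) = c *: rho u.
Proof.
apply/matrixP => a b; rewrite !mxE mulr_sumr.
by apply: eq_bigr => g _; rewrite gscaleE mulrA.
Qed.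

Lemma rhoM u v : rho (u * v) = rho u *m rho v.
Proof.
apply/matrixP => a b; rewrite !mxE.
under [RHS]eq_bigr => d _ do rewrite !rhoE.
rewrite (sum_enum (fun f => (\sum_g u g * (enum_val a == icomp f g)%:R) *
  (\sum_g v g * (f == icomp (enum_val b) g)%:R))).
under [RHS]eq_bigr => f _ do rewrite mulr_sumr.
rewrite exchange_big /=.
have E h : \sum_(f : I) (\sum_g u g * (enum_val a == icomp f g)%:R) *
  (v h * (f == icomp (enum_val b) h)%:R) = \sum_g u g * v h * (enum_val a == icomp (enum_val b) (g * h)%g)%:R.
  rewrite (bigD1 (icomp (enum_val b) h)) //= [X in _ + X]big1 => [|f fn]; last by rewrite (negPf fn) !mulr0.
  rewrite eqxx mulr1 addr0 mulr_suml; apply: eq_bigr => g _.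
  by rewrite mulrAC icompM.
under [RHS]eq_bigr => h _ do rewrite E.
rewrite exchange_big /=.
transitivity (\sum_g \sum_h u g * v (g^-1 * h)%g * (enum_val a == icomp (enum_val b) h)%:R).
  rewrite exchange_big /=; apply: eq_bigr => h _.
  by rewrite gmulE mulr_suml.
apply: eq_bigr => g _; rewrite (reindex_inj (mulgI g)) /=.
by apply: eq_bigr => h _; rewrite mulKg.
Qed.

Lemma moves_icomp x f f' g : moves x (icomp f g) (icomp f' g) = moves x f f'.
Proof.
apply/forallP/forallP => h i; last by rewrite !icompE.
by have := h (g^-1%g i); rewrite !icompE permKV.
Qed.

Lemma moves_icompV x f f' g :
  moves x f (icomp f' g) = moves x (icomp f g^-1) f'.
Proof. by rewrite -[in RHS](moves_icomp _ _ _ g) -icompM mulgV icomp1. Qed.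

Lemma rho_action u x : rho u *m action_mx R n l x = action_mx R n l x *m rho u.
Proof.
apply/matrixP => a b; rewrite !mxE.
under eq_bigr => d _ do rewrite rhoE action_mxE.
under [RHS]eq_bigr => d _ do rewrite rhoE action_mxE.
rewrite (sum_enum (fun f => (\sum_g u g * (enum_val a == icomp f g)%:R) *
  (moves x f (enum_val b))%:R)).
rewrite (sum_enum (fun f => (moves x (enum_val a) f)%:R *
  (\sum_g u g * (f == icomp (enum_val b) g)%:R))).
under eq_bigr => f _ do rewrite mulr_suml.
under [RHS]eq_bigr => f _ do rewrite mulr_sumr.
rewrite exchange_big [RHS]exchange_big; apply: eq_bigr => g _ /=.
rewrite (bigD1 (icomp (enum_val a) g^-1)) //= [X in _ + X]big1 => [|f hf]; last first.
  case: eqP => [E|_]; last by rewrite mulr0 mul0r.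
  by move: hf; rewrite E -icompM mulVg icomp1 eqxx.
rewrite [RHS](bigD1 (icomp (enum_val b) g)) //= [X in _ = _ + X]big1 => [|f fn]; last by rewrite (negPf fn) !mulr0.
by rewrite -icompM mulgV icomp1 !eqxx !mulr1 !addr0 moves_icompV mulrC.
Qed.

Lemma trace_rho_action u x : \tr (rho u *m action_mx R n l x) =
  \sum_(f : I) \sum_g u g * (moves x f (icomp f g))%:R.
Proof.
transitivity (\sum_(f : I) \sum_(f' : I) \sum_g u g * (f == icomp f' g)%:R * (moves x f' f)%:R).
  rewrite /mxtrace -sum_enum; apply: eq_bigr => a _; rewrite mxE -sum_enum.
  by apply: eq_bigr => b _; rewrite rhoE action_mxE mulr_suml.
rewrite exchange_big; apply: eq_bigr => f' _ /=.
rewrite exchange_big; apply: eq_bigr => g _ /=.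
rewrite (bigD1 (icomp f' g)) //= [X in _ + X]big1 => [|f fn]; last by rewrite (negPf fn) mulr0 mul0r.
by rewrite eqxx mulr1 addr0.
Qed.

Lemma young_mxE : young_symmetrizer_mx R n l = rho (ysym C k (val l)).
Proof.
apply/matrixP => a b; rewrite !mxE.
have [e c] := (enum_val a, enum_val b).
have -> : \sum_g ysym C k (val l) g * (enum_val a == icomp (enum_val b) g)%:R =
  \sum_(p in fstab (@crow k (val l))) \sum_(q in fstab (@ccol k (val l)))
     (-1) ^+ odd_perm q * (enum_val a == icomp (enum_val b) (p * q)%g)%:R :> C.
  transitivity (gpair (fun g => (enum_val a == icomp (enum_val b) g)%:R : C) (ysym C k (val l))).
    by apply: eq_bigr => g _; rewrite mulrC.
  rewrite ysymE /rowsym /colsym {1}/rsym mulr_suml gpair_sum; apply: eq_bigr => p _.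
  rewrite mulr_sumr gpair_sum; apply: eq_bigr => q _.
  by rewrite -scalerAr -geltM gpairZ gpair_elt.
(* The defining matrix expresses b through a, while [rho] expresses a through b; inversion passes
   from one to the other and preserves both stabilizers and the sign. *)
rewrite [RHS](reindex_inj invg_inj); apply: eq_big => [p|p _]; first by rewrite fstabV; rewrite !inE.
rewrite [RHS](reindex_inj invg_inj); apply: eq_big => [q|q _]; first by rewrite fstabV; rewrite !inE.
rewrite odd_permV; congr (_ * (nat_of_bool _)%:R).
rewrite -invMg; apply/forallP/eqP => [h|h i].
  apply: ifunP => i; rewrite icompE.
  have /eqP := h ((q * p)^-1%g i); rewrite -(permM q p) permKV.
  by move=> E; rewrite -[LHS]/(a @ i) -E.
have E : enum_val b = icomp (enum_val a) (q * p)%g by rewrite h -icompM mulgV icomp1.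
by rewrite -[b @ i]/(ifun (enum_val b) i) E icompE permM.
Qed.

End Injections.

Lemma ydiagP (l : ydiag) : sorted geq (val l) /\ 0%N \notin val l.
Proof. by have /andP[] := valP l. Qed.

Lemma Rn_lt n (x : Rinf) i j : Rn n x -> x i = Some j -> (j < n)%N = (i < n)%N.
Proof.
move=> xn xi; apply/idP/idP => h; rewrite ltnNge; apply/negP => ge.
  by move: xi; rewrite (xn _ ge) => -[E]; move: h; rewrite -E ltnNge ge.
have := Rinf_inj xi (xn _ ge) => E.
by move: h; rewrite E ltnNge ge.
Qed.

Lemma Rn_mul n (x y : Rinf) : Rn n x -> Rn n y -> Rn n (x * y)%g.
Proof. by move=> xn yn i ni; rewrite [LHS]RmulE yn //= xn. Qed.

Lemma Rn_inv n (x : Rinf) : Rn n x -> Rn n (x^-1)%g.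
Proof. by move=> xn i ni; apply/RinvE; exact: xn. Qed.

Lemma Rn_le m n (x : Rinf) : (m <= n)%N -> Rn m x -> Rn n x.
Proof. by move=> mn xm i ni; apply: xm; apply: leq_trans ni. Qed.

(** * Permutations as elements of R_n *)

Definition perm_fun n (s : 'S_n) (i : nat) : option nat :=
  if insub i is Some j then Some (s j : nat) else Some i.

Lemma perm_funE n (s : 'S_n) (i : 'I_n) : perm_fun s i = Some (s i : nat).
Proof. by rewrite /perm_fun valK. Qed.

Lemma perm_fun_ge n (s : 'S_n) i : (n <= i)%N -> perm_fun s i = Some i.
Proof. by move=> ni; rewrite /perm_fun insubN // -leqNgt. Qed.

Lemma perm_fun_pred n (s : 'S_n) : Rinf_pred (perm_fun s).
Proof.
apply/asboolP; split=> [i j m|]; last by exists n; exact: perm_fun_ge.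
have [ni|ni] := ltnP i n; have [nj|nj] := ltnP j n.
- rewrite (erefl : i = val (Ordinal ni)) (erefl : j = val (Ordinal nj)) !perm_funE.
  by move=> [<-] [/val_inj/perm_inj ->].
- rewrite (erefl : i = val (Ordinal ni)) perm_funE perm_fun_ge // => -[<-] [E].
  by move: nj; rewrite E leqNgt ltn_ord.
- rewrite (erefl : j = val (Ordinal nj)) perm_funE perm_fun_ge // => -[<-] [E].
  by move: ni; rewrite -E leqNgt ltn_ord.
- by rewrite !perm_fun_ge // => -[->] [->].
Qed.

Definition Rperm n (s : 'S_n) : Rinf := exist Rinf_pred _ (perm_fun_pred s).

Lemma RpermE n (s : 'S_n) (i : 'I_n) : Rperm s i = Some (s i : nat).
Proof. exact: perm_funE. Qed.

Lemma Rperm_ge n (s : 'S_n) i : (n <= i)%N -> Rperm s i = Some i.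
Proof. exact: perm_fun_ge. Qed.

Lemma Rn_perm n (s : 'S_n) : Rn n (Rperm s).
Proof. by move=> i; exact: Rperm_ge. Qed.

(** The order is reversed: products in ['S_n] are read from left to right, those of [Rinf] are
    compositions of functions. *)
Lemma RpermM n (s t : 'S_n) : Rperm (s * t) = (Rperm t * Rperm s)%g.
Proof.
apply: RinfP => i; rewrite [RHS]RmulE; have [ni|ni] := ltnP i n.
  by rewrite (erefl : i = val (Ordinal ni)) !RpermE /= RpermE permM.
by rewrite !Rperm_ge //= Rperm_ge.
Qed.

Lemma Rperm1 n : Rperm (1 : 'S_n) = 1%g.
Proof.
apply: RinfP => i; have [ni|ni] := ltnP i n; last by rewrite Rperm_ge.
by rewrite (erefl : i = val (Ordinal ni)) RpermE perm1.
Qed.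

Lemma RpermV n (s : 'S_n) : Rperm s^-1 = (Rperm s)^-1%g.
Proof.
apply: RinfP => i; apply: option_ext => j.
split.
  move=> h; apply/RinvE; have [ni|ni] := ltnP i n.
    move: h; rewrite (erefl : i = val (Ordinal ni)) RpermE => -[<-].
    by rewrite RpermE permKV.
  by move: h; rewrite Rperm_ge // => -[<-]; rewrite Rperm_ge.
move/RinvE; have [nj|nj] := ltnP j n.
  rewrite (erefl : j = val (Ordinal nj)) RpermE => -[<-].
  by rewrite RpermE permK.
by rewrite Rperm_ge // => -[<-]; rewrite Rperm_ge.
Qed.

(** * Adjoint matrices *)

Section MatrixAdjoint.
Variable C : numClosedFieldType.

Definition mxadj m n (M : 'M[C]_(m, n)) : 'M[C]_(n, m) :=
  \matrix_(i, j) (M j i)^*.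

Lemma mxadjM m n p (M : 'M[C]_(m, n)) (N : 'M[C]_(n, p)) :
  mxadj (M *m N) = mxadj N *m mxadj M.
Proof.
apply/matrixP => i j; rewrite !mxE rmorph_sum; apply: eq_bigr => k _.
by rewrite !mxE rmorphM mulrC.
Qed.

Lemma mxadjZ m n a (M : 'M[C]_(m, n)) : mxadj (a *: M) = a^* *: mxadj M.
Proof. by apply/matrixP => i j; rewrite !mxE rmorphM. Qed.

Lemma mxadjK m n (M : 'M[C]_(m, n)) : mxadj (mxadj M) = M.
Proof. by apply/matrixP => i j; rewrite !mxE conjCK. Qed.

Lemma mxadj_sum m n I (r : seq I) (F : I -> 'M[C]_(m, n)) :
  mxadj (\sum_(i <- r) F i) = \sum_(i <- r) mxadj (F i).
Proof.
apply/matrixP => i j; rewrite !mxE !summxE rmorph_sum.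
by apply: eq_bigr => a _; rewrite mxE.
Qed.

Lemma mxtrace_adj_ge0 m n (M : 'M[C]_(m, n)) : 0 <= \tr (M *m mxadj M).
Proof.
apply: sumr_ge0 => i _; rewrite mxE; apply: sumr_ge0 => j _.
by rewrite !mxE mul_conjC_ge0.
Qed.

End MatrixAdjoint.

Section IrrCharacter.
Variables (R : realType) (n : nat) (l : ydiag).
Local Notation k := (ncells l).
Local Notation I := (injections n l).
Local Notation N := #|{: injections n l}|.
Local Notation C := R[i].
Local Notation A := (galg C 'S_k).
Local Notation c := (ysym C k (val l)).
Local Notation h := (yhook C k (val l)).
Local Notation E := (young_symmetrizer_mx R n l).
Local Notation act := (action_mx R n l).

Lemma lk : sumn (val l) = k. Proof. by []. Qed.

Lemma young_mx_idem : E *m E = h *: E.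
Proof. by rewrite young_mxE -rhoM -rhoZ ysym_idem. Qed.

(** The order is reversed because matrices act on row vectors. The intermediate injection is unique,
    and it takes its values below n because y belongs to R_n. *)
Lemma action_mxM x y : Rn n x -> Rn n y -> act (x * y)%g = act y *m act x.
Proof.
move=> xn yn; apply/matrixP => a b; rewrite action_mxE mxE.
under eq_bigr => d _ do rewrite !action_mxE.
rewrite (sum_enum (fun f => (moves y (enum_val a) f)%:R *
  (moves x f (enum_val b))%:R)).
have [/existsP[d yd]|] := boolP [exists d, moves y (enum_val a) d]; last first.
  move=> /existsPn nd; rewrite big1 => [|d _]; last by rewrite (negPf (nd d)) mul0r.
  suff /negPf-> : ~~ moves (x * y)%g (enum_val a) (enum_val b) by [].
  apply/negP => /forallP h.
  have ex (i : 'I_k) : exists j : 'I_n, y (ifun (enum_val a) i) == Some (j : nat).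
    have := h i; rewrite [X in X == _]RmulE.
    case Ey: (y _) => [j|//] /= _; have jn : (j < n)%N by rewrite (Rn_lt yn Ey) ltn_ord.
    by exists (Ordinal jn).
  pose d0 i := xchoose (ex i); have dP i := eqP (xchooseP (ex i)).
  have dinj : injectiveb ([ffun i => d0 i] : {ffun 'I_k -> 'I_n}).
    apply/injectiveP => i j; rewrite !ffunE => ij.
    have := dP i; rewrite -/(d0 i) ij => yi; have := dP j; rewrite -/(d0 j) => yj.
    by have /val_inj/ifun_inj := Rinf_inj yi yj.
  have /negP[] := nd (exist (fun f : {ffun 'I_k -> 'I_n} => injectiveb f) _ dinj).
  by apply/forallP => i; rewrite /ifun /= ffunE; apply/eqP; exact: dP.
rewrite (bigD1 d) //= big1 => [|f fd].
  rewrite yd mul1r addr0; congr (nat_of_bool _)%:R.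
  have yE i : y (ifun (enum_val a) i) = Some (ifun d i : nat).
    exact/eqP/(forallP yd).
  by apply: eq_forallb => i; rewrite [X in X == _]RmulE yE.
suff /negPf-> : ~~ moves y (enum_val a) f by rewrite mul0r.
apply: contra fd => /forallP yf; apply/eqP/ifunP => i; apply: val_inj.
by have := forallP yd i; rewrite (eqP (yf i)) => /eqP[].
Qed.

Lemma action_mxV x : act (x^-1)%g = mxadj (act x).
Proof.
apply/matrixP => a b; rewrite action_mxE mxE action_mxE conjC_nat.
congr (nat_of_bool _)%:R; apply: eq_forallb => i.
by apply/eqP/eqP => /RinvE.
Qed.

Lemma rho_adj (u : A) : mxadj (rho n u) = rho n (gstar u).
Proof.
apply/matrixP => a b; rewrite mxE !rhoE rmorph_sum [RHS](reindex_inj invg_inj).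
apply: eq_bigr => g _ /=; rewrite rmorphM rmorph_nat gstarE invgK; congr (_ * (nat_of_bool _)%:R).
by apply/eqP/eqP => ->; rewrite -icompM ?mulVg ?mulgV icomp1.
Qed.

End IrrCharacter.

(** * Positivity of the hook scalar *)

Section HookPositive.
Variables (R : realType) (l : ydiag).
Local Notation k := (ncells l).
Local Notation C := R[i].

Lemma iid_subproof : injectiveb ([ffun i => i] : {ffun 'I_k -> 'I_k}).
Proof. by apply/injectiveP => i j; rewrite !ffunE. Qed.

Definition iid : injections k l :=
  exist (fun f : {ffun 'I_k -> 'I_k} => injectiveb f) _ iid_subproof.

Lemma moves1 n (f f' : injections n l) : moves 1%g f f' = (f == f').
Proof.
apply/forallP/eqP => [hf|-> i //].
by apply: ifunP => i; apply: val_inj; have /eqP[] := hf i.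
Qed.

Lemma icomp_fixed n (f : injections n l) (g : 'S_k) : (f == icomp f g) = (g == 1%g).
Proof.
apply/eqP/eqP => [E|->]; last by rewrite icomp1.
by apply/permP => i; rewrite perm1; apply: (@ifun_inj _ _ f); rewrite -icompE -E.
Qed.

(** The trace of the symmetrizer acting on the bijections is computed twice: only the identity has
    fixed points, which gives the number of bijections, and quasi-idempotence gives the hook scalar
    times a rank. *)
Lemma yhook_gt0 : 0 < yhook C k (val l).
Proof.
set h := yhook _ _ _; set E := rho k (ysym C k (val l)).
have EE : E *m E = h *: E by rewrite -rhoM -rhoZ ysym_idem.
have act1 : action_mx R k l 1%g = 1%:M.
  by apply/matrixP => a b; rewrite action_mxE moves1 mxE (inj_eq enum_val_inj).
have := trace_rho_action k (ysym C k (val l)) 1%g.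
rewrite act1 mulmx1 -/E (mxtrace_quasi_idem EE).
have -> : \sum_(f : injections k l) \sum_g ysym C k (val l) g * (moves 1%g f (icomp f g))%:R
    = #|{: injections k l}|%:R.
  rewrite -sum1_card natr_sum; apply: eq_bigr => f _.
  rewrite (bigD1 1%g) //= big1 => [|g g1]; last first.
    by rewrite moves1 icomp_fixed (negPf g1) mulr0.
  have := ysym_trace C (lk l); rewrite /gtrace => ->.
  by rewrite moves1 icomp1 eqxx mulr1 addr0.
move=> rk; have N0 : (0 < #|{: injections k l}|)%N by apply/card_gt0P; exists iid.
have r0 : (0 : C) < (\rank E)%:R.
  rewrite ltr0n lt0n; apply: contraTneq N0 => r0.
  by move: rk => /eqP; rewrite r0 mulr0 eq_sym pnatr_eq0 => /eqP ->.
by rewrite -(pmulr_lgt0 _ r0) rk ltr0n.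
Qed.

End HookPositive.

Section IrrFormula.
Variables (R : realType) (n : nat) (l : ydiag).
Local Notation k := (ncells l).
Local Notation I := (injections n l).
Local Notation C := R[i].
Local Notation c := (ysym C k (val l)).
Local Notation h := (yhook C k (val l)).
Local Notation act := (action_mx R n l).

Let h0 : h != 0. Proof. by rewrite gt_eqF ?yhook_gt0. Qed.

Lemma irr_trace x : irr_character R n l x = h^-1 * \tr (rho n c *m act x).
Proof.
rewrite /irr_character (mxtrace_restrict h0) ?young_mxE //.
  by rewrite -young_mxE young_mx_idem.
exact: rho_action.
Qed.

Lemma irrE x : irr_character R n l x =
  h^-1 * \sum_(f : I) \sum_g c g * (moves x f (icomp f g))%:R.
Proof. by rewrite irr_trace trace_rho_action. Qed.

(** Reindexing the injections by a permutation y conjugates g by y, so the symmetrizer may be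
    replaced by its average over conjugates. *)
Lemma irr_ychar x : irr_character R n l x = (k`!)%:R^-1 *
  \sum_(f : I) \sum_g ychar C k (val l) g * (moves x f (icomp f g))%:R.
Proof.
have K0 : (k`!)%:R != 0 :> C by rewrite pnatr_eq0 -lt0n fact_gt0.
rewrite irrE; apply: (mulfI K0); rewrite mulrA (mulrC _ h^-1) -mulrA mulVKf //.
set S := (X in h^-1 * (_ * X)).
transitivity (h^-1 * \sum_(y : 'S_k) S).
  by rewrite sumr_const card_Sn mulr_natl.
rewrite mulr_sumr exchange_big.
have -> : \sum_(g : 'S_k) \sum_(f : I) ychar C k (val l) g * (moves x f (icomp f g))%:R =
   \sum_(y : 'S_k) \sum_(f : I) \sum_g h^-1 * (c (y * g * y^-1)%g * (moves x f (icomp f g))%:R).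
  rewrite exchange_big [RHS]exchange_big; apply: eq_bigr => f _; rewrite [RHS]exchange_big.
  apply: eq_bigr => g _; rewrite -mulr_sumr -mulr_suml mulrA; congr (_ * _).
  by rewrite gscaleE gavgE.
apply: eq_bigr => y _; rewrite [RHS](reindex_inj (can_inj (icompK y^-1%g))) mulr_sumr.
apply: eq_bigr => f _; rewrite mulr_sumr [LHS](reindex_inj (mulgI y)) (reindex_inj (mulIg y^-1%g)).
apply: eq_bigr => g _ /=; congr (_ * (_ * (nat_of_bool _)%:R)); first by rewrite mulgA.
have -> : icomp (icomp f y^-1%g) g = icomp (icomp f (y * (g * y^-1))%g) y^-1%g.
  by rewrite -!icompM !mulgA mulVg mul1g.
by rewrite moves_icomp.
Qed.

End IrrFormula.

(** * The Young lattice *)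

Section YoungLattice.
Local Open Scope nat_scope.

Definition yrow (l : ydiag) (i : nat) : nat := nth 0 (val l) i.

Lemma yrow_gt0 l i : (0 < yrow l i) = (i < size (val l)).
Proof.
rewrite /yrow; case: (ltnP i (size _)) => h; last by rewrite nth_default.
by rewrite lt0n; apply: contraNneq (proj2 (ydiagP l)) => <-; exact: mem_nth.
Qed.

Lemma geq_trans : transitive geq.
Proof. by move=> a b c /= h1 h2; apply: leq_trans h2 h1. Qed.

Lemma yrow_anti l i j : i <= j -> yrow l j <= yrow l i.
Proof.
move=> ij; case: (ltnP j (size (val l))) => jl; last by rewrite /yrow nth_default.
apply: (sorted_leq_nth geq_trans leqnn 0 (proj1 (ydiagP l))) => //.
by rewrite inE; apply: leq_ltn_trans jl.
Qed.

Lemma ydiag_ext l m : yrow l =1 yrow m -> l = m.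
Proof.
move=> h; apply/val_inj/(@eq_from_nth _ 0); last by move=> i _; exact: h.
apply/eqP; rewrite eqn_leq; apply/andP; split; rewrite leqNgt -yrow_gt0.
  by rewrite h yrow_gt0 ltnn.
by rewrite -h yrow_gt0 ltnn.
Qed.

Lemma ncells_sum l N : size (val l) <= N -> ncells l = \sum_(i < N) yrow l i.
Proof.
move=> lN; rewrite /ncells sumnE (big_nth 0) big_mkord.
rewrite (big_ord_widen _ (fun i => nth 0 (val l) i) lN) big_mkcond /=.
by apply: eq_bigr => i _; case: ltnP => // h; rewrite /yrow nth_default.
Qed.

Lemma size_le_ncells l : size (val l) <= ncells l.
Proof.
rewrite (ncells_sum (leqnn _)) -{1}[size _]card_ord -sum1_card.
by apply: leq_sum => i _; rewrite yrow_gt0.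
Qed.

Lemma yof_ex (f : nat -> nat) N : (forall i, f i.+1 <= f i) -> (forall i, N <= i -> f i = 0) ->
  exists l, yrow l =1 f.
Proof.
move=> fd f0; have fa i j : i <= j -> f j <= f i.
  elim: j => [|j IH]; first by rewrite leqn0 => /eqP->.
  by rewrite leq_eqVlt => /orP[/eqP->//|/IH]; exact: leq_trans.
pose M := find (pred1 0) (mkseq f N.+1).
have hasM : has (pred1 0) (mkseq f N.+1).
  by apply/(has_nthP 0); exists N; rewrite ?size_mkseq // nth_mkseq //= f0.
have MN : M < N.+1 by rewrite -[N.+1](size_mkseq f) -has_find.
have fM : f M = 0.
  by have := nth_find 0 hasM; rewrite nth_mkseq // => /eqP.
have fltM i : i < M -> 0 < f i.
  move=> iM; have := before_find 0 iM; rewrite nth_mkseq ?(ltn_trans iM) //=.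
  by rewrite lt0n => ->.
have ok : is_ydiag (mkseq f M).
  apply/andP; split.
    apply/(sortedP 0) => i; rewrite size_mkseq => iM.
    by rewrite !nth_mkseq //; [exact: fd|exact: ltnW].
  by apply/mapP => -[j]; rewrite mem_iota add0n => /andP[_ /fltM]; case: (f j).
exists (exist is_ydiag _ ok) => i; rewrite /yrow /=.
case: (ltnP i M) => iM; first by rewrite nth_mkseq.
by rewrite nth_default ?size_mkseq //; apply/esym/eqP; rewrite -leqn0 -fM fa.
Qed.

Definition yle (l m : ydiag) := forall i, yrow l i <= yrow m i.

Lemma yle_containedP l m : reflect (yle l m) (ydiag_contained l m).
Proof.
apply: (iffP allP) => h i; last by move=> _; exact: h.
case: (ltnP i (size (val l))) => il; last by rewrite /yrow nth_default.
by apply: h; rewrite mem_iota.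
Qed.

Lemma yle_size l m : yle l m -> size (val l) <= size (val m).
Proof.
move=> lm; rewrite leqNgt -yrow_gt0 -leqNgt.
by have := lm (size (val m)); rewrite [X in _ <= X]/yrow nth_default.
Qed.

Lemma yle_eq l m : yle l m -> ncells m <= ncells l -> l = m.
Proof.
move=> lm; have sz := yle_size lm; rewrite (ncells_sum sz) (ncells_sum (leqnn _)) => ml.
apply: ydiag_ext => i.
have := leqif_sum (fun (x : 'I_(size (val m))) (_ : true) => leqif_eq (lm x)).
move=> /geq_leqif; rewrite ml => /esym/forallP h.
case: (ltnP i (size (val m))) => im; first exact/eqP/(h (Ordinal im)).
by rewrite /yrow !nth_default //; apply: leq_trans im.
Qed.

Lemma add_cellP l m : reflect (yle l m /\ ncells m = (ncells l).+1) (add_cell l m).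
Proof.
by apply: (iffP andP) => -[/yle_containedP h /eqP e]; split=> //; apply/eqP.
Qed.

(** A finite superset of the diagrams with n cells: these have at most n rows, of length at most
    n. *)
Definition yseqs n : seq (seq nat) :=
  flatten [seq [seq map val (t : k.-tuple 'I_n.+1) | t : k.-tuple 'I_n.+1] | k <- iota 0 n.+1].

Definition yseq n : seq ydiag :=
  [seq l <- undup (pmap insub (yseqs n)) | ncells l == n].

Lemma yseq_uniq n : uniq (yseq n).
Proof. by rewrite filter_uniq // undup_uniq. Qed.

Lemma mem_yseq n l : (l \in yseq n) = (ncells l == n).
Proof.
rewrite mem_filter; case: eqP => //= ln; rewrite mem_undup mem_pmap_sub /=.
apply/flatten_mapP; exists (size (val l)).
  by rewrite mem_iota add0n ltnS -ln size_le_ncells.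
have lt i : yrow l i < n.+1.
  rewrite ltnS -ln (@ncells_sum l (maxn (size (val l)) i.+1)) ?leq_maxl //.
  have h : i < maxn (size (val l)) i.+1 by rewrite leq_max ltnSn orbT.
  by rewrite (bigD1 (Ordinal h)) //= leq_addr.
apply/mapP; exists [tuple inord (yrow l i) : 'I_n.+1 | i < size (val l)].
  by rewrite mem_enum.
apply: (@eq_from_nth _ 0); first by rewrite size_map size_tuple.
move=> i il; rewrite (nth_map ord0) ?size_tuple // (erefl : i = nat_of_ord (Ordinal il)).
by rewrite -tnth_nth tnth_mktuple /= inordK.
Qed.

Lemma yseq0 : yseq 0 = [:: ydiag0].
Proof.
have : perm_eq (yseq 0) [:: ydiag0].
  apply: uniq_perm; rewrite ?yseq_uniq // => l; rewrite mem_yseq inE.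
  apply/eqP/eqP => [l0|-> //]; apply/esym/yle_eq; last by rewrite l0.
  by move=> i; rewrite /yrow nth_nil.
move=> p; have := perm_size p; case: (yseq 0) p => [|a [|b s]] //.
by move=> /perm_mem/(_ a); rewrite !inE eqxx => /esym/eqP ->.
Qed.

Lemma yrowS l i : yrow l i.+1 <= yrow l i.
Proof. by rewrite yrow_anti. Qed.

Lemma yrow_size l i : size (val l) <= i -> yrow l i = 0.
Proof. exact: nth_default. Qed.

Lemma yjoin_ex l m : exists u, forall i, yrow u i = maxn (yrow l i) (yrow m i).
Proof.
apply: (@yof_ex (fun i => maxn (yrow l i) (yrow m i)) (maxn (size (val l)) (size (val m)))) => i.
  by have := yrowS l i; have := yrowS m i; lia.
by rewrite geq_max => /andP[h1 h2]; rewrite !yrow_size.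
Qed.

Lemma ymeet_ex l m : exists u, forall i, yrow u i = minn (yrow l i) (yrow m i).
Proof.
apply: (@yof_ex (fun i => minn (yrow l i) (yrow m i)) (size (val l))) => i.
  by have := yrowS l i; have := yrowS m i; lia.
by move=> h; rewrite (yrow_size h) min0n.
Qed.

Lemma join_meet_ncells l m u v :
  (forall i, yrow u i = maxn (yrow l i) (yrow m i)) ->
  (forall i, yrow v i = minn (yrow l i) (yrow m i)) ->
  ncells u + ncells v = ncells l + ncells m.
Proof.
move=> hu hv; pose N := size (val l) + size (val m) + size (val u) + size (val v).
rewrite !(@ncells_sum _ N) /N; [|lia..].
by rewrite -!big_split; apply: eq_bigr => i _; rewrite /= hu hv; lia.
Qed.

Definition ups l := [seq m <- yseq (ncells l).+1 | add_cell l m].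

(** A common upper neighbour can only be the join and a common lower neighbour only the meet. Their
    sizes add up to 2 (k + 1), so that one has the right size exactly when the other does. *)
Lemma up_low_distinct k l m : l != m -> ncells l = k.+1 -> ncells m = k.+1 ->
  count (fun u => add_cell l u && add_cell m u) (yseq k.+2) =
  count (fun v => add_cell v l && add_cell v m) (yseq k).
Proof.
move=> lm lk mk; have [u hu] := yjoin_ex l m; have [v hv] := ymeet_ex l m.
have uv := join_meet_ncells hu hv.
have lu : yle l u by move=> i; rewrite hu leq_maxl.
have mu : yle m u by move=> i; rewrite hu leq_maxr.
have vl : yle v l by move=> i; rewrite hv geq_minl.
have vm : yle v m by move=> i; rewrite hv geq_minr.
have ult : k.+1 < ncells u.
  rewrite ltnNge; apply/negP => h; move/eqP: lm; apply.
  by rewrite (yle_eq lu) ?lk // (yle_eq mu) ?mk.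
have cu : count (fun w => add_cell l w && add_cell m w) (yseq k.+2) = (ncells u == k.+2).
  rewrite (@eq_in_count _ _ (pred1 u)) => [|w].
    by rewrite count_uniq_mem ?yseq_uniq // mem_yseq.
  rewrite mem_yseq => /eqP wk /=; apply/andP/eqP => [[/add_cellP[h1 _] /add_cellP[h2 _]]|E].
    apply/esym/yle_eq; last by rewrite wk.
    by move=> i; rewrite hu geq_max h1 h2.
  by split; apply/add_cellP; rewrite ?lk ?mk E -?wk ?E.
have vlt : ncells v < k.+1 by lia.
have cv : count (fun w => add_cell w l && add_cell w m) (yseq k) = (ncells v == k).
  rewrite (@eq_in_count _ _ (pred1 v)) => [|w].
    by rewrite count_uniq_mem ?yseq_uniq // mem_yseq.
  rewrite mem_yseq => /eqP wk /=; apply/andP/eqP => [[/add_cellP[h1 _] /add_cellP[h2 _]]|E].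
    apply: yle_eq; last by rewrite wk -ltnS.
    by move=> i; rewrite hv leq_min h1 h2.
  by split; apply/add_cellP; rewrite ?lk ?mk wk E.
by rewrite cu cv; lia.
Qed.

Definition addable (l : ydiag) i := (i == 0) || (yrow l i < yrow l i.-1).
Definition removable (l : ydiag) i := yrow l i.+1 < yrow l i.

Lemma sum_delta N i : i < N -> \sum_(j < N) (val j == i) = 1.
Proof.
move=> iN; rewrite (bigD1 (Ordinal iN)) //= eqxx big1 // => j ji.
by apply/eqP; rewrite eqb0.
Qed.

Lemma yadd_ex l i : addable l i ->
  exists m, (forall j, yrow m j = yrow l j + (j == i)) /\ add_cell l m.
Proof.
move=> ai; have [m hm] : exists m, yrow m =1 (fun j => yrow l j + (j == i)).
  apply: (@yof_ex _ (maxn (size (val l)) i.+1)) => j.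
    have := yrowS l j; move: ai; rewrite /addable; case: (eqVneq j.+1 i) => [<-|/=] /=; first by lia.
    by lia.
  rewrite geq_max => /andP[h1 h2]; rewrite yrow_size //.
  by lia.
exists m; split=> //; apply/add_cellP; split=> [j|]; first by rewrite hm leq_addr.
pose N := (size (val l) + size (val m) + i).+1.
rewrite (@ncells_sum m N) ?(@ncells_sum l N) /N; [|lia..].
under eq_bigr => j _ do rewrite hm.
rewrite big_split /= -[X in _ + X]/(\sum_(j < _) (val j == i)) sum_delta ?addn1 //.
lia.
Qed.

Lemma add_cell_row l m : add_cell l m ->
  exists2 i, forall j, yrow m j = yrow l j + (j == i) & addable l i.
Proof.
move=> /add_cellP[lm ml].
have [i li] : exists i, yrow l i < yrow m i.
  apply: contrapT => h; suff E : m = l by move: ml; rewrite E; lia.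
  apply: ydiag_ext => i; apply/eqP; rewrite eqn_leq lm andbT leqNgt.
  by apply/negP => hi; apply: h; exists i.
have hm j : yrow m j = yrow l j + (j == i).
  pose N := (size (val l) + size (val m) + i + j).+1.
  have iN : i < N by rewrite /N; lia.
  have jN : j < N by rewrite /N; lia.
  move: ml; rewrite (@ncells_sum m N) ?(@ncells_sum l N) /N; [|lia..].
  rewrite -/N; clearbody N; rewrite (bigD1 (Ordinal iN)) //= [in RHS](bigD1 (Ordinal iN)) //=.
  case: (eqVneq j i) => [-> E|ji].
    have : \sum_(x < N | x != Ordinal iN) yrow l x <=
           \sum_(x < N | x != Ordinal iN) yrow m x.
      by apply: leq_sum => x _; exact: lm.
    move: E; move: (bigop _ _ _) => a; move: (bigop _ _ _) => b.
    by rewrite addn1; lia.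
  have jo : Ordinal jN != Ordinal iN by [].
  rewrite (bigD1 (Ordinal jN)) //= [in RHS](bigD1 (Ordinal jN)) //=.
  have : \sum_(x < N | (x != Ordinal iN) && (x != Ordinal jN)) yrow l x <=
         \sum_(x < N | (x != Ordinal iN) && (x != Ordinal jN)) yrow m x.
    by apply: leq_sum => x _; exact: lm.
  move: (bigop _ _ _) => a; move: (bigop _ _ _) => b.
  by have := lm j; have := lm i; lia.
exists i => //; rewrite /addable; case: i li hm => //= i li hm.
have := yrowS m i; rewrite !hm eqxx; lia.
Qed.

Lemma yrem_ex l i : removable l i ->
  exists m, (forall j, yrow m j = yrow l j - (j == i)) /\ add_cell m l.
Proof.
rewrite /removable => ai; have [m hm] : exists m, yrow m =1 (fun j => yrow l j - (j == i)).
  apply: (@yof_ex _ (size (val l))) => j; last by move=> h; rewrite yrow_size.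
  by have := yrowS l j; case: (eqVneq j i) => [->|] /=; lia.
have hl j : yrow l j = yrow m j + (j == i).
  by rewrite hm; case: (eqVneq j i) => [->|] /=; lia.
exists m; split=> //; apply/add_cellP; split=> [j|]; first by rewrite hl leq_addr.
pose N := (size (val l) + size (val m) + i).+1.
rewrite (@ncells_sum l N) ?(@ncells_sum m N) /N; [|lia..].
under eq_bigr => j _ do rewrite hl.
rewrite big_split /= sum_delta ?addn1 //.
lia.
Qed.

Lemma count_ups l : count (add_cell l) (yseq (ncells l).+1) =
  count (addable l) (iota 0 (size (val l)).+1).
Proof.
have ex i : exists m, addable l i ->
    (forall j, yrow m j = yrow l j + (j == i)) /\ add_cell l m.
  by have [/yadd_ex[m hm]|_] := boolP (addable l i); [exists m|exists l].
have [f fP] := choice ex.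
rewrite -!size_filter -(size_map f); apply/perm_size/uniq_perm.
- by rewrite filter_uniq ?yseq_uniq.
- rewrite map_inj_in_uniq ?filter_uniq ?iota_uniq // => i j.
  rewrite !mem_filter => /andP[/fP[hi _] _] /andP[/fP[hj _] _] ij.
  have := hi i; have := hj i; rewrite ij eqxx => ->.
  by case: eqP => //; lia.
move=> m; rewrite mem_filter mem_yseq; apply/andP/mapP => [[lm mk]|[j]].
  have [i hm ai] := add_cell_row lm; exists i.
    rewrite mem_filter ai mem_iota add0n ltnS /=.
    move: ai; rewrite /addable; case: i {hm} => //= i; rewrite -yrow_gt0; lia.
  by apply: ydiag_ext => j; have [-> //] := fP _ ai; rewrite hm.
rewrite mem_filter => /andP[/fP[_ am] _] ->; split=> //.
by have /add_cellP[_ ->] := am.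
Qed.

Lemma count_downs k l : ncells l = k.+1 -> count (add_cell^~ l) (yseq k) =
  count (removable l) (iota 0 (size (val l))).
Proof.
move=> lk; have ex i : exists m, removable l i ->
    (forall j, yrow m j = yrow l j - (j == i)) /\ add_cell m l.
  by have [/yrem_ex[m hm]|_] := boolP (removable l i); [exists m|exists l].
have [f fP] := choice ex.
rewrite -!size_filter -(size_map f); apply/perm_size/uniq_perm.
- by rewrite filter_uniq ?yseq_uniq.
- rewrite map_inj_in_uniq ?filter_uniq ?iota_uniq // => i j.
  rewrite !mem_filter => /andP[ri _] /andP[rj _] ij.
  have [hi _] := fP _ ri; have [hj _] := fP _ rj.
  have := hi i; have := hj i; rewrite ij eqxx => ->.
  by move: ri; rewrite /removable; case: eqP => //; lia.
move=> m; rewrite mem_filter mem_yseq; apply/andP/mapP => [[ml mk]|[j]].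
  have [i hl ai] := add_cell_row ml.
  have ri : removable l i.
    by rewrite /removable !hl eqxx gtn_eqF //; have := yrowS m i; lia.
  exists i.
    rewrite mem_filter ri mem_iota add0n /= -yrow_gt0.
    by move: ri; rewrite /removable; lia.
  by apply: ydiag_ext => j; have [-> _] := fP _ ri; rewrite hl; lia.
rewrite mem_filter => /andP[/fP[_ am] _] ->; split=> //.
by have /add_cellP[_ h] := am; rewrite -eqSS -h lk.
Qed.

(** Row i + 1 is addable exactly when row i is removable; row 0, always addable, accounts for the
    extra one. *)
Lemma up_low_same k l : ncells l = k.+1 ->
  count (add_cell l) (yseq k.+2) = (count (add_cell^~ l) (yseq k)).+1.
Proof.
move=> lk; rewrite (count_downs lk) -lk count_ups /= add1n.
by congr _.+1; rewrite (iotaDl 1 0) count_map; apply: eq_count => i.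
Qed.

(* The commutation relation D U - U D = 1 of the Young lattice. *)
Lemma up_low k l m : ncells l = k.+1 -> ncells m = k.+1 ->
  count (fun u => add_cell l u && add_cell m u) (yseq k.+2) =
  count (fun v => add_cell v l && add_cell v m) (yseq k) + (l == m).
Proof.
move=> lk mk; case: (eqVneq l m) => [<-|lm]; last by rewrite addn0 up_low_distinct.
rewrite addn1 (eq_count (_ : _ =1 add_cell l)) => [|u]; last by rewrite andbb.
by rewrite up_low_same //; congr _.+1; apply: eq_count => u; rewrite /= andbb.
Qed.

(** When m has k cells, this is the number f^m of standard tableaux, counted as paths from the empty
    diagram. *)
Fixpoint syt_rec k (m : ydiag) : nat :=
  if k is k'.+1 then \sum_(l <- yseq k' | add_cell l m) syt_rec k' l else 1.

Definition syt := locked syt_rec.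

Lemma syt0 m : syt 0 m = 1.
Proof. by rewrite /syt -lock. Qed.

Lemma sytS k m : syt k.+1 m = \sum_(l <- yseq k | add_cell l m) syt k l.
Proof. by rewrite /syt -lock. Qed.

(** Induction through the commutation relation: passing down before up gives k + 1 copies by
    induction at the next level, and the diagonal term of [up_low] adds one. *)
Lemma syt_up k l : ncells l = k ->
  \sum_(m <- yseq k.+1 | add_cell l m) syt k.+1 m = k.+1 * syt k l.
Proof.
elim: k l => [|k IH] l lk.
  under eq_bigr => m _ do rewrite sytS yseq0 big_mkcond big_seq1 /=.
  have l0 : l = ydiag0 by apply/eqP; have := mem_yseq 0 l; rewrite yseq0 inE lk eqxx.
  transitivity (count (add_cell ydiag0) (yseq 1)); last by rewrite syt0; exact: (count_ups ydiag0).
  by rewrite -sum1_count l0; apply: eq_bigr => m ->; rewrite syt0.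
under eq_bigr => m _ do rewrite sytS big_mkcond.
rewrite big_mkcond /=.
transitivity (\sum_(n <- yseq k.+1) syt k.+1 n *
    count (fun u => add_cell l u && add_cell n u) (yseq k.+2)).
  rewrite (eq_bigr (fun m => \sum_(n <- yseq k.+1) syt k.+1 n * (add_cell l m && add_cell n m))).
    rewrite exchange_big; apply: eq_bigr => n _ /=.
    rewrite -sum1_count [in RHS]big_mkcond [RHS]big_distrr; apply: eq_bigr => m _ /=.
    by case: ifP.
  move=> m _; case: ifP => _; last by rewrite big1 // => n _; rewrite muln0.
  by apply: eq_bigr => n _; case: ifP; rewrite ?muln0 ?muln1.
rewrite big_seq (eq_bigr (fun n => \sum_(v <- yseq k | add_cell v l) (syt k.+1 n * add_cell v n) + syt k.+1 n * (l == n))).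
  rewrite -big_seq big_split /= exchange_big /=.
  rewrite mulSn [RHS]addnC; congr (_ + _).
    rewrite sytS big_distrr /= big_seq_cond [RHS]big_seq_cond; apply: eq_bigr => v.
    rewrite mem_yseq => /andP[/eqP vk _]; rewrite -(IH _ vk) [RHS]big_mkcond /=.
    by apply: eq_bigr => n _; case: ifP; rewrite ?muln0 ?muln1.
  rewrite (bigD1_seq l) ?yseq_uniq ?mem_yseq ?lk //= eqxx muln1 big1 ?addn0 // => n.
  by rewrite eq_sym => /negPf ->; rewrite muln0.
move=> n; rewrite mem_yseq => /eqP nk; rewrite up_low // mulnDr; congr (_ + _).
rewrite -sum1_count big_mkcond big_distrr [RHS]big_mkcond; apply: eq_bigr => v _ /=.
by case: (add_cell v l) => //=; case: (add_cell v n); rewrite ?muln0 ?muln1.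
Qed.

(** One factor of each square is unfolded over the lower neighbours; after exchanging the sums,
    [syt_up] evaluates the other one. *)
Lemma syt_square k : \sum_(l <- yseq k) syt k l ^ 2 = k`!.
Proof.
elim: k => [|k IH]; first by rewrite yseq0 big_seq1 syt0.
rewrite factS -IH big_distrr /=.
transitivity (\sum_(m <- yseq k.+1) \sum_(l <- yseq k | add_cell l m) syt k.+1 m * syt k l).
  by apply: eq_bigr => m _; rewrite -big_distrr /= -sytS -mulnn.
rewrite (exchange_big_dep xpredT) //= big_seq [RHS]big_seq; apply: eq_bigr => l.
rewrite mem_yseq => /eqP lk; rewrite -big_distrl /= syt_up //.
by rewrite -mulnn mulnA.
Qed.

End YoungLattice.

(** * Completeness and branching for the symmetric groups *)

Section Completeness.
Variables (C : numClosedFieldType) (k : nat).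
Local Notation A := (galg C 'S_k).
Local Notation c l := (ysym C k (val (l : ydiag))).
Local Notation h l := (yhook C k (val (l : ydiag))).
Local Notation X l := (ychar C k (val (l : ydiag))).
Local Notation e l := (yidem C k (val (l : ydiag))).
Implicit Types (l m : ydiag).

Hypothesis hook_gt0 : forall l, ncells l = k -> 0 < h l.

Lemma hook_neq0 l : ncells l = k -> h l != 0.
Proof. by move=> lk; rewrite gt_eqF ?hook_gt0. Qed.

(** Only one of the two orders is known to vanish; in the second case the centrality of the
    idempotent moves it to the left of the symmetrizer. *)
Lemma ysym_yidem_orth l m : ncells l = k -> ncells m = k -> l != m ->
  c l * e m = 0.
Proof.
move=> lk mk lm; have [sl l0] := ydiagP l; have [sm m0] := ydiagP m.
have vlm : val l != val m by rewrite (inj_eq val_inj).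
have [E|E] := ysym_orth_sym C lk mk sl l0 sm m0 vlm.
  rewrite -scalerAr -scalerAr /gavg mulr_sumr big1 ?scaler0 // => x _.
  have -> : c l * (gelt C x^-1 * c m * gelt C x) =
    rowsym C k (val l) * (colsym C k (val l) * gelt C x^-1 * rowsym C k (val m))
      * colsym C k (val m) * gelt C x.
    by rewrite !ysymE !mulrA.
  by rewrite E mul0r.
have ce := @yidem_central C k (val m) (c l).
rewrite -ce -scalerAl -scalerAl /gavg mulr_suml big1 ?scaler0 // => x _.
have -> : gelt C x^-1 * c m * gelt C x * c l =
    gelt C x^-1 * (rowsym C k (val m) * (colsym C k (val m) * gelt C x * rowsym C k (val l))
      * colsym C k (val l)).
  by rewrite !ysymE !mulrA.
by rewrite E mulr0.
Qed.

Lemma yidem_orth l m : ncells l = k -> ncells m = k -> l != m -> e l * e m = 0.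
Proof.
move=> lk mk lm; have ce := @yidem_central C k (val m).
rewrite -!scalerAl -ce -gavg_mull // ce ysym_yidem_orth //.
by rewrite -(scale0r (0 : A)) gavgZ !scale0r !scaler0.
Qed.

Definition ysum : A := \sum_(l <- yseq k) e l.

Lemma ysum_idem : ysum * ysum = ysum.
Proof.
rewrite {1}/ysum mulr_suml /ysum [LHS]big_seq [RHS]big_seq; apply: eq_bigr => l.
rewrite mem_yseq => /eqP lk; rewrite mulr_sumr (bigD1_seq l) ?yseq_uniq ?mem_yseq ?lk //=.
rewrite (yidem_idem lk (hook_gt0 lk)) big_seq_cond big1 ?addr0 // => m /andP[].
by rewrite mem_yseq => /eqP mk ml; apply: yidem_orth; rewrite // eq_sym.
Qed.

Lemma gstar_ysum : gstar ysum = ysum.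
Proof.
rewrite gstar_sum /ysum [LHS]big_seq [RHS]big_seq; apply: eq_bigr => l.
by rewrite mem_yseq => /eqP lk; exact: (gstar_yidem (hook_gt0 lk)).
Qed.

Lemma ysum_trace : gtrace ysum = (\sum_(l <- yseq k) gtrace (X l) ^+ 2) / (k`!)%:R.
Proof.
rewrite gtrace_sum mulr_suml [LHS]big_seq [RHS]big_seq; apply: eq_bigr => l.
by rewrite mem_yseq => /eqP lk; exact: yidem_trace.
Qed.

(** [ysum] is a self-adjoint idempotent, so this is the squared distance from it to 1: its
    nonnegativity is Bessel's inequality, its vanishing is completeness. *)
Lemma ysum_defect : gtrace ((1 - ysum) * gstar (1 - ysum)) = 1 - gtrace ysum.
Proof.
rewrite gstarB gstar1 gstar_ysum mulrBl mul1r mulrBr mulr1 ysum_idem subrr subr0.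
by rewrite gtraceD gtraceN gtrace1.
Qed.

Lemma ychar_bessel : \sum_(l <- yseq k) gtrace (X l) ^+ 2 <= (k`!)%:R.
Proof.
have := gtrace_star_ge0 (1 - ysum).
by rewrite ysum_defect subr_ge0 ysum_trace ler_pdivrMr ?mul1r ?ltr0n ?fact_gt0 //.
Qed.

Definition ycomplete := \sum_(l <- yseq k) gtrace (X l) ^+ 2 = (k`!)%:R.

Lemma ycomplete1 : ycomplete -> ysum = 1.
Proof.
move=> yc; apply/esym/eqP; rewrite -subr_eq0; apply/eqP/gtrace_star_eq0.
by rewrite ysum_defect ysum_trace yc mulfV ?subrr ?pnatr_eq0 -?lt0n ?fact_gt0 //.
Qed.

Lemma gpair_central_ysym theta l : class_fun theta ->
  gpair theta (c l) = gtrace (c l * gof theta : A).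
Proof.
move=> ct; have cz := class_fun_central ct.
transitivity (gpair (gof theta) (c l)).
  by apply: eq_bigr => x _; rewrite gofE.
rewrite (gpair_trace _ (@real_ysym C k (val l))) gstar_ysym ysymE mulrA [LHS]gtraceC.
by rewrite mulrA -(cz (rowsym _ _ _)) -mulrA cz.
Qed.

(** The coefficient of [ychar] of l in [theta], in a form that is visibly nonnegative when [theta]
    is positive definite. *)
Definition ycoef (theta : 'S_k -> C) l := gpair theta (c l) / h l.

(** Completeness decomposes 1 into the central idempotents, and multiplying each of them by the
    central element [theta] yields a multiple of a character by [ysym_central]. *)
Lemma class_fun_expand theta : ycomplete -> class_fun theta ->
  gof theta = \sum_(l <- yseq k) ycoef theta l *: X l.
Proof.
move=> /ycomplete1 yc ct; have cz := class_fun_central ct.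
rewrite -[LHS]mulr1 -yc mulr_sumr [LHS]big_seq [RHS]big_seq; apply: eq_bigr => l.
rewrite mem_yseq => /eqP lk; have h0 := hook_neq0 lk.
rewrite -!scalerAr -gavg_mull // cz (ysym_central lk (hook_gt0 lk)) // gavgZ.
rewrite -gpair_central_ysym // /ycoef !scalerA; congr (_ *: _).
by rewrite mulrC mulrA.
Qed.

Lemma gpair_ychar_ysym l m : ncells l = k -> ncells m = k ->
  gpair (X m) (c l) = h l *+ (l == m).
Proof.
move=> lk mk; have ct := central_class_fun (@ychar_central C k (val m)).
rewrite gpair_central_ysym //.
have -> : gof (X m) = h m *: e m :> A.
  rewrite scalerA mulfV ?scale1r ?hook_neq0 //.
  by apply/galgP => x; rewrite gofE.
rewrite -scalerAr gtraceZ; case: (eqVneq l m) => [<-|lm]; last first.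
  by rewrite ysym_yidem_orth // gtrace0 mulr0.
by rewrite (ysym_yidem lk (hook_gt0 lk)) (ysym_trace _ lk) mulr1.
Qed.

Lemma gpair_suml I (r : seq I) (F : I -> 'S_k -> C) (u : A) :
  gpair (fun g => \sum_(i <- r) F i g) u = \sum_(i <- r) gpair (F i) u.
Proof.
rewrite exchange_big; apply: eq_bigr => x _.
by rewrite mulr_suml.
Qed.

Lemma ycoef_unique (a : ydiag -> C) theta m : ncells m = k ->
  (forall g, theta g = \sum_(l <- yseq k) a l * X l g) -> ycoef theta m = a m.
Proof.
move=> mk ht; have -> : theta = (fun g => \sum_(l <- yseq k) a l * X l g) by exact/funext.
rewrite /ycoef gpair_suml.
have E l : gpair (fun g => a l * X l g) (c m) = a l * gpair (X l) (c m).
  by rewrite mulr_sumr; apply: eq_bigr => x _; rewrite mulrA.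
under eq_bigr => l _ do rewrite E.
rewrite (bigD1_seq m) ?yseq_uniq ?mem_yseq ?mk //= gpair_ychar_ysym // eqxx mulr1n.
rewrite big_seq_cond big1 => [|l /andP[]]; first by rewrite addr0 mulfK ?hook_neq0.
by rewrite mem_yseq => /eqP lk lm; rewrite gpair_ychar_ysym // eq_sym (negPf lm) mulr0.
Qed.

Lemma ycoef_ge0 theta l : ncells l = k -> class_fun theta -> pos_def theta ->
  0 <= ycoef theta l.
Proof.
by move=> lk ct pt; apply: divr_ge0; [exact: gpair_ysym_ge0|exact/ltW/hook_gt0].
Qed.

End Completeness.

(** * Integrality of multiplicities in the symmetric groups *)

Section PermCharacter.
Variables (R : realType) (l : ydiag).
Local Notation k := (ncells l).
Local Notation C := R[i].
Local Notation X := (ychar C k (val l)).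

Lemma card_injections : #|{: injections k l}| = (k`!)%N.
Proof.
have := card_inj_ffuns 'I_k 'I_k; rewrite !card_ord ffactnn => <-.
by rewrite card_sig; apply: eq_card => f; rewrite !inE.
Qed.

Lemma irr_perm (s : 'S_k) : irr_character R k l (Rperm s) = X s.
Proof.
rewrite irr_ychar (eq_bigr (fun _ => X s)) => [|f _].
  by rewrite sumr_const card_injections -[X in _ * X]mulr_natl mulKf ?pnatr_eq0 -?lt0n ?fact_gt0 //.
pose p := perm (@ifun_inj _ _ f).
rewrite (bigD1 (p * s * p^-1)%g) //= big1 => [|g hg].
  have -> : moves (Rperm s) f (icomp f (p * s * p^-1)%g).
    apply/forallP => i; rewrite RpermE icompE !permM.
    by rewrite -[ifun f (p^-1%g _)](permE (@ifun_inj _ _ f)) permKV permE.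
  rewrite mulr1 addr0; have ct := central_class_fun (@ychar_central C k (val l)).
  by rewrite ct mulgA mulVg mul1g.
case: (boolP (moves _ _ _)) => [/forallP hm|_]; last by rewrite mulr0.
case/eqP: hg; apply/permP => i; rewrite !permM.
have := hm i; rewrite RpermE icompE => /eqP[/val_inj].
rewrite -!(permE (@ifun_inj _ _ f)) -/p => ->.
by rewrite permK.
Qed.

Local Notation c := (ysym C k (val l)).
Local Notation h := (yhook C k (val l)).
Local Notation act := (action_mx R k l).

Definition lact (u : galg C 'S_k) := \sum_s u s *: act (Rperm s).

(** The two order reversals of [RpermM] and [action_mxM] cancel. *)
Lemma lactM u v : lact (u * v) = lact u *m lact v.
Proof.
rewrite {1}/lact; under eq_bigr => s _ do rewrite gmulE scaler_suml.
rewrite exchange_big mulmx_suml; apply: eq_bigr => t _ /=.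
rewrite mulmx_sumr (reindex_inj (mulgI t)); apply: eq_bigr => s _ /=.
rewrite mulKg RpermM action_mxM; try exact: Rn_perm.
by rewrite -scalemxAl -scalemxAr scalerA.
Qed.

(** The normalized right symmetrizer P and the normalized left action Q of u are commuting
    idempotents; the quantity is the trace of the idempotent P Q, that is its rank. *)
Lemma gpair_ychar_nat u (a : C) : a != 0 -> u * u = a *: u ->
  exists d : nat, a^-1 * gpair X u = d%:R.
Proof.
move=> a0 uu; set E := rho k c; set L := lact u; have h0 : h != 0 by rewrite gt_eqF ?yhook_gt0.
have EE : E *m E = h *: E by rewrite -rhoM -rhoZ ysym_idem.
have LL : L *m L = a *: L.
  rewrite -lactM uu scaler_sumr; apply: eq_bigr => s _.
  by rewrite gscaleE scalerA.
have EL : E *m L = L *m E.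
  rewrite mulmx_sumr mulmx_suml; apply: eq_bigr => s _.
  by rewrite -scalemxAl -scalemxAr rho_action.
set P := h^-1 *: E; set Q := a^-1 *: L.
have PP : P *m P = P by rewrite -scalemxAl -scalemxAr EE [X in _ *: X]scalerA mulVf ?scale1r.
have QQ : Q *m Q = Q by rewrite -scalemxAl -scalemxAr LL [X in _ *: X]scalerA mulVf ?scale1r.
have QP : Q *m P = P *m Q.
  by rewrite -scalemxAl -!scalemxAr -scalemxAl -EL !scalerA mulrC.
exists (\rank (P *m Q)).
rewrite -[RHS]mul1r -mxtrace_quasi_idem; last first.
  by rewrite scale1r mulmxA -(mulmxA P) QP mulmxA PP -mulmxA QQ.
rewrite -scalemxAl -scalemxAr !mxtraceZ mulrCA; congr (_ * _).
rewrite /gpair; under eq_bigr => s _ do rewrite -irr_perm irr_trace.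
rewrite mulmx_sumr raddf_sum mulr_sumr; apply: eq_bigr => s _ /=.
by rewrite -scalemxAr mxtraceZ mulrCA mulrC mulrA.
Qed.

End PermCharacter.

Lemma perm_extend k n (f : 'I_k -> 'I_n) : injective f ->
  (* The image of f listed in order, then the remaining points: w sends j to the j-th entry. *)
  exists w : 'S_n, forall (i : 'I_k) (j : 'I_n), val j = val i -> w j = f i.
Proof.
move=> finj; pose s := [seq f i | i <- enum 'I_k] ++ [seq j <- enum 'I_n | j \notin [seq f i | i <- enum 'I_k]].
have sP : perm_eq s (enum 'I_n).
  rewrite perm_sym -(perm_filterC (mem [seq f i | i <- enum 'I_k]) (enum 'I_n)) perm_cat2r.
  apply: uniq_perm.
  - exact/filter_uniq/enum_uniq.
  - by rewrite (map_inj_uniq finj) enum_uniq.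
  move=> j; rewrite mem_filter mem_enum andbT //.
have us : uniq s by rewrite (perm_uniq sP) enum_uniq.
have ss : size s = n by rewrite (perm_size sP) size_enum_ord.
have winj : injective (fun j : 'I_n => nth j s j).
  move=> i j /eqP; rewrite (set_nth_default i j) ?ss // nth_uniq ?ss // => /eqP.
  exact: val_inj.
exists (perm winj) => i j ij; rewrite permE.
have ik : (i < size [seq f i | i <- enum 'I_k])%N by rewrite size_map size_enum_ord.
rewrite nth_cat ij ik (nth_map i); first by rewrite nth_ord_enum.
by rewrite size_enum_ord; exact: ltn_ord.
Qed.

(** * The embedding of S_k into S_(k+1) *)

Section Embedding.
Variables (C : numClosedFieldType) (k : nat).
Local Notation A := (galg C 'S_k).
Local Notation B := (galg C 'S_k.+1).

Definition jperm (s : 'S_k) : 'S_k.+1 := lift_perm ord_max ord_max s.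

Lemma jpermM s t : jperm (s * t) = (jperm s * jperm t)%g.
Proof. by rewrite /jperm lift_permM. Qed.
Lemma jperm1 : jperm 1 = 1%g. Proof. exact: lift_perm1. Qed.
Lemma jpermV s : jperm s^-1 = (jperm s)^-1%g.
Proof. by rewrite /jperm lift_permV. Qed.
Lemma odd_jperm s : odd_perm (jperm s) = odd_perm s.
Proof. by rewrite odd_lift_perm addbb. Qed.
Lemma jperm_lift s i : jperm s (lift ord_max i) = lift ord_max (s i).
Proof. exact: lift_perm_lift. Qed.
Lemma jperm_max s : jperm s ord_max = ord_max.
Proof. exact: lift_perm_id. Qed.

Definition jalg (u : A) : B := \sum_s u s *: gelt C (jperm s).

Lemma jalg_elt s : jalg (gelt C s) = gelt C (jperm s).
Proof.
rewrite /jalg (bigD1 s) //= big1 => [|t ts].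
  by rewrite geltE eqxx scale1r addr0.
by rewrite geltE (negPf ts) scale0r.
Qed.

Lemma jalgD u v : jalg (u + v) = jalg u + jalg v.
Proof. by rewrite -big_split; apply: eq_bigr => s _; rewrite gaddE scalerDl. Qed.
Lemma jalgZ a u : jalg (a *: u) = a *: jalg u.
Proof. by rewrite scaler_sumr; apply: eq_bigr => s _; rewrite gscaleE scalerA. Qed.
Lemma jalg_sum I (r : seq I) (P : pred I) (F : I -> A) :
  jalg (\sum_(i <- r | P i) F i) = \sum_(i <- r | P i) jalg (F i).
Proof.
apply: (big_morph jalg jalgD).
by rewrite -(scale0r (0 : A)) jalgZ scale0r.
Qed.

Lemma jalgM u v : jalg (u * v) = jalg u * jalg v.
Proof.
rewrite {1}(gelt_sum u) {1}(gelt_sum v) mulr_suml jalg_sum /jalg mulr_suml.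
apply: eq_bigr => s _; rewrite mulr_sumr -/(jalg _) jalg_sum mulr_sumr.
apply: eq_bigr => t _.
by rewrite -!scalerAl -!scalerAr -geltM !jalgZ jalg_elt jpermM geltM.
Qed.

Lemma jalg_star u : gstar (jalg u) = jalg (gstar u).
Proof.
rewrite gstar_sum [RHS](reindex_inj invg_inj); apply: eq_bigr => s _ /=.
by rewrite gstarZ gstar_elt gstarE invgK jpermV.
Qed.

Lemma gpair_jalg theta u : gpair theta (jalg u) = gpair (theta \o jperm) u.
Proof.
by rewrite gpair_sum; apply: eq_bigr => s _; rewrite gpairZ gpair_elt mulrC.
Qed.

End Embedding.

(** * Nonvanishing along the edges of the Young graph *)

Section Corner.
Variables (C : numClosedFieldType) (k : nat) (l m : ydiag).
Hypotheses (lk : ncells l = k) (mk : ncells m = k.+1) (lm : add_cell l m).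

Lemma corner_perm : exists w : 'S_k.+1, forall i : 'I_k,
  crow (val m) (w (lift ord_max i)) = crow (val l) i /\
  ccol (val m) (w (lift ord_max i)) = ccol (val l) i.
Proof.
have /add_cellP[le_lm _] := lm.
have ex (i : 'I_k) : exists j : 'I_k.+1, (crow (val m) j == crow (val l) i) && (ccol (val m) j == ccol (val l) i).
  have [j [<- <-]] := cell_ex mk (leq_trans (ccol_lt lk i) (le_lm _)).
  by exists j; rewrite !eqxx.
pose f i := xchoose (ex i).
have fP i : crow (val m) (f i) = crow (val l) i /\ ccol (val m) (f i) = ccol (val l) i.
  by have /andP[/eqP ? /eqP ?] := xchooseP (ex i).
have finj : injective f.
  move=> i j ij; apply: (@cell_inj _ (val l)); first by rewrite -(proj1 (fP i)) ij (proj1 (fP j)).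
  by rewrite -(proj2 (fP i)) ij (proj2 (fP j)).
have [w hw] := perm_extend finj; exists w => i.
by rewrite (hw i (lift ord_max i) (lift_max i)); exact: fP.
Qed.

Lemma fstab_corner (r : 'I_k -> nat) (r' : 'I_k.+1 -> nat) (w : 'S_k.+1) p :
  (forall i, r' (w (lift ord_max i)) = r i) -> p \in fstab r ->
  ((jperm p) ^ w)%g \in fstab r'.
Proof.
move=> rr /fstabP hp; apply/fstabP => j; rewrite -[j in RHS](permKV w) -[j in LHS](permKV w).
rewrite permJ; case: (unliftP ord_max (w^-1%g j)) => [i|] ->; last by rewrite jperm_max.
by rewrite jperm_lift !rr hp.
Qed.

(** Let w carry each cell of l to the cell of m in the same row and column. Conjugated by w, the row
    and column groups of l lie in those of m and are absorbed, so that a trace built from the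
    product is the product of their orders, which is nonzero. *)
Lemma branch_neq0 : exists y : 'S_k.+1,
  ysym C k.+1 (val m) * gelt C y * gstar (jalg (ysym C k (val l))) != 0.
Proof.
have [w hw] := corner_perm; exists w^-1%g; apply/eqP => E0.
have := congr1 (fun u => gtrace (gelt C w^-1 * gstar u)) E0.
rewrite !gstarM gstar_elt invgK gstarK gstar_ysym.
have -> : gstar (0 : galg C 'S_k.+1) = 0.
  by apply/galgP => x; rewrite gstarE !gzeroE conjC0.
rewrite mulr0 gtrace0 ysymE jalgM.
set r := rowsym _ _ _; set c := colsym _ _ _; set r' := rowsym _ _ _; set c' := colsym _ _ _.
have cw : jalg c * gelt C w * c' = ncol C k (val l) *: (gelt C w * c').
  rewrite /c /colsym /csym jalg_sum !mulr_suml.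
  rewrite (eq_bigr (fun _ => gelt C w * c')) => [|q hq].
    by rewrite sumr_const scaler_nat.
  rewrite jalgZ jalg_elt -!scalerAl -geltM conjgC geltM -mulrA.
  rewrite (@csymMl C _ _ (jperm q ^ w)%g); last exact: (fstab_corner (fun i => proj2 (hw i))).
  by rewrite odd_permJ odd_jperm -scalerAr scalerA -expr2 sqrr_sign scale1r.
have rw : r' * (gelt C w^-1 * jalg r * gelt C w) = nrow C k (val l) *: r'.
  rewrite /r /rowsym /rsym jalg_sum mulr_sumr mulr_suml mulr_sumr.
  rewrite (eq_bigr (fun _ => r')) => [|p hp]; first by rewrite sumr_const scaler_nat.
  rewrite jalg_elt -!geltM -mulgA -conjgE /r' /rowsym rsymMr //.
  exact: (fstab_corner (fun i => proj1 (hw i))).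
have -> : gelt C w^-1 * (jalg r * jalg c * (gelt C w * (c' * r'))) =
  gelt C w^-1 * jalg r * (jalg c * gelt C w * c') * r' by rewrite !mulrA.
rewrite cw -scalerAr -scalerAl gtraceZ gtraceC !mulrA.
have -> : r' * gelt C w^-1 * jalg r * gelt C w * c' =
  r' * (gelt C w^-1 * jalg r * gelt C w) * c' by rewrite !mulrA.
rewrite rw -scalerAl gtraceZ -ysymE ysym_trace // mulr1 => /eqP.
by rewrite mulf_eq0 !gt_eqF ?nrow_gt0 ?ncol_gt0.
Qed.

(** The sum of squared norms in [gpair_ychar_star] has a nonzero term by [branch_neq0]. *)
Lemma branch_gt0 : 0 < yhook C k.+1 (val m) -> 0 < yhook C k (val l) ->
  0 < gpair (ychar C k.+1 (val m) \o @jperm k) (ysym C k (val l)).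
Proof.
move=> hm hl; set X := ychar _ _ _; set c := ysym _ _ _.
have ct : class_fun (X \o @jperm k).
  by move=> x y /=; rewrite !jpermM; apply: central_class_fun; exact: ychar_central.
have : 0 < gpair (X \o @jperm k) (c * gstar c).
  rewrite gpairC // -gpair_jalg jalgM -jalg_star -{2}(gstarK (jalg c)).
  rewrite gpair_ychar_star //; apply: mulr_gt0.
    by rewrite invr_gt0 !mulr_gt0 ?nrow_gt0 ?ncol_gt0.
  rewrite lt_def sumr_ge0 ?andbT => [|x _]; last exact: gtrace_star_ge0.
  have [y hy] := branch_neq0; apply: contra hy => /eqP hs; apply/eqP/gtrace_star_eq0.
  by apply: (psumr_eq0P _ hs) => // x _; exact: gtrace_star_ge0.
by rewrite gpair_ysym_star // pmulr_rgt0 ?mulr_gt0 ?nrow_gt0 ?ncol_gt0.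
Qed.

End Corner.

(** * Degrees and the branching rule *)

Section BranchingStep.
Variables (C : numClosedFieldType).
Hypothesis hook_gt0 : forall k l, ncells l = k -> 0 < yhook C k (val l).
Hypothesis mult_nat : forall k l (u : galg C 'S_k) (a : C), ncells l = k ->
  a != 0 -> u * u = a *: u -> exists d : nat, a^-1 * gpair (ychar C k (val l)) u = d%:R.
Local Notation X k l := (ychar C k (val (l : ydiag))).

Definition rchar k (m : ydiag) : 'S_k -> C := X k.+1 m \o @jperm k.

Lemma rchar_class k m : class_fun (@rchar k m).
Proof.
by move=> x y /=; rewrite /rchar /= !jpermM; apply: central_class_fun; exact: ychar_central.
Qed.

(** A lower bound on the multiplicity is all that is asked for here; the counting of squares makes
    it sharp. *)
Lemma rcoef_nat k l m : ncells l = k -> ncells m = k.+1 ->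
  exists2 d : nat, ycoef (@rchar k m) l = d%:R & (add_cell l m <= d)%N.
Proof.
move=> lk mk; have h0 := hook_gt0 lk.
have [|] := mult_nat (u := jalg (ysym C k (val l))) mk (lt0r_neq0 h0).
  by rewrite -jalgM ysym_idem // jalgZ.
rewrite gpair_jalg => d dE; have cE : ycoef (@rchar k m) l = d%:R by rewrite -dE mulrC.
exists d => //; case: (boolP (add_cell l m)) => // lm.
rewrite -(ltr0n C) -cE; apply: divr_gt0 => //.
by apply: branch_gt0 => //; exact: hook_gt0.
Qed.

Lemma ydim_gt0 k l : ncells l = k -> 0 < gtrace (X k l).
Proof. by move=> lk; apply: ychar_trace_gt0; [exact: lk|exact: hook_gt0]. Qed.

Lemma rchar_expand k m (s : 'S_k) : ycomplete C k -> ncells m = k.+1 ->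
  rchar m s = \sum_(l <- yseq k) ycoef (@rchar k m) l * X k l s.
Proof.
move=> yc mk; have /galgP/(_ s) := class_fun_expand (@hook_gt0 k) yc (@rchar_class k m).
by rewrite gofE gsumE => ->; apply: eq_bigr => l _; rewrite gscaleE.
Qed.

Lemma sum_sqr_eq (I : eqType) (r : seq I) (f g : I -> C) :
  (forall i, i \in r -> 0 <= g i <= f i) ->
  \sum_(i <- r) f i ^+ 2 <= \sum_(i <- r) g i ^+ 2 -> forall i, i \in r -> f i = g i.
Proof.
move=> fg le; have sqr i : i \in r -> 0 <= f i ^+ 2 - g i ^+ 2.
  by move=> /fg/andP[g0 gf]; rewrite subr_ge0 lerXn2r ?nnegrE // (le_trans g0).
have s0 : \sum_(i <- r) (f i ^+ 2 - g i ^+ 2) = 0.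
  apply/eqP; rewrite eq_le big_seq sumr_ge0 ?andbT //.
  by rewrite -big_seq sumrB subr_le0.
move=> i ir; move: s0; rewrite big_seq => s0.
have : f i ^+ 2 - g i ^+ 2 == 0.
  have := s0; rewrite -big_seq (big_rem _ ir) /= => /eqP; rewrite paddr_eq0 ?sqr //.
    by move=> /andP[].
  by rewrite big_seq sumr_ge0 // => j /mem_rem/sqr.
rewrite subr_eq0 => /eqP h; have /andP[g0 gf] := fg _ ir.
by apply/eqP; rewrite -(@eqrXn2 _ 2) ?h // (le_trans g0).
Qed.

(** The three claims go together: knowing the degrees at level k gives completeness there, hence the
    expansion of restricted characters, from which both the degrees at level k + 1 and the
    multiplicities are found. *)
Lemma ydim_step k : (forall l, l \in yseq k -> gtrace (X k l) = (syt k l)%:R) ->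
  [/\ ycomplete C k, forall m, m \in yseq k.+1 -> gtrace (X k.+1 m) = (syt k.+1 m)%:R &
   forall m l, m \in yseq k.+1 -> l \in yseq k -> ycoef (@rchar k m) l = (add_cell l m)%:R].
Proof.
move=> IH; have yc : ycomplete C k.
  rewrite /ycomplete -syt_square natr_sum [LHS]big_seq [RHS]big_seq.
  by apply: eq_bigr => l /IH ->; rewrite natrX.
have dimE m : m \in yseq k.+1 ->
    gtrace (X k.+1 m) = \sum_(l <- yseq k) ycoef (@rchar k m) l * (syt k l)%:R.
  rewrite mem_yseq => /eqP mk; have := rchar_expand 1%g yc mk.
  rewrite {1}/rchar /= jperm1 => E; rewrite /gtrace E [LHS]big_seq [RHS]big_seq.
  by apply: eq_bigr => l /IH <-.
have sytE m : (syt k.+1 m)%:R = \sum_(l <- yseq k) (add_cell l m)%:R * (syt k l)%:R :> C.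
  by rewrite sytS big_mkcond natr_sum; apply: eq_bigr => l _; case: ifP; rewrite ?mul1r ?mul0r.
have le m l : m \in yseq k.+1 -> l \in yseq k ->
    (add_cell l m)%:R * (syt k l)%:R <= ycoef (@rchar k m) l * (syt k l)%:R.
  rewrite !mem_yseq => /eqP mk /eqP lk; have [d -> dm] := rcoef_nat lk mk.
  by apply: ler_wpM2r; rewrite ?ler0n ?ler_nat.
have dim m : m \in yseq k.+1 -> gtrace (X k.+1 m) = (syt k.+1 m)%:R.
  move: m; apply: (@sum_sqr_eq _ (yseq k.+1) (fun m => gtrace (X k.+1 m))
    (fun m => (syt k.+1 m)%:R)) => [i ik|].
    by rewrite ler0n sytE dimE // big_seq [leRHS]big_seq ler_sum // => l; exact: le.
  have -> : \sum_(i <- yseq k.+1) (syt k.+1 i)%:R ^+ 2 = (k.+1)`!%:R :> C.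
    by rewrite -syt_square natr_sum; apply: eq_bigr => l _; rewrite natrX.
  by apply: ychar_bessel; exact: hook_gt0.
split=> // m l mk lk.
(* A vanishing sum of nonnegative terms; each multiplicity is recovered by dividing by f^l, which is
   nonzero. *)
have E : \sum_(l <- yseq k) (ycoef (@rchar k m) l * (syt k l)%:R - (add_cell l m)%:R * (syt k l)%:R) = 0.
  by rewrite sumrB -dimE // -sytE dim // subrr.
have : ycoef (@rchar k m) l * (syt k l)%:R - (add_cell l m)%:R * (syt k l)%:R == 0.
  move/eqP: E; rewrite (big_rem _ lk) /= paddr_eq0 ?subr_ge0 ?le //.
    by move=> /andP[].
  by rewrite big_seq sumr_ge0 // => j /mem_rem jk; rewrite subr_ge0 le.
have f0 : (syt k l)%:R != 0 :> C.
  rewrite -IH //; apply: lt0r_neq0; apply: ydim_gt0.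
  by apply/eqP; rewrite -mem_yseq.
by rewrite -mulrBl mulf_eq0 (negPf f0) orbF subr_eq0 => /eqP.
Qed.

Lemma ydim_syt k l : l \in yseq k -> gtrace (X k l) = (syt k l)%:R.
Proof.
elim: k l => [|k IH] l; last by have [_ h _] := ydim_step IH; exact: h.
rewrite mem_yseq => /eqP lk; rewrite ychar_trace //.
have E : ysym C 0 (val l) = 1.
  apply/galgP => x; have -> : x = 1%g by apply/permP => -[].
  by rewrite gone1; exact: ysym_trace.
by rewrite /yhook E mulr1 gtrace1 divr1 syt0.
Qed.

Lemma ychar_complete k : ycomplete C k.
Proof. by have [] := ydim_step (@ydim_syt k). Qed.

Lemma ychar_branching k m (s : 'S_k) : ncells m = k.+1 ->
  X k.+1 m (jperm s) = \sum_(l <- yseq k | add_cell l m) X k l s.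
Proof.
move=> mk; have [yc _ h] := ydim_step (@ydim_syt k).
rewrite -[LHS]/(rchar m s) rchar_expand // [RHS]big_mkcond [LHS]big_seq [RHS]big_seq.
apply: eq_bigr => l lk; rewrite h //; last by rewrite mem_yseq mk.
by case: ifP; rewrite ?mul1r ?mul0r.
Qed.

End BranchingStep.

Section RealCharacters.
Variable R : realType.

Lemma yhook_gt0C k (l : ydiag) : ncells l = k -> 0 < yhook R[i] k (val l).
Proof. by move=> <-; exact: yhook_gt0. Qed.

Lemma mult_natC k l (u : galg R[i] 'S_k) (a : R[i]) : ncells l = k ->
  a != 0 -> u * u = a *: u ->
  exists d : nat, a^-1 * gpair (ychar R[i] k (val l)) u = d%:R.
Proof. by move=> lk; subst k; exact: gpair_ychar_nat. Qed.

Lemma completeC k : ycomplete R[i] k.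
Proof. exact: (ychar_complete yhook_gt0C mult_natC). Qed.

Lemma branchingC k m (s : 'S_k) : ncells m = k.+1 ->
  ychar R[i] k.+1 (val m) (jperm s) =
  \sum_(l <- yseq k | add_cell l m) ychar R[i] k (val l) s.
Proof. exact: (ychar_branching yhook_gt0C mult_natC). Qed.

End RealCharacters.

(** * Induction from S_k to R_n *)

Lemma big_bij (T : nmodType) (I J : finType) (P : pred I) (Q : pred J) (e : J -> I) (F : I -> T) :
  {in Q &, injective e} -> (forall j, Q j -> P (e j)) ->
  (forall i, P i -> exists2 j, Q j & e j = i) ->
  \sum_(i | P i) F i = \sum_(j | Q j) F (e j).
Proof.
move=> einj QP PQ; rewrite -(big_imset F (A := Q) einj) /=.
apply: eq_bigl => i; apply/idP/imsetP => [/PQ[j Qj <-]|[j Qj ->]]; last exact: QP.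
by exists j.
Qed.

Section Induced.
Variable C : numClosedFieldType.

Definition fmoves k (x : Rinf) (f : 'I_k -> nat) (g : 'S_k) : bool :=
  [forall i, x (f i) == Some (f (g i))].

Definition gsum k (theta : 'S_k -> C) (x : Rinf) (f : 'I_k -> nat) : C :=
  \sum_g theta g * (fmoves x f g)%:R.

(** For [theta] the character of an S_k-module V this is the character of C[I(k, n)] tensored with V
    over C[S_k]; the factor 1/k! compensates for the k! injections with a given image. *)
Definition ind n k (theta : 'S_k -> C) (x : Rinf) : C :=
  (k`!)%:R^-1 * \sum_(f : {ffun 'I_k -> 'I_n} | injectiveb f)
    gsum theta x (fun i => val (f i)).

Lemma eq_gsum k (theta : 'S_k -> C) x f f' : f =1 f' -> gsum theta x f = gsum theta x f'.
Proof.
move=> ff; apply: eq_bigr => g _; congr (_ * (nat_of_bool _)%:R).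
by apply: eq_forallb => i; rewrite !ff.
Qed.

Lemma eq_ind n k (t t' : 'S_k -> C) x : t =1 t' -> ind n t x = ind n t' x.
Proof.
move=> tt; congr (_ * _); apply: eq_bigr => f _; apply: eq_bigr => g _.
by rewrite tt.
Qed.

Lemma gsum_perm k (theta : 'S_k -> C) x f (s : 'S_k) : class_fun theta ->
  gsum theta x (fun i => f (s i)) = gsum theta x f.
Proof.
move=> ct; rewrite /gsum [RHS](reindex_inj (conjg_inj s)) /=.
apply: eq_bigr => g _; rewrite conjgE ct mulgK; congr (_ * (nat_of_bool _)%:R).
apply/forallP/forallP => h i; last by have := h (s i); rewrite permJ.
by have := h (s^-1%g i); rewrite -(permJ g s) permKV.
Qed.

Lemma jperm_ex k (g : 'S_k.+1) : g ord_max = ord_max -> exists g', jperm g' = g.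
Proof.
move=> gm; have ex (i : 'I_k) : exists j, lift ord_max j == g (lift ord_max i).
  case: (unliftP ord_max (g (lift ord_max i))) => [j ->|]; first by exists j.
  rewrite -{2}gm => /perm_inj/eqP E.
  by move: (neq_lift ord_max i); rewrite eq_sym E.
pose f i := xchoose (ex i).
have fP i : lift ord_max (f i) = g (lift ord_max i) by apply/eqP; exact: (xchooseP (ex i)).
have finj : injective f.
  by move=> i j ij; apply: (@lift_inj _ ord_max); apply: (@perm_inj _ g); rewrite -!fP ij.
exists (perm finj); apply/permP => i; case: (unliftP ord_max i) => [j ->|->].
  by rewrite jperm_lift permE fP.
by rewrite jperm_max gm.
Qed.

Lemma jperm_inj k : injective (@jperm k).
Proof.
move=> g g' E; apply/permP => i; apply: (@lift_inj _ ord_max).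
by rewrite -!jperm_lift E.
Qed.

Definition extf k n (f : 'I_k -> nat) (i : 'I_k.+1) : nat :=
  if unlift ord_max i is Some j then f j else n.

Lemma gsum_ext k n (theta : 'S_k.+1 -> C) x (f : 'I_k -> nat) :
  Rn n x -> (forall i, f i < n)%N ->
  gsum theta x (extf n f) = gsum (theta \o @jperm k) x f.
Proof.
move=> xn fn; have extl i : extf n f (lift ord_max i) = f i by rewrite /extf liftK.
have extm : extf n f ord_max = n by rewrite /extf unlift_none.
have split g : fmoves x (extf n f) (jperm g) = fmoves x f g.
  apply/forallP/forallP => h i; first by have := h (lift ord_max i); rewrite jperm_lift !extl.
  case: (unliftP ord_max i) => [j ->|->]; first by rewrite jperm_lift !extl.
  by rewrite jperm_max extm xn.
rewrite /gsum (bigID (fun g : 'S_k.+1 => g ord_max == ord_max)) /=.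
rewrite [X in _ + X]big1 ?addr0 => [|g gm]; last first.
  suff /negPf -> : ~~ fmoves x (extf n f) g by rewrite mulr0.
  apply/negP => /forallP/(_ ord_max); rewrite extm xn // => /eqP[].
  case: (unliftP ord_max (g ord_max)) => [j E|E]; last by rewrite E eqxx in gm.
  by rewrite E extl => E'; move: (fn j); rewrite -E' ltnn.
rewrite (@big_bij _ _ _ _ xpredT (@jperm k)) => [||g _|g /eqP/jperm_ex[g' <-]].
- by apply: eq_bigr => g _ /=; rewrite split.
- by move=> g g' _ _; exact: jperm_inj.
- by rewrite jperm_max.
- by exists g'.
Qed.

(** An injection into n + 1 points avoids the new point, or takes it at exactly one of k + 1
    positions. As [theta] is a class function all positions contribute equally, which turns 1/(k+1)!
    into 1/k!; and as x fixes the new point, only permutations fixing the last position remain. *)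
Lemma ind_branch n k (theta : 'S_k.+1 -> C) x : class_fun theta -> Rn n x ->
  ind n.+1 theta x = ind n theta x + ind n (theta \o @jperm k) x.
Proof.
move=> ct xn; rewrite {1}/ind.
rewrite (bigID (fun f : {ffun 'I_k.+1 -> 'I_n.+1} => [exists i, f i == ord_max])) /=.
rewrite mulrDr addrC; congr (_ + _).
  congr (_ * _).
  rewrite (@big_bij _ _ _ _ (fun f : {ffun 'I_k.+1 -> 'I_n} => injectiveb f)
    (fun f : {ffun 'I_k.+1 -> 'I_n} => [ffun i => lift ord_max (f i)])).
  - by apply: eq_bigr => f _; apply: eq_gsum => i; rewrite ffunE lift_max.
  - move=> f f' _ _ /ffunP E; apply/ffunP => i; apply: (@lift_inj _ ord_max).
    by have := E i; rewrite !ffunE.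
  - move=> f /injectiveP fi; apply/andP; split.
      by apply/injectiveP => i j; rewrite !ffunE => /lift_inj/fi.
    by apply/existsPn => i; rewrite ffunE eq_sym neq_lift.
  move=> f /andP[/injectiveP fi /existsPn fm].
  have ex i : exists j, lift ord_max j == f i.
    case: (unliftP ord_max (f i)) => [j ->|E]; first by exists j.
    by have := fm i; rewrite E eqxx.
  exists [ffun i => xchoose (ex i)].
    apply/injectiveP => i j; rewrite !ffunE => E; apply: fi.
    by rewrite -(eqP (xchooseP (ex i))) E (eqP (xchooseP (ex j))).
  by apply/ffunP => i; rewrite !ffunE (eqP (xchooseP (ex i))).
have K0 : (k`!)%:R != 0 :> C by rewrite pnatr_eq0 -lt0n fact_gt0.
have K1 : (k.+1)%:R != 0 :> C by rewrite pnatr_eq0.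
rewrite /ind factS natrM invfM mulrC mulrA [RHS]mulrC; congr (_ * _).
apply: (mulIf K1); rewrite -mulrA mulVf // mulr1.
pose G (f : {ffun 'I_k.+1 -> 'I_n.+1}) := gsum theta x (fun i => val (f i)).
transitivity (\sum_(i0 : 'I_k.+1) \sum_(f : {ffun 'I_k.+1 -> 'I_n.+1} | injectiveb f && (f i0 == ord_max)) G f).
  rewrite (exchange_big_dep (fun f : {ffun 'I_k.+1 -> 'I_n.+1} => injectiveb f && [exists i, f i == ord_max])) /=; last first.
    by move=> i f _ /andP[-> fi]; apply/existsP; exists i.
  apply: eq_bigr => f /andP[/injectiveP fi /existsP[i0 /eqP fi0]].
  rewrite (big_pred1 i0) // => i /=; apply/andP/eqP => [[_ /eqP E]|->].
    by apply: fi; rewrite fi0 E.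
  by split; [apply/injectiveP|apply/eqP].
rewrite (eq_bigr (fun _ => \sum_(f : {ffun 'I_k -> 'I_n} | injectiveb f)
    gsum (theta \o @jperm k) x (fun i => val (f i)))) => [|i0 _].
  by rewrite sumr_const card_ord mulr_natr.
(* f is extended by the new point at the last position, which is then exchanged with position i0. *)
pose e (f : {ffun 'I_k -> 'I_n}) : {ffun 'I_k.+1 -> 'I_n.+1} :=
  [ffun i => if unlift ord_max (tperm i0 ord_max i) is Some j then lift ord_max (f j) else ord_max].
have eE f i : val (e f i) = extf n (fun j => val (f j)) (tperm i0 ord_max i).
  by rewrite ffunE /extf; case: unlift => [j|] //; exact: lift_max.
have et f i : e f (tperm i0 ord_max (lift ord_max i)) = lift ord_max (f i).
  by rewrite ffunE tpermK liftK.
have e0 f : e f i0 = ord_max by rewrite ffunE tpermL unlift_none.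
rewrite (@big_bij _ _ _ _ (fun f : {ffun 'I_k -> 'I_n} => injectiveb f) e).
- apply: eq_bigr => f _; rewrite /G (eq_gsum _ _ (eE f)) gsum_perm //.
  by apply: (gsum_ext _ xn) => j; exact: ltn_ord.
- move=> f f' _ _ E; apply/ffunP => i; apply: (@lift_inj _ ord_max).
  by rewrite -!et E.
- move=> f /injectiveP fi; rewrite e0 eqxx andbT; apply/injectiveP => i j.
  rewrite -(tpermK i0 ord_max i) -(tpermK i0 ord_max j).
  move: (tperm i0 ord_max i) (tperm i0 ord_max j) => {}i {}j.
  case: (unliftP ord_max i) => [i'|] ->; case: (unliftP ord_max j) => [j'|] ->; rewrite ?et ?tpermR ?e0 //.
  + by move=> /lift_inj/fi ->.
  + by move=> /eqP; rewrite eq_sym (negPf (neq_lift _ _)).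
  + by move=> /eqP; rewrite (negPf (neq_lift _ _)).
move=> f /andP[/injectiveP fi /eqP f0].
have ex i : exists j, lift ord_max j == f (tperm i0 ord_max (lift ord_max i)).
  case: (unliftP ord_max (f (tperm i0 ord_max (lift ord_max i)))) => [j ->|]; first by exists j.
  move=> E; have : f (tperm i0 ord_max (lift ord_max i)) = f i0 by rewrite E f0.
  move=> /fi; rewrite -{2}(tpermR i0 ord_max) => /perm_inj/eqP.
  by rewrite eq_sym (negPf (neq_lift _ _)).
exists [ffun i => xchoose (ex i)].
  apply/injectiveP => i j; rewrite !ffunE => E.
  have : f (tperm i0 ord_max (lift ord_max i)) = f (tperm i0 ord_max (lift ord_max j)).
    by rewrite -(eqP (xchooseP (ex i))) E (eqP (xchooseP (ex j))).
  by move=> /fi/perm_inj/lift_inj.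
apply/ffunP => i; rewrite -(tpermK i0 ord_max i).
move: (tperm i0 ord_max i) => {}i; case: (unliftP ord_max i) => [j|] ->.
  by rewrite et ffunE (eqP (xchooseP (ex j))).
by rewrite tpermR e0.
Qed.

Lemma gsum_sum k J (r : seq J) (P : pred J) (a : J -> C) (t : J -> 'S_k -> C) x f :
  gsum (fun s => \sum_(j <- r | P j) a j * t j s) x f =
  \sum_(j <- r | P j) a j * gsum (t j) x f.
Proof.
rewrite /gsum; under [RHS]eq_bigr => j _ do rewrite mulr_sumr.
rewrite exchange_big; apply: eq_bigr => g _ /=.
by rewrite mulr_suml; apply: eq_bigr => j _; rewrite mulrA.
Qed.

Lemma ind_sum n k J (r : seq J) (P : pred J) (a : J -> C) (t : J -> 'S_k -> C) x :
  ind n (fun s => \sum_(j <- r | P j) a j * t j s) x =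
  \sum_(j <- r | P j) a j * ind n (t j) x.
Proof.
rewrite /ind; under eq_bigr => f _ do rewrite gsum_sum.
rewrite exchange_big mulr_sumr; apply: eq_bigr => j _ /=.
by rewrite -mulr_sumr mulrCA.
Qed.

Lemma ind0 n (theta : 'S_0 -> C) x : ind n theta x = theta 1%g.
Proof.
have e0 (T : Type) (a b : 'I_0 -> T) : a =1 b by case.
have f0 : injectiveb ([ffun i : 'I_0 => match i with Ordinal m h => False_rect _ (notF h) end] : {ffun 'I_0 -> 'I_n}).
  by apply/injectiveP => -[].
rewrite /ind fact0 invr1 mul1r (big_pred1 [ffun i : 'I_0 => match i with Ordinal m h => False_rect _ (notF h) end]).
  rewrite /gsum (big_pred1 1%g).
    by rewrite (_ : fmoves _ _ _) ?mulr1 //; apply/forallP => -[].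
  by move=> g; apply/esym/eqP/permP => -[].
move=> f /=; apply/idP/eqP => [_|->]; last exact: f0.
by apply/ffunP => -[].
Qed.

End Induced.

Section IrrInduced.
Variables (R : realType).

Lemma irr_ind n k (l : ydiag) x : ncells l = k ->
  irr_character R n l x = ind n (ychar R[i] k (val l)) x.
Proof.
move=> lk; subst k; rewrite irr_ychar; congr (_ * _).
rewrite (@big_bij _ _ (injections n l) _ xpredT (fun f : injections n l => val f)).
- apply: eq_bigr => f _; apply: eq_bigr => g _; congr (_ * (nat_of_bool _)%:R).
  by apply: eq_forallb => i; rewrite icompE.
- by move=> f f' _ _; exact: val_inj.
- by move=> f _; exact: (valP f).
by move=> f fi; exists (exist (fun f : {ffun 'I_(ncells l) -> 'I_n} => injectiveb f) f fi).
Qed.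

(** For the empty diagram the predecessor of 0 is 0, but the sum is empty since [add_cell] raises
    the number of cells. *)
Lemma irr_branch n (m : ydiag) x : Rn n x ->
  irr_character R n.+1 m x = irr_character R n m x +
    \sum_(l <- yseq (ncells m).-1 | add_cell l m) irr_character R n l x.
Proof.
move=> xn; case mk: (ncells m) => [|k].
  rewrite !(irr_ind _ _ mk) !ind0 yseq0 big_mkcond big_seq1 /=.
  case: ifP; last by rewrite addr0.
  by move=> /add_cellP[_]; rewrite mk.
rewrite !(irr_ind _ _ mk) ind_branch //; last first.
  by apply: central_class_fun; exact: ychar_central.
congr (_ + _).
rewrite (@eq_ind _ _ _ _ (fun s => \sum_(l <- yseq k | add_cell l m) 1 * ychar R[i] k (val l) s)).
  rewrite ind_sum big_seq_cond [RHS]big_seq_cond; apply: eq_bigr => l.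
  by rewrite mem_yseq => /andP[/eqP lk _]; rewrite mul1r (irr_ind _ _ lk).
by move=> s /=; rewrite branchingC //; apply: eq_bigr => l _; rewrite mul1r.
Qed.

End IrrInduced.

(** * Inclusion-exclusion expansion of a central function on R_n *)

Lemma RmulgE (x y : Rinf) i :
  Rinf_fun (x * y)%g i = obind x (y i).
Proof. by []. Qed.

(** * Alternating sums over subsets *)

Section Toggle.
Variables (T : numDomainType) (I : finType).

(** Adding or removing i is an involution that reverses the sign. *)
Lemma sum_toggle (F : {set I} -> T) i : (forall B, F (i |: B) = F B) ->
  \sum_(B : {set I}) (-1) ^+ #|B| * F B = 0.
Proof.
move=> Fi; pose h (B : {set I}) := if i \in B then B :\ i else i |: B.
have hK : involutive h.
  move=> B; rewrite /h; have [iB|iB] := boolP (i \in B).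
    by rewrite !inE eqxx /= finset.setD1K.
  by rewrite finset.setU11 finset.setU1K.
have E : \sum_(B : {set I}) (-1) ^+ #|B| * F B = - \sum_(B : {set I}) (-1) ^+ #|B| * F B.
  rewrite {1}(reindex_inj (inv_inj hK)) -sumrN; apply: eq_bigr => B _.
  rewrite /h; have [iB|iB] := boolP (i \in B).
    rewrite -[in RHS](finset.setD1K iB) Fi cardsU1 !inE eqxx /=.
    by rewrite add1n exprS mulN1r mulNr opprK.
  by rewrite Fi cardsU1 iB add1n exprS mulN1r mulNr.
by apply/eqP; move/eqP: E; rewrite -subr_eq0 opprK -mulr2n mulrn_eq0.
Qed.

(** For nonempty B the inner sum is unchanged when an element of B is toggled, so only the empty B
    survives. In the algebra this says that a signed sum of commuting partial identities is
    idempotent. *)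
Lemma sum_union (F : {set I} -> T) :
  \sum_(B : {set I}) \sum_(B' : {set I}) (-1) ^+ #|B| * (-1) ^+ #|B'| * F (B :|: B') = \sum_(B : {set I}) (-1) ^+ #|B| * F B.
Proof.
rewrite (bigD1 (finset.set0 : {set I})) //= [X in _ + X]big1 ?addr0 => [|B].
  by apply: eq_bigr => B _; rewrite finset.set0U cards0 mul1r.
move=> /finset.set0Pn[i iB]; under eq_bigr => B' _ do rewrite -mulrA.
rewrite -mulr_sumr (sum_toggle (i := i)) ?mulr0 // => B'.
congr F; apply/finset.setP => j; rewrite !inE.
by case: (eqVneq j i) => [->|//]; rewrite iB.
Qed.

Lemma sum_mobius (F : {set I} -> T) :
  \sum_(B : {set I}) \sum_(S : {set I} | S \subset B) (-1) ^+ #|B :\: S| * F S = F [set: I].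
Proof.
rewrite (exchange_big_dep xpredT) //= (bigD1 [set: I]) //= [X in _ + X]big1 => [|S ST].
  rewrite (big_pred1 [set: I]) => [|B]; last by rewrite finset.subTset.
  by rewrite finset.setDv cards0 mul1r addr0.
have [i iS] : exists i, i \notin S.
  by apply/existsP; rewrite -negb_forall; apply: contra ST => /forallP h; apply/eqP/finset.setP => i; rewrite h inE.
rewrite big_mkcond /=.
rewrite (eq_bigr (fun B : {set I} => (-1) ^+ #|B| * ((-1) ^+ #|S| * F S *+ (S \subset B)))).
  apply: (sum_toggle (i := i)) => B; congr (_ *+ nat_of_bool _).
  apply/idP/idP => [|h]; last by apply: fintype.subset_trans h _; exact: finset.subsetUr.
  move=> /fintype.subsetP h; apply/fintype.subsetP => j jS; have := h j jS.
  by rewrite !inE => /orP[/eqP E|//]; rewrite -E jS in iS.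
move=> B _; case: ifP => SB; last by rewrite mulr0n mulr0.
rewrite mulr1n mulrA -exprD; congr (_ * _).
by rewrite -[in RHS](cardsID S B) (finset.setIidPr SB) addnAC exprD addnn -[X in X * _]signr_odd odd_double mul1r.
Qed.

End Toggle.

Definition kill_fun n (P : pred nat) (i : nat) : option nat :=
  if (i < n)%N && P i then None else Some i.

Lemma kill_pred n P : Rinf_pred (kill_fun n P).
Proof.
apply/asboolP; split=> [i j k|]; rewrite /kill_fun.
  by case: ifP => // _ [->]; case: ifP => // _ [->].
by exists n => i ni; rewrite ltnNge ni.
Qed.

Definition Rkill n P : Rinf := exist Rinf_pred _ (kill_pred n P).

Lemma RkillE n P i : Rkill n P i = if (i < n)%N && P i then None else Some i.
Proof. by []. Qed.

Lemma Rkill_ge n P i : (n <= i)%N -> Rkill n P i = Some i.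
Proof. by move=> ni; rewrite RkillE ltnNge ni. Qed.

Lemma Rn_kill n P : Rn n (Rkill n P).
Proof. by move=> i; exact: Rkill_ge. Qed.

Lemma RkillM n P Q : (Rkill n P * Rkill n Q)%g = Rkill n (predU P Q).
Proof.
apply: RinfP => i; rewrite [LHS]RmulE !RkillE /=.
case E: (i < n)%N => /=; last by rewrite RkillE E.
by case: (Q i); rewrite /= ?orbT // orbF RkillE E.
Qed.

Lemma eq_Rkill n P Q : {in gtn n, P =1 Q} -> Rkill n P = Rkill n Q.
Proof.
move=> PQ; apply: RinfP => i; rewrite !RkillE.
by case: ltnP => //= ni; rewrite PQ.
Qed.

Lemma RkillV n P : (Rkill n P)^-1%g = Rkill n P.
Proof.
apply: RinfP => i; apply: option_ext => j.
rewrite -[(_^-1%g : Rinf)]/(Rinv _); split.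
  by move=> /RinvE; rewrite !RkillE; case: ifP => // h [E]; rewrite -E h.
by rewrite RkillE; case: ifP => // h [E]; apply/RinvE; rewrite RkillE -E h.
Qed.

Lemma Rkill0 n P : {in gtn n, P =1 xpred0} -> Rkill n P = 1%g.
Proof.
by move=> h; apply: RinfP => i; rewrite RkillE; case: ltnP => //= ni; rewrite h.
Qed.

(** * The terms of the expansion *)

Section Expansion.
Variables (C : numClosedFieldType) (psi : Rinf -> C).
Hypothesis psiC : forall x y, psi (x * y)%g = psi (y * x)%g.

Definition surv k (f : 'I_k -> nat) (B : {set 'I_k}) (i : nat) : bool :=
  [exists j, (j \notin B) && (f j == i)].

Definition Rkeep n k (f : 'I_k -> nat) (B : {set 'I_k}) : Rinf :=
  Rkill n (predC (surv f B)).

(* [x * Rkeep n f B] is x restricted to the points f(j), j notin B, and to those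
   from n on. *)
Definition texp n k (f : 'I_k -> nat) (x : Rinf) : C :=
  \sum_(B : {set 'I_k}) (-1) ^+ #|B| * psi (x * Rkeep n f B)%g.

(** The part of [psi] of rank exactly k: the value at g acting on the first k of n points, corrected
    by inclusion-exclusion for what proper subsets of these points account for. *)
Definition theta n k (g : 'S_k) : C := texp n (fun i : 'I_k => val i) (Rperm g).

Lemma surv_f k (f : 'I_k -> nat) B j : injective f -> surv f B (f j) = (j \notin B).
Proof.
move=> fi; apply/existsP/idP => [[j' /andP[jB /eqP/fi <-]] //|jB].
by exists j; rewrite jB eqxx.
Qed.

Lemma RkeepM n k (f : 'I_k -> nat) B B' : injective f ->
  (Rkeep n f B * Rkeep n f B')%g = Rkeep n f (B :|: B').
Proof.
move=> fi; rewrite RkillM; apply: eq_Rkill => i _ /=.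
rewrite -negb_and; congr negb; apply/andP/existsP.
  move=> [/existsP[j /andP[jB /eqP <-]]]; rewrite surv_f // => jB'.
  by exists j; rewrite !inE negb_or jB jB' eqxx.
move=> [j /andP[]]; rewrite !inE negb_or => /andP[jB jB'] /eqP <-.
by rewrite !surv_f.
Qed.

Lemma perm_move_keep n k (f : {ffun 'I_k -> 'I_n}) x (g : 'S_k) B (w : 'S_n) :
  injective f -> Rn n x -> fmoves x (fun i => val (f i)) g ->
  (forall (i : 'I_k) (j : 'I_n), val j = val i -> w j = f i) ->
  (x * Rkeep n (fun i => val (f i)) B * Rperm w)%g =
  (Rperm w * (Rperm g * Rkeep n (fun i : 'I_k => val i) B))%g.
Proof.
move=> fi xn /forallP xf wf.
have vfi : injective (fun i => val (f i)) by move=> i j /val_inj/fi.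
have kn : (k <= n)%N.
  by have := leq_card f fi; rewrite !card_ord.
apply: RinfP => i; rewrite !RmulgE.
have [ni|ni] := ltnP i n; last first.
  rewrite Rperm_ge // !Rkill_ge //= RmulgE Rkill_ge //= xn //.
  by rewrite Rperm_ge ?(leq_trans kn) //= Rperm_ge.
rewrite (erefl : i = val (Ordinal ni)) RpermE [LHS]/= RmulgE.
have [ki|ki] := ltnP i k; last first.
  have -> : Rkeep n (fun i => val (f i)) B (w (Ordinal ni)) = None.
    rewrite RkillE ltn_ord /=; case: ifP => // /negbFE/existsP[j /andP[_ /eqP /val_inj E]].
    have jn : (j < n)%N by apply: leq_trans kn.
    rewrite -(wf j (Ordinal jn) erefl) in E; move/perm_inj/(congr1 val): E => /= E.
    by exfalso; move: ki; rewrite -E leqNgt ltn_ord.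
  have -> : Rkeep n (fun i : 'I_k => val i) B (val (Ordinal ni)) = None.
    rewrite RkillE /= ni /=; case: ifP => // /negbFE/existsP[j /andP[_ /eqP E]].
    by exfalso; move: ki; rewrite -E leqNgt ltn_ord.
  by [].
have wi : w (Ordinal ni) = f (Ordinal ki) by exact: wf.
rewrite wi !RkillE ltn_ord /= ni /= surv_f //.
have -> : surv (fun i : 'I_k => val i) B i = (Ordinal ki \notin B).
  by rewrite -(@surv_f _ (fun i : 'I_k => val i) B (Ordinal ki)) //; exact: val_inj.
case: ifP => //= _; rewrite (eqP (xf (Ordinal ki))).
have -> : Rperm g i = Some (val (g (Ordinal ki))) by exact: (RpermE g (Ordinal ki)).
have gn : (g (Ordinal ki) < n)%N by apply: leq_trans kn.
rewrite -(wf _ (Ordinal gn) erefl) /=; apply/esym; exact: (RpermE w (Ordinal gn)).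
Qed.

(** A permutation of n points extending f conjugates x restricted to the image of f into g
    restricted to the first k points, and [psi] is central. *)
Lemma texp_move n k (f : {ffun 'I_k -> 'I_n}) x (g : 'S_k) :
  injective f -> Rn n x -> fmoves x (fun i => val (f i)) g ->
  texp n (fun i => val (f i)) x = theta n g.
Proof.
move=> fi xn xf; have [w hw] := perm_extend fi.
apply: eq_bigr => B _; congr (_ * _).
have E := perm_move_keep B fi xn xf hw.
have wV : (Rperm w * Rperm w^-1 = 1)%g by rewrite -RpermM mulVg Rperm1.
have Vw : (Rperm w^-1 * Rperm w = 1)%g by rewrite -RpermM mulgV Rperm1.
rewrite -[LHS](congr1 psi (mulg1 _)) -wV mulgA E.
by rewrite [LHS]psiC (mulgA (Rperm w^-1)) Vw mul1g.
Qed.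

Lemma texp_nomove n k (f : {ffun 'I_k -> 'I_n}) x :
  injective f -> Rn n x -> (forall g, ~~ fmoves x (fun i => val (f i)) g) ->
  texp n (fun i => val (f i)) x = 0.
Proof.
move=> fi xn nomove.
have vfi : injective (fun i => val (f i)) by move=> i j /val_inj/fi.
(* If x reached every point of the image of f from that image, it would permute it, and the inverse
   permutation would contradict [nomove]. *)
have [i0 hi0] : exists i0, forall j, x (f j) <> Some (val (f i0)).
  apply: contrapT => nex.
  have ex i : exists j, x (f j) == Some (val (f i)).
    apply: contrapT => nj; apply: nex; exists i => j E; apply: nj; exists j.
    exact/eqP.
  pose h i := xchoose (ex i).
  have hP i : x (f (h i)) = Some (val (f i)) by apply/eqP; exact: (xchooseP (ex i)).
  have hinj : injective h by move=> i j ij; have := hP i; rewrite ij hP => -[/val_inj/fi].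
  have /negP[] := nomove (perm hinj)^-1%g; apply/forallP => i.
  by rewrite -{1}(permKV (perm hinj) i) permE hP.
apply: (sum_toggle (i := i0)) => B.
(* By centrality [eps] may act after the restriction of x, where it changes nothing, as the point it
   kills is never reached. *)
pose eps := Rkill n (pred1 (val (f i0))).
have -> : Rkeep n (fun i => val (f i)) (i0 |: B)%SET = (Rkeep n (fun i => val (f i)) B * eps)%g.
  rewrite RkillM; apply: eq_Rkill => i _ /=; rewrite -[RHS]negbK negb_or negbK; congr negb.
  apply/existsP/andP.
    move=> [j]; rewrite !inE negb_or => /andP[/andP[jn jB] /eqP <-].
    rewrite surv_f // jB; split=> //; apply: contra jn => /eqP E.
    by apply/eqP; apply: vfi.
  move=> [/existsP[j /andP[jB /eqP <-]] jn]; exists j.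
  by rewrite !inE negb_or jB eqxx !andbT; apply: contra jn => /eqP ->.
rewrite mulgA [LHS]psiC; congr psi; apply: RinfP => i; rewrite RmulgE.
case E: (Rinf_fun (x * Rkeep n (fun i => val (f i)) B)%g i) => [m|] //=.
rewrite RkillE; case: ifP => // /andP[_ /eqP mf].
move: E; rewrite RmulgE RkillE; case: ifP => //= h; rewrite mf.
have [ni|ni] := ltnP i n; last first.
  by rewrite xn // => -[E]; move: ni; rewrite E leqNgt ltn_ord.
move: h; rewrite ni /= => /negbFE/existsP[j /andP[_ /eqP <-]] E.
by case: (hi0 j).
Qed.

Lemma gsum_theta n k (f : {ffun 'I_k -> 'I_n}) x : injective f -> Rn n x ->
  gsum (@theta n k) x (fun i => val (f i)) = texp n (fun i => val (f i)) x.
Proof.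
move=> fi xn; have [/existsP[g hg]|] := boolP [exists g, fmoves x (fun i => val (f i)) g].
  rewrite (texp_move fi xn hg) /gsum (bigD1 g) //= hg mulr1 big1 ?addr0 // => g' gg.
  suff /negPf -> : ~~ fmoves x (fun i => val (f i)) g' by rewrite mulr0.
  apply: contra gg => /forallP h; apply/eqP/permP => i; apply: fi; apply: val_inj.
  by have := forallP hg i; rewrite (eqP (h i)) => /eqP[].
rewrite negb_exists => /forallP nm; rewrite texp_nomove // /gsum big1 // => g _.
by rewrite (negPf (nm g)) mulr0.
Qed.

Definition tset n (B : {set 'I_n}) (x : Rinf) : C :=
  \sum_(S : {set 'I_n} | S \subset B) (-1) ^+ #|B :\: S| *
     psi (x * Rkill n (predC (fun i => [exists j, (j \in S) && (val j == i)])))%g.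

Lemma tset_sum n x : \sum_(B : {set 'I_n}) tset B x = psi x.
Proof.
rewrite (@sum_mobius _ _ (fun S : {set 'I_n} => psi (x * Rkill n (predC (fun i => [exists j, (j \in S) && (val j == i)])))%g)).
rewrite Rkill0 ?mulg1 // => i; rewrite inE => /= ni; apply/negbF.
by apply/existsP; exists (Ordinal ni); rewrite inE eqxx.
Qed.

Lemma texp_tset n k (f : {ffun 'I_k -> 'I_n}) x : injective f ->
  texp n (fun i => val (f i)) x = tset (f @: [set: 'I_k])%SET x.
Proof.
move=> fi; rewrite /tset (@big_bij _ _ _ _ xpredT (fun B : {set 'I_k} => f @: (~: B))%SET).
- apply: eq_bigr => B _; congr (_ * _).
    congr (_ ^+ _); rewrite -(card_imset _ fi); apply: eq_card => i; rewrite !inE.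
    apply/imsetP/andP => [[j jB ->]|[iB /imsetP[j _ ij]]].
      split; last by rewrite imset_f ?inE.
      by apply/imsetP => -[j']; rewrite inE => jB' /fi E; rewrite -E jB in jB'.
    exists j => //; apply: contraNT iB => jB; rewrite ij; apply: imset_f.
    by rewrite inE.
  congr psi; congr (_ * _)%g; apply: eq_Rkill => i _ /=; congr negb.
  apply/existsP/existsP => [[j /andP[jB /eqP <-]]|[j /andP[/imsetP[j' jB ->] /eqP <-]]].
    by exists (f j); rewrite eqxx andbT imset_f // inE.
  by exists j'; rewrite eqxx andbT; move: jB; rewrite inE.
- move=> B B' _ _ E; apply/finset.setP => i; have /finset.setP/(_ (f i)) := E.
  by rewrite !mem_imset // !inE => /negb_inj.
- by move=> B _; apply: imsetS; exact: finset.subsetT.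
move=> S SB; exists (~: (f @^-1: S))%SET => //; rewrite finset.setCK.
apply/finset.setP => i; apply/imsetP/idP => [[j]|iS]; first by rewrite inE => jS ->.
have /imsetP[j _ ij] := fintype.subsetP SB _ iS.
by exists j => //; rewrite inE -ij.
Qed.

(* The term of the expansion over a set B vanishes unless x permutes B: otherwise
   some point of B can be killed without changing the values of psi. *)
Lemma psi_expand n x : Rn n x -> psi x = \sum_(k < n.+1) ind n (@theta n k) x.
Proof.
move=> xn; rewrite -(tset_sum n) (partition_big (fun B : {set 'I_n} => inord #|B| : 'I_n.+1) xpredT) //=.
apply: eq_bigr => k _; rewrite /ind.
have K0 : (k`!)%:R != 0 :> C by rewrite pnatr_eq0 -lt0n fact_gt0.
apply: (mulfI K0); rewrite mulVKf //.
have cn (B : {set 'I_n}) : (#|B| < n.+1)%N.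
  by rewrite ltnS -[n in (_ <= n)%N]card_ord max_card.
rewrite (eq_bigr (fun f : {ffun 'I_k -> 'I_n} => tset (f @: [set: 'I_k])%SET x)) => [|f /injectiveP fi]; last first.
  by rewrite gsum_theta // texp_tset.
rewrite (partition_big (fun f : {ffun 'I_k -> 'I_n} => f @: [set: 'I_k])%SET (fun B : {set 'I_n} => #|B| == k)) /=; last first.
  by move=> f /injectiveP fi; rewrite card_imset // cardsT card_ord.
rewrite mulr_sumr; apply: eq_big => [B|B Bk].
  apply/eqP/eqP => [/(congr1 val)/=|Bk]; first by rewrite inordK.
  by apply: val_inj; rewrite /= inordK.
have {}Bk : #|B| = k by move/(congr1 val): (eqP Bk); rewrite /= inordK.
rewrite (eq_bigr (fun _ => tset B x)) => [|f /andP[_ /eqP ->] //].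
rewrite sumr_const mulr_natl; congr (_ *+ _).
transitivity #|[set f : {ffun 'I_k -> 'I_n} in ffun_on (mem B) | injectiveb f]|%SET.
  by rewrite card_inj_ffuns_on card_ord Bk ffactnn.
apply: eq_card => f; rewrite !inE andbC; apply/andP/andP => -[/injectiveP fi h]; split=> //; try exact/injectiveP.
  rewrite eqEcard card_imset // cardsT card_ord Bk leqnn andbT.
  apply/fintype.subsetP => i /imsetP[j _ ->]; exact: (ffun_onP h).
by apply/ffun_onP => i; rewrite -(eqP h) imset_f.
Qed.

End Expansion.

Lemma sum_enum_val (T : nmodType) (J : finType) (F : J -> T) :
  \sum_(a < #|J|) F (enum_val a) = \sum_j F j.
Proof.
rewrite [RHS](reindex_onto (@enum_val _ _) enum_rank) /=.
  by apply: eq_bigl => a; rewrite enum_valK eqxx.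
by move=> a _; rewrite enum_rankK.
Qed.

Lemma char_fin_ge0 (R : realType) (G : starMonoidType) (chi : G -> R[i]) (J : finType)
    (c : J -> R[i]) (x : J -> G) : is_character chi ->
  0 <= \sum_i \sum_j c i * (c j)^* * chi (x i * (x j)^-1)%g.
Proof.
move=> [_ _ /(_ #|J| (fun a => c (enum_val a)) (fun a => x (enum_val a)))].
rewrite (sum_enum_val (fun i => \sum_(b < #|J|) c i * (c (enum_val b))^* * chi (x i * (x (enum_val b))^-1)%g)).
congr (0 <= _); apply: eq_bigr => i _.
exact: (sum_enum_val (fun j => c i * (c j)^* * chi (x i * (x j)^-1)%g)).
Qed.

Lemma gpair_star_sum (C : numClosedFieldType) (gT : finGroupType) (t : gT -> C) (u : galg C gT) :
  gpair t (u * gstar u) = \sum_x \sum_y u x * (u y)^* * t (x * y^-1)%g.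
Proof.
rewrite gpairM; apply: eq_bigr => x _; rewrite (reindex_inj invg_inj) /=.
by apply: eq_bigr => y _; rewrite gstarE invgK.
Qed.

Lemma Rkeep_perm n k (B : {set 'I_k}) (t : 'S_k) : (k <= n)%N ->
  (Rkeep n (fun i : 'I_k => val i) B * Rperm t)%g =
  (Rperm t * Rkeep n (fun i : 'I_k => val i) (t @^-1: B))%g.
Proof.
move=> kn; have vi : injective (fun i : 'I_k => val i) by exact: val_inj.
apply: RinfP => i; rewrite !RmulgE; have [ki|ki] := ltnP i k.
  have si : surv (fun i : 'I_k => val i) (t @^-1: B) i = (t (Ordinal ki) \notin B).
    by have := surv_f (t @^-1: B)%SET (Ordinal ki) vi; rewrite inE.
  have ti : Rperm t i = Some (val (t (Ordinal ki))) by exact: (RpermE t (Ordinal ki)).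
  rewrite ti /= !RkillE /= si (leq_trans ki kn).
  rewrite (leq_trans (ltn_ord _) kn) (surv_f _ _ vi) /=.
  by case: ifP => //= _; rewrite ti.
rewrite Rperm_ge //= !RkillE; have [ni|ni] := ltnP i n; last by rewrite /= Rperm_ge.
have ns A : surv (fun i : 'I_k => val i) A i = false.
  by apply/negbTE/existsPn => j; rewrite negb_and neq_ltn (leq_trans (ltn_ord j) ki) orbT.
by rewrite /= !ns.
Qed.

(** * Positive definiteness of the terms *)

Section ThetaPos.
Variables (R : realType) (psi : Rinf -> R[i]).
Hypothesis chpsi : is_character psi.
Local Notation C := R[i].

Let psiC x y : psi (x * y)%g = psi (y * x)%g. Proof. by case: chpsi. Qed.

Lemma theta_class n k : (k <= n)%N -> class_fun (@theta _ psi n k).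
Proof.
move=> kn s t; rewrite /theta /texp.
have tinj : injective (fun B : {set 'I_k} => t @^-1: B)%SET.
  move=> A B /finset.setP E; apply/finset.setP => i.
  by have := E (t^-1%g i); rewrite !inE permKV.
rewrite [RHS](reindex_inj tinj); apply: eq_bigr => B _; congr (_ * _).
  by rewrite card_preimset //; exact: perm_inj.
by rewrite !RpermM -[in RHS]mulgA -Rkeep_perm // [in RHS]mulgA [RHS]psiC mulgA.
Qed.

(** The signed sum e of the elements [Rkeep] is a self-adjoint idempotent by [sum_union], so
    positivity of the term at u is positivity of [psi] at u times e. *)
Lemma theta_pos_def n k : (k <= n)%N -> pos_def (@theta _ psi n k).
Proof.
move=> kn u; rewrite gpair_star_sum.
pose X (a : 'S_k * {set 'I_k}) := (Rperm a.1 * Rkeep n (fun i : 'I_k => val i) a.2)%g.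
pose c (a : 'S_k * {set 'I_k}) : C := u a.1 * (-1) ^+ #|a.2|.
have := char_fin_ge0 c X chpsi; congr (0 <= _).
rewrite -(pair_bigA _ (fun s B => \sum_j c (s, B) * (c j)^* * psi (X (s, B) * (X j)^-1)%g)) /=.
apply: eq_bigr => s _.
under eq_bigr => B _ do rewrite -(pair_bigA _ (fun t B' => c (s, B) * (c (t, B'))^* * psi (X (s, B) * (X (t, B'))^-1)%g)) /=.
rewrite exchange_big; apply: eq_bigr => t _ /=.
rewrite /theta /texp -sum_union mulr_sumr; apply: eq_bigr => B _.
rewrite mulr_sumr; apply: eq_bigr => B' _.
rewrite /c /= rmorphM rmorph_sign /X /= invgM RkillV -RpermV.
have -> : psi (Rperm s * Rkeep n (fun i : 'I_k => val i) B * (Rkeep n (fun i : 'I_k => val i) B' * Rperm t^-1))%g =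
  psi (Rperm (s * t^-1) * Rkeep n (fun i : 'I_k => val i) (B :|: B'))%g.
  have vi : injective (fun i : 'I_k => val i) by exact: val_inj.
  rewrite !mulgA [LHS]psiC RpermM -(RkeepM n B B' vi).
  by rewrite !mulgA.
by rewrite !mulrA; congr (_ * _); rewrite -!mulrA; congr (_ * _); rewrite mulrCA.
Qed.

End ThetaPos.

(** * Irreducible characters of R_n are central and positive *)

Section IrrPos.
Variables (R : realType) (n : nat) (l : ydiag).
Local Notation k := (ncells l).
Local Notation C := R[i].
Local Notation act := (action_mx R n l).
Local Notation irr := (irr_character R n l).

Lemma irr_comm x y : Rn n x -> Rn n y -> irr (x * y)%g = irr (y * x)%g.
Proof.
move=> xn yn; rewrite !irr_trace (action_mxM R l xn yn) (action_mxM R l yn xn).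
congr (_ * _).
by rewrite [in LHS]mulmxA rho_action -[in LHS]mulmxA [LHS]mxtrace_mulC mulmxA.
Qed.

(** P Q need not be self-adjoint. Cyclicity and quasi-idempotence show that the trace is the squared
    norm of Q P times the adjoint of W, divided by a b. *)
Lemma mxtrace_pos (N : nat) (P Q : 'M[C]_N) (a b : C) W : 0 < a -> 0 < b ->
  mxadj P = P -> mxadj Q = Q -> P *m P = a *: P -> Q *m Q = b *: Q ->
  P *m W = W *m P -> Q *m W = W *m Q -> P *m mxadj W = mxadj W *m P ->
  Q *m mxadj W = mxadj W *m Q ->
  0 <= \tr (P *m Q *m (mxadj W *m W)).
Proof.
move=> a0 b0 aP aQ PP QQ PW QW PW' QW'.
have := mxtrace_adj_ge0 (Q *m P *m mxadj W).
have -> : \tr (Q *m P *m mxadj W *m mxadj (Q *m P *m mxadj W)) =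
    (b * a) * \tr (P *m Q *m (mxadj W *m W)).
  rewrite !mxadjM mxadjK aP aQ; set V := mxadj W.
  have PV : P *m (V *m W) = V *m W *m P by rewrite mulmxA PW' -[LHS]mulmxA PW mulmxA.
  have -> : Q *m P *m V *m (W *m (P *m Q)) = Q *m (P *m (V *m W) *m P *m Q).
    by rewrite !mulmxA.
  rewrite mxtrace_mulC -!mulmxA QQ -!scalemxAr mxtraceZ -mulrA; congr (_ * _).
  have -> : P *m (V *m (W *m (P *m Q))) = V *m W *m (P *m P *m Q).
    by rewrite [X in P *m X]mulmxA [LHS]mulmxA PV -!mulmxA.
  rewrite PP -scalemxAl -scalemxAr mxtraceZ; congr (_ * _).
  by rewrite (mulmxA P Q); exact: mxtrace_mulC.
by rewrite pmulr_rge0 ?mulr_gt0.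
Qed.

Lemma irr_psd m (c : 'I_m -> C) (x : 'I_m -> Rinf) : (forall i, Rn n (x i)) ->
  0 <= \sum_i \sum_j c i * (c j)^* * irr (x i * (x j)^-1)%g.
Proof.
move=> xn; set P := rho n (rowsym C k (val l)); set Q := rho n (colsym C k (val l)).
pose W := \sum_i c i *: act (x i).
have -> : \sum_i \sum_j c i * (c j)^* * irr (x i * (x j)^-1)%g =
  (yhook C k (val l))^-1 * \tr (P *m Q *m (mxadj W *m W)).
  rewrite -rhoM -ysymE /W mxadj_sum mulmx_suml mulmx_sumr raddf_sum mulr_sumr.
  rewrite exchange_big; apply: eq_bigr => j _ /=.
  rewrite !mulmx_sumr raddf_sum mulr_sumr; apply: eq_bigr => i _ /=.
  rewrite irr_trace (action_mxM R l (xn i) (Rn_inv (xn j))) action_mxV.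
  rewrite mxadjZ -scalemxAl -!scalemxAr !mxtraceZ [LHS]mulrCA; congr (_ * _).
  by rewrite [c i * (c j)^*]mulrC -mulrA.
apply: mulr_ge0; first by rewrite invr_ge0 ltW ?yhook_gt0.
have comm u : rho n u *m W = W *m rho n u.
  rewrite mulmx_sumr mulmx_suml; apply: eq_bigr => i _.
  by rewrite -scalemxAr -scalemxAl rho_action.
have comm' u : rho n u *m mxadj W = mxadj W *m rho n u.
  rewrite /W mxadj_sum mulmx_sumr mulmx_suml; apply: eq_bigr => i _.
  by rewrite mxadjZ -action_mxV -scalemxAr -scalemxAl rho_action.
apply: (@mxtrace_pos _ P Q (nrow C k (val l)) (ncol C k (val l)) W
  (nrow_gt0 _ _ _) (ncol_gt0 _ _ _) _ _ _ _ (comm _) (comm _) (comm' _) (comm' _)).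
- by rewrite rho_adj gstar_rowsym.
- by rewrite rho_adj gstar_colsym.
- by rewrite -rhoM rowsym_idem rhoZ.
- by rewrite -rhoM colsym_idem rhoZ.
Qed.

End IrrPos.

(** * Triangularity of induction *)

Section IndDiag.
Variable C : numClosedFieldType.

(** Test elements of rank k. Functions induced from S_j vanish on them for j > k, and those induced
    from S_k take their original values, which makes the expansion triangular. *)
Definition Rtrunc n k (s : 'S_k) : Rinf := (Rperm s * Rkill n (leq k))%g.

Lemma Rn_trunc n k (s : 'S_k) : (k <= n)%N -> Rn n (Rtrunc n s).
Proof. by move=> kn; apply: Rn_mul; [exact: Rn_le kn (Rn_perm s)|exact: Rn_kill]. Qed.

Lemma Rtrunc_none n k (s : 'S_k) i : (k <= i < n)%N -> Rtrunc n s i = None.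
Proof. by move=> /andP[ki ni]; rewrite RmulgE RkillE ni ki. Qed.

Lemma Rtrunc_some n k (s : 'S_k) (i : 'I_k) : Rtrunc n s i = Some (s i : nat).
Proof. by rewrite RmulgE RkillE (leqNgt k) ltn_ord andbF /= RpermE. Qed.

Lemma ind_small n k j (t : 'S_j -> C) (s : 'S_k) : (k < j)%N ->
  ind n t (Rtrunc n s) = 0.
Proof.
move=> kj; rewrite /ind big1 ?mulr0 // => f /injectiveP fi.
rewrite /gsum big1 // => g _.
suff /negPf -> : ~~ fmoves (Rtrunc n s) (fun i => val (f i)) g by rewrite mulr0.
apply/negP => /forallP h.
have fk i : (f i < k)%N.
  rewrite ltnNge; apply/negP => ki; have := h i.
  by rewrite Rtrunc_none // ki ltn_ord.
have : injective (fun i => Ordinal (fk i)) by move=> a b [/val_inj/fi].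
by move=> /leq_card; rewrite !card_ord leqNgt kj.
Qed.

Lemma ind_diag n k (t : 'S_k -> C) (s : 'S_k) : (k <= n)%N -> class_fun t ->
  ind n t (Rtrunc n s) = t s.
Proof.
move=> kn ct; have K0 : (k`!)%:R != 0 :> C by rewrite pnatr_eq0 -lt0n fact_gt0.
apply: (mulfI K0); rewrite mulVKf //.
rewrite (bigID (fun f : {ffun 'I_k -> 'I_n} => [forall i, f i < k]%N)) /=.
rewrite [X in _ + X]big1 ?addr0 => [|f /andP[_]]; last first.
  rewrite negb_forall => /existsP[i0]; rewrite -leqNgt => ki.
  rewrite /gsum big1 // => g _.
  suff /negPf -> : ~~ fmoves (Rtrunc n s) (fun i => val (f i)) g by rewrite mulr0.
  by apply/negP => /forallP/(_ i0); rewrite Rtrunc_none // ki ltn_ord.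
rewrite (@big_bij _ _ _ _ xpredT (fun w : 'S_k => [ffun i => widen_ord kn (w i)])).
- rewrite (eq_bigr (fun _ => t s)) => [|w _].
    by rewrite sumr_const card_Sn mulr_natl.
  rewrite (eq_gsum _ _ (f' := fun i => val (w i))) => [|i]; last by rewrite ffunE.
  rewrite (@gsum_perm _ _ _ _ (fun i : 'I_k => val i)) // /gsum (bigD1 s) //= big1 => [|g gs].
    rewrite addr0; suff -> : fmoves (Rtrunc n s) (fun i : 'I_k => val i) s by rewrite mulr1.
    by apply/forallP => i; rewrite Rtrunc_some.
  suff /negPf -> : ~~ fmoves (Rtrunc n s) (fun i : 'I_k => val i) g by rewrite mulr0.
  apply: contra gs => /forallP h; apply/eqP/permP => i; apply: val_inj.
  by have := h i; rewrite Rtrunc_some => /eqP[].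
- move=> w w' _ _ /ffunP E; apply/permP => i; apply: val_inj.
  by have := congr1 val (E i); rewrite !ffunE.
- move=> w _; apply/andP; split.
    by apply/injectiveP => i j; rewrite !ffunE => /(congr1 val)/= /val_inj/perm_inj.
  by apply/forallP => i; rewrite ffunE /=.
move=> f /andP[/injectiveP fi /forallP fk].
have gi : injective (fun i => Ordinal (fk i)) by move=> a b [/val_inj/fi].
exists (perm gi) => //; apply/ffunP => i; rewrite ffunE permE.
exact: val_inj.
Qed.

End IndDiag.

(** * Expansions at level n and their uniqueness *)

Section Slow.
Variable R : realType.
Local Notation C := R[i].
Local Notation irr := (irr_character R).

Definition slow_sum (a : ydiag -> C) n x : C :=
  \sum_(k < n.+1) \sum_(l <- yseq k) a l * irr n l x.

Lemma irr_gt n l x : (n < ncells l)%N -> irr n l x = 0.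
Proof.
move=> nl; rewrite (irr_ind R n x (erefl (ncells l))) /ind big1 ?mulr0 // => f /injectiveP/leq_card.
by rewrite !card_ord leqNgt nl.
Qed.

Lemma slow_sum_trunc (a : ydiag -> C) n k (s : 'S_k) : (k <= n)%N ->
  (forall l, (ncells l < k)%N -> a l = 0) ->
  slow_sum a n (Rtrunc n s) = \sum_(l <- yseq k) a l * ychar C k (val l) s.
Proof.
move=> kn a0; have kn' : (k < n.+1)%N by [].
rewrite /slow_sum (bigD1 (Ordinal kn')) //= [X in _ + X]big1 ?addr0 => [|j jk].
  rewrite big_seq [RHS]big_seq; apply: eq_bigr => l; rewrite mem_yseq => /eqP lk.
  rewrite (irr_ind _ _ _ lk) ind_diag //.
  by apply: central_class_fun; exact: ychar_central.
rewrite big_seq big1 // => l; rewrite mem_yseq => /eqP lj.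
case: (ltngtP j k) => jk'; last by case/eqP: jk; exact: val_inj.
  by rewrite a0 ?mul0r // lj.
by rewrite (irr_ind _ _ _ lj) ind_small ?mulr0.
Qed.

(** Induction on the number of cells: on elements of rank k larger diagrams contribute 0 and smaller
    ones have zero coefficients, so a combination of independent characters of S_k remains. *)
Lemma slow_sum_unique (a : ydiag -> C) n : (forall x, Rn n x -> slow_sum a n x = 0) ->
  forall l, (ncells l <= n)%N -> a l = 0.
Proof.
move=> h l; move kE : (ncells l) => k; elim/ltn_ind: k l kE => k IH l lk kn.
have s0 (s : 'S_k) : \sum_(m <- yseq k) a m * ychar C k (val m) s = 0.
  rewrite -(slow_sum_trunc s kn) ?h //; first exact: Rn_trunc.
  by move=> m mk; apply: (IH _ mk _ erefl); rewrite (leq_trans (ltnW mk)).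
have : ycoef (fun s : 'S_k => 0 : C) l = a l.
  by apply: (ycoef_unique (@yhook_gt0C R k)) => // s; rewrite s0.
move=> <-; rewrite /ycoef /gpair big1 ?mul0r // => x _.
by rewrite mul0r.
Qed.

(** The transpose of the branching rule: harmonicity of the coefficients is exactly compatibility of
    the sums on consecutive levels. *)
Lemma slow_sumS (a : ydiag -> C) n x : Rn n x ->
  slow_sum a n.+1 x = slow_sum (fun l => a l + \sum_(m <- ups l) a m) n x.
Proof.
move=> xn; rewrite /slow_sum.
have E (k : nat) : \sum_(m <- yseq k) a m * irr n.+1 m x =
    \sum_(m <- yseq k) a m * irr n m x +
    (if k is k'.+1 then \sum_(l <- yseq k') (\sum_(m <- ups l) a m) * irr n l x else 0).
  under eq_bigr => m _ do rewrite (irr_branch R _ xn) mulrDr.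
  rewrite big_split; congr (_ + _) => /=; case: k => [|k].
    rewrite yseq0 big_seq1 big1 ?mulr0 // => l /add_cellP[_].
    by rewrite /ncells.
  transitivity (\sum_(m <- yseq k.+1) \sum_(l <- yseq k | add_cell l m) a m * irr n l x).
    rewrite big_seq [RHS]big_seq; apply: eq_bigr => m; rewrite mem_yseq => /eqP ->.
    by rewrite mulr_sumr.
  rewrite (exchange_big_dep xpredT) //= big_seq [RHS]big_seq; apply: eq_bigr => l.
  by rewrite mem_yseq => /eqP lk; rewrite mulr_suml /ups lk big_filter.
under eq_bigr => k _ do rewrite E.
rewrite big_split /= big_ord_recr /= [X in _ + X + _]big_seq [X in _ + X + _]big1 => [|l]; last first.
  by rewrite mem_yseq => /eqP ln; rewrite irr_gt ?mulr0 // ln.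
rewrite addr0 [X in _ + X]big_ord_recl /= add0r -big_split; apply: eq_bigr => k _ /=.
rewrite -big_split; apply: eq_bigr => l _.
by rewrite mulrDl.
Qed.

End Slow.

(** * Characters and harmonic functions *)

Section HarmonicCharacters.
Variable R : realType.
Local Notation C := R[i].
Local Notation irr := (irr_character R).
Implicit Types (phi : nat -> ydiag -> R) (f : ydiag -> R).

(** Only pairs with |l| at most n are vertices; values elsewhere are arbitrary, so such functions
    are compared by [slow_eq] rather than by equality. *)
Definition slow_harmonic phi :=
  [/\ forall n l, (ncells l <= n)%N -> 0 <= phi n l, phi 0%N ydiag0 = 1 &
      forall n l, (ncells l <= n)%N -> phi n l = phi n.+1 l + \sum_(m <- ups l) phi n.+1 m].

Definition young_harmonic f :=
  [/\ forall l, 0 <= f l, f ydiag0 = 1 & forall l, f l = \sum_(m <- ups l) f m].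

Definition slow_char phi (psi : Rinf -> C) :=
  forall n x, Rn n x -> psi x = slow_sum (fun l => (phi n l)%:C%C) n x.

Definition young_char f (chi : Sinf -> C) :=
  forall n s, Sn n s -> chi s = \sum_(l <- yseq n) (f l)%:C%C * irr n l (val s).

Lemma mem_ups l m : (m \in ups l) = add_cell l m.
Proof.
rewrite mem_filter mem_yseq; case: (boolP (add_cell l m)) => //= /add_cellP[_ ->].
by rewrite eqxx.
Qed.

Lemma ups_ncells l m : m \in ups l -> ncells m = (ncells l).+1.
Proof. by rewrite mem_ups => /add_cellP[]. Qed.

Lemma irr_0_1 : irr 0 ydiag0 1%g = 1.
Proof.
rewrite (irr_ind R _ _ (erefl : ncells ydiag0 = 0%N)) ind0.
have := ydim_syt (@yhook_gt0C R) (@mult_natC R) (k := 0) (l := ydiag0).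
by rewrite yseq0 inE eqxx syt0 /gtrace => ->.
Qed.

Lemma slow_sum0 a : slow_sum a 0 1%g = a ydiag0 :> C.
Proof. by rewrite /slow_sum big_ord1 yseq0 big_seq1 irr_0_1 mulr1. Qed.

Lemma eq_slow_sum (a b : ydiag -> C) n x : (forall l, (ncells l <= n)%N -> a l = b l) ->
  slow_sum a n x = slow_sum b n x.
Proof.
move=> ab; apply: eq_bigr => k _; rewrite big_seq [RHS]big_seq; apply: eq_bigr => l.
by rewrite mem_yseq => /eqP lk; rewrite ab // lk -ltnS.
Qed.

Lemma slow_sum_step phi n x : slow_harmonic phi -> Rn n x ->
  slow_sum (fun l => (phi n.+1 l)%:C%C : C) n.+1 x = slow_sum (fun l => (phi n l)%:C%C) n x.
Proof.
move=> [_ _ hs] xn; rewrite slow_sumS //; apply: eq_slow_sum => l ln.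
by rewrite [phi n l]hs // rmorphD rmorph_sum.
Qed.

Lemma slow_sum_le phi m n x : slow_harmonic phi -> Rn m x -> (m <= n)%N ->
  slow_sum (fun l => (phi n l)%:C%C : C) n x = slow_sum (fun l => (phi m l)%:C%C) m x.
Proof.
move=> hp xm; elim: n => [|n IH]; first by rewrite leqn0 => /eqP ->.
rewrite leq_eqVlt => /orP[/eqP -> //|]; rewrite ltnS => mn.
by rewrite slow_sum_step ?IH //; exact: Rn_le xm.
Qed.

Lemma slow_char_ex phi : slow_harmonic phi -> exists psi, slow_char phi psi.
Proof.
move=> hp; have ex (x : Rinf) : exists n, Rn n x by exact: Rinf_fin.
have [N hN] := choice ex.
exists (fun x => slow_sum (fun l => (phi (N x) l)%:C%C) (N x) x) => n x xn.
rewrite -(slow_sum_le hp (hN x) (leq_maxl _ n)).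
by rewrite -(slow_sum_le hp xn (leq_maxr (N x) _)).
Qed.

Lemma slow_char_fun phi psi psi' : slow_char phi psi -> slow_char phi psi' -> psi = psi'.
Proof.
by move=> h h'; apply/funext => x; have [n xn] := Rinf_fin x; rewrite (h n) // (h' n).
Qed.

Lemma slow_char_character phi psi : slow_harmonic phi -> slow_char phi psi ->
  is_character psi.
Proof.
move=> [p0 p1 ph] h; split.
- by rewrite (h 0%N) // slow_sum0 p1.
- move=> x y; have [m xm] := Rinf_fin x; have [n yn] := Rinf_fin y.
  have xM := Rn_le (leq_maxl m n) xm; have yM := Rn_le (leq_maxr m n) yn.
  rewrite !(h (maxn m n)); try exact: Rn_mul.
  by apply: eq_bigr => k _; apply: eq_bigr => l _; rewrite irr_comm.
move=> m c x; have [N hN] : exists N, forall i, Rn N (x i).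
  have [f hf] := choice (fun i => Rinf_fin (x i)).
  by exists (\max_i f i) => i; apply: Rn_le (hf i); exact: leq_bigmax.
under eq_bigr => i _ do under eq_bigr => j _ do
  rewrite (h N _ (Rn_mul (hN i) (Rn_inv (hN j)))) /slow_sum mulr_sumr.
under eq_bigr => i _ do rewrite exchange_big.
rewrite exchange_big; apply: sumr_ge0 => k _ /=.
under eq_bigr => i _ do under eq_bigr => j _ do rewrite mulr_sumr.
under eq_bigr => i _ do rewrite exchange_big.
rewrite exchange_big big_seq; apply: sumr_ge0 => l; rewrite mem_yseq => /eqP lk /=.
under eq_bigr => i _ do under eq_bigr => j _ do rewrite mulrCA.
under eq_bigr => i _ do rewrite -mulr_sumr.
rewrite -mulr_sumr; apply: mulr_ge0; last exact: irr_psd.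
by rewrite ler0c p0 // lk -ltnS.
Qed.

Lemma slow_char_coef phi phi' psi n l : slow_char phi psi -> slow_char phi' psi ->
  (ncells l <= n)%N -> phi n l = phi' n l.
Proof.
move=> h h' ln; apply/eqP; rewrite -subr_eq0; apply/eqP.
suff : (phi n l - phi' n l)%:C%C = 0 :> C by move=> [].
apply: (@slow_sum_unique R (fun l => (phi n l - phi' n l)%:C%C) n) => // x xn.
have : slow_sum (fun l => (phi n l)%:C%C) n x - slow_sum (fun l => (phi' n l)%:C%C) n x = 0 :> C.
  by rewrite -h // -h' // subrr.
rewrite /slow_sum -sumrB => E0; rewrite -[RHS]E0 /slow_sum; apply: eq_bigr => k _; rewrite -sumrB.
by apply: eq_bigr => m _; rewrite rmorphB mulrBl.
Qed.

(** The coefficients are multiplicities in the terms of the expansion, nonnegative by positive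
    definiteness. Harmonicity follows from uniqueness, the expansions at levels n and n + 1 agreeing
    on R_n. *)
Lemma slow_char_exists psi : is_character psi -> exists2 phi, slow_harmonic phi & slow_char phi psi.
Proof.
move=> cp; have psiC x y : psi (x * y)%g = psi (y * x)%g by case: cp.
pose a n l : C := ycoef (@theta _ psi n (ncells l)) l.
have a0 n l : (ncells l <= n)%N -> 0 <= a n l.
  move=> ln; apply: ycoef_ge0 => //; first exact: yhook_gt0C.
  + exact: theta_class.
  + exact: theta_pos_def.
pose phi n l := complex.Re (a n l).
have phiE n l : (ncells l <= n)%N -> (phi n l)%:C%C = a n l.
  by move=> /a0/ger0_real; rewrite /phi => /RRe_real.
have hc : slow_char phi psi.
  move=> n x xn; rewrite (psi_expand psiC xn); apply: eq_bigr => k _.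
  have kn : (k <= n)%N by rewrite -ltnS.
  rewrite (@eq_ind _ _ _ _ (fun s => \sum_(l <- yseq k) ycoef (@theta _ psi n k) l * ychar C k (val l) s)).
    rewrite ind_sum big_seq [RHS]big_seq; apply: eq_bigr => l; rewrite mem_yseq => /eqP lk.
    by rewrite (irr_ind _ _ _ lk) phiE ?lk // /a; case: _ / lk.
  move=> s; have := class_fun_expand (@yhook_gt0C R k) (completeC R k) (theta_class cp kn).
  by move=> /galgP/(_ s); rewrite gofE gsumE => ->; apply: eq_bigr => l _; rewrite gscaleE.
exists phi => //; split.
- by move=> n l ln; rewrite -ler0c phiE // a0.
- have : psi 1%g = 1 by case: cp.
  by rewrite (hc 0%N) // slow_sum0 => -[].
move=> n l ln; apply/eqP; rewrite -subr_eq0; apply/eqP.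
suff : (phi n l - (phi n.+1 l + \sum_(m <- ups l) phi n.+1 m))%:C%C = 0 :> C by move=> [].
apply: (@slow_sum_unique R (fun l => (phi n l - (phi n.+1 l + \sum_(m <- ups l) phi n.+1 m))%:C%C) n) => // x xn.
have : slow_sum (fun l => (phi n l)%:C%C) n x - slow_sum (fun l => (phi n.+1 l)%:C%C) n.+1 x = 0 :> C.
  by rewrite -hc // -hc ?subrr //; exact: Rn_le xn.
rewrite slow_sumS // /slow_sum -sumrB => E0; rewrite -[RHS]E0 /slow_sum; apply: eq_bigr => k _; rewrite -sumrB.
by apply: eq_bigr => m _; rewrite -mulrBl rmorphB rmorphD rmorph_sum.
Qed.

End HarmonicCharacters.

(** * Harmonic functions and characters of S_oo *)

Lemma Sperm_subproof k (s : 'S_k) : total_pred (Rperm s).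
Proof.
apply/asboolP => i; have [ik|ik] := ltnP i k; last by rewrite Rperm_ge.
by rewrite (erefl : i = val (Ordinal ik)) RpermE.
Qed.

Definition Sperm k (s : 'S_k) : Sinf := exist total_pred _ (Sperm_subproof s).

Lemma SpermM k (s t : 'S_k) : Sperm (s * t) = (Sperm t * Sperm s)%g.
Proof. by apply: val_inj; exact: RpermM. Qed.

Lemma SpermV k (s : 'S_k) : Sperm s^-1 = (Sperm s)^-1%g.
Proof. by apply: val_inj; exact: RpermV. Qed.

Lemma Sperm1 k : Sperm (1 : 'S_k) = 1%g.
Proof. by apply: val_inj; exact: Rperm1. Qed.

Lemma Rperm_jperm k (s : 'S_k) : Rperm (jperm s) = Rperm s.
Proof.
apply: RinfP => i; have [ik|ik] := ltnP i k; last first.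
  rewrite (Rperm_ge s) //; move: ik; rewrite leq_eqVlt => /orP[/eqP <-|ik]; last by rewrite Rperm_ge.
  by have := RpermE (jperm s) ord_max; rewrite jperm_max.
have := RpermE (jperm s) (lift ord_max (Ordinal ik)); rewrite jperm_lift !lift_max => ->.
by rewrite -(RpermE s (Ordinal ik)).
Qed.

Lemma Sperm_ex k (x : Sinf) : Sn k x -> exists s : 'S_k, x = Sperm s.
Proof.
move=> xk; have /asboolP xt := valP x.
have ex (i : 'I_k) : exists j : 'I_k, val x i == Some (j : nat).
  case E: (val x i) => [j|]; last by case: (xt i).
  have jk : (j < k)%N by rewrite (Rn_lt xk E).
  by exists (Ordinal jk).
pose f i := xchoose (ex i).
have fP (i : 'I_k) : val x i = Some (f i : nat) by apply/eqP; exact: (xchooseP (ex i)).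
have fi : injective f.
  move=> i j ij; apply: val_inj; apply: (@Rinf_inj (val x) _ _ (f i)); first exact: fP.
  by rewrite ij; exact: fP.
exists (perm fi); apply/val_inj/RinfP => i; have [ik|ik] := ltnP i k; last first.
  by rewrite xk // Rperm_ge.
by have := RpermE (perm fi) (Ordinal ik); rewrite permE /= => ->; exact: (fP (Ordinal ik)).
Qed.

Section YoungCharacters.
Variable R : realType.
Local Notation C := R[i].
Local Notation irr := (irr_character R).
Implicit Types (f : ydiag -> R) (chi : Sinf -> C).

Lemma irr_permE n l (s : 'S_n) : ncells l = n -> irr n l (Rperm s) = ychar C n (val l) s.
Proof. by move=> ln; subst n; exact: irr_perm. Qed.

Lemma young_charP f chi : young_char f chi <->
  forall n (s : 'S_n), chi (Sperm s) = \sum_(l <- yseq n) (f l)%:C%C * ychar C n (val l) s.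
Proof.
have E n (s : 'S_n) : \sum_(l <- yseq n) (f l)%:C%C * irr n l (Rperm s) =
    \sum_(l <- yseq n) (f l)%:C%C * ychar C n (val l) s.
  rewrite big_seq [RHS]big_seq; apply: eq_bigr => l; rewrite mem_yseq => /eqP ln.
  by rewrite irr_permE.
split=> [h n s|h n x /Sperm_ex[s ->]]; last by rewrite h E.
by rewrite (h n) /= ?E //; exact: Rn_perm.
Qed.

Lemma young_char_fun f chi chi' : young_char f chi -> young_char f chi' -> chi = chi'.
Proof.
move=> h h'; apply/funext => x; have [n xn] := Rinf_fin (val x).
by rewrite (h n) // (h' n).
Qed.

Lemma young_char_coef f f' chi : young_char f chi -> young_char f' chi -> f = f'.
Proof.
move=> /young_charP h /young_charP h'; apply/funext => l.
suff : (f l)%:C%C = (f' l)%:C%C :> C by move=> [].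
rewrite -(ycoef_unique (@yhook_gt0C R _) (erefl (ncells l)) (h (ncells l))).
by rewrite -(ycoef_unique (@yhook_gt0C R _) (erefl (ncells l)) (h' (ncells l))).
Qed.

Definition young_slow f n l : R := if ncells l == n then f l else 0.

(* S_oo is reached through the harmonic functions carried by |l| = n: these are
   the characters of R_oo that vanish outside of S_oo. *)
Lemma young_slow_harmonic f : young_harmonic f -> slow_harmonic (young_slow f).
Proof.
move=> [f0 f1 fh]; split=> [n l _||n l ln]; rewrite /young_slow.
- by case: ifP.
- exact: f1.
have -> : (ncells l == n.+1) = false by rewrite ltn_eqF.
rewrite add0r [RHS]big_seq.
rewrite (eq_bigr (fun m => if ncells l == n then f m else 0)) => [|m /ups_ncells ->].
  by case: ifP => // _; [rewrite fh big_seq|rewrite big1].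
by rewrite eqSS.
Qed.

Lemma young_char_ex f : young_harmonic f -> exists2 chi, young_char f chi & is_character chi.
Proof.
move=> hf; have hs := young_slow_harmonic hf; have [psi hpsi] := slow_char_ex hs.
have [p1 pC pP] := slow_char_character hs hpsi.
exists (fun x => psi (val x)).
  move=> n x xn; rewrite (hpsi n) // /slow_sum big_ord_recr /= big1 ?add0r => [|k _].
    rewrite big_seq [RHS]big_seq; apply: eq_bigr => l; rewrite mem_yseq => ln.
    by rewrite /young_slow ln.
  rewrite big_seq big1 // => l; rewrite mem_yseq => /eqP lk.
  by rewrite /young_slow lk ltn_eqF // mul0r.
by split=> [|x y|m c x]; [exact: p1|exact: pC|exact: pP].
Qed.

Lemma young_char_exists chi : is_character chi ->
  exists2 f, young_harmonic f & young_char f chi.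
Proof.
move=> cc; have [c1 cC cP] := cc.
pose t k (s : 'S_k) := chi (Sperm s).
have tc k : class_fun (t k) by move=> s u; rewrite /t !SpermM cC.
have tp k : pos_def (t k).
  move=> u; rewrite gpair_star_sum.
  have := char_fin_ge0 (fun s : 'S_k => u s) (fun s => Sperm s) cc; congr (0 <= _).
  by apply: eq_bigr => s _; apply: eq_bigr => s' _; rewrite -SpermV cC -SpermM.
pose a l : C := ycoef (t (ncells l)) l.
have a0 l : 0 <= a l by apply: ycoef_ge0 => //; exact: yhook_gt0C.
pose f l := complex.Re (a l).
have fE l : (f l)%:C%C = a l by apply: RRe_real; exact: ger0_real.
have h : forall k (s : 'S_k), chi (Sperm s) = \sum_(l <- yseq k) (f l)%:C%C * ychar C k (val l) s.
  move=> k s; have := class_fun_expand (@yhook_gt0C R k) (completeC R k) (tc k).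
  move=> /galgP/(_ s); rewrite gofE gsumE -/(t k s) => ->.
  rewrite big_seq [RHS]big_seq; apply: eq_bigr => l; rewrite mem_yseq => /eqP lk.
  have -> : (f l)%:C%C = ycoef (t k) l by rewrite fE /a; case: _ / lk.
  by rewrite gscaleE.
exists f; last exact/young_charP.
split.
- by move=> l; rewrite -ler0c fE.
- have := h 0%N 1%g; rewrite Sperm1 c1 yseq0 big_seq1 -irr_permE // Rperm1 irr_0_1 mulr1.
  by case.
move=> l; suff : (f l)%:C%C = (\sum_(m <- ups l) f m)%:C%C :> C by move=> [].
set k := ncells l.
rewrite -(ycoef_unique (@yhook_gt0C R _) (erefl k) (h k)).
apply: (ycoef_unique (a := fun l => (\sum_(m <- ups l) f m)%:C%C) (@yhook_gt0C R _) (erefl k)) => s.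
have -> : Sperm s = Sperm (jperm s) by apply: val_inj; rewrite /= Rperm_jperm.
rewrite h; transitivity (\sum_(m <- yseq k.+1) \sum_(l <- yseq k | add_cell l m) (f m)%:C%C * ychar C k (val l) s).
  rewrite big_seq [RHS]big_seq; apply: eq_bigr => m; rewrite mem_yseq => /eqP mk.
  by rewrite branchingC // mulr_sumr.
rewrite (exchange_big_dep xpredT) //= big_seq [RHS]big_seq; apply: eq_bigr => m.
by rewrite mem_yseq => /eqP lk; rewrite rmorph_sum mulr_suml /ups lk big_filter.
Qed.

End YoungCharacters.

(** * Moments on the Pascal graph *)

Section Pascal.
Variable R : realType.
Implicit Types (p : nat -> nat -> R) (g : nat -> R) (d : R).

Definition pascal_rec p :=
  forall n k, (k <= n)%N -> p n k = p n.+1 k + p n.+1 k.+1.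

(** When p is the harmonic function of a central measure, this is the expectation of g at level N,
    as C(N, K) paths lead to (N, K). *)
Definition binsum p N g : R := \sum_(K < N.+1) 'C(N, K)%:R * p N K * g K.

Lemma binsumD p N g h : binsum p N (fun K => g K + h K) = binsum p N g + binsum p N h.
Proof. by rewrite -big_split; apply: eq_bigr => K _; rewrite mulrDr. Qed.

Lemma binsumZ p N a g : binsum p N (fun K => a * g K) = a * binsum p N g.
Proof. by rewrite mulr_sumr; apply: eq_bigr => K _; rewrite mulrCA. Qed.

Lemma eq_binsum p N g h : g =1 h -> binsum p N g = binsum p N h.
Proof. by move=> gh; apply: eq_bigr => K _; rewrite gh. Qed.

Lemma binsum_ge0 p N g : (forall n k, (k <= n)%N -> 0 <= p n k) -> (forall K, 0 <= g K) ->
  0 <= binsum p N g.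
Proof.
by move=> p0 g0; apply: sumr_ge0 => K _; rewrite !mulr_ge0 // p0 // -ltnS.
Qed.

Lemma binsum_step (F : nat -> R) N :
  \sum_(K < N.+2) 'C(N.+1, K)%:R * F K = \sum_(K < N.+1) 'C(N, K)%:R * (F K + F K.+1).
Proof.
rewrite big_ord_recl bin0 mul1r.
under eq_bigr => K _ do rewrite lift0 binS natrD mulrDl.
rewrite big_split /= addrA.
have -> : F 0%N + \sum_(K < N.+1) 'C(N, K.+1)%:R * F K.+1 = \sum_(K < N.+1) 'C(N, K)%:R * F K.
  rewrite [RHS]big_ord_recl bin0 mul1r big_ord_recr /= bin_small // mul0r addr0.
  by congr (_ + _); apply: eq_bigr.
by rewrite -big_split; apply: eq_bigr => K _; rewrite mulrDr.
Qed.

Lemma binsum1 p N : pascal_rec p -> binsum p N (fun=> 1) = p 0%N 0%N.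
Proof.
move=> hp; elim: N => [|N IH]; first by rewrite /binsum big_ord1 bin0 mul1r mulr1.
rewrite -IH /binsum; under eq_bigr => K _ do rewrite mulr1.
rewrite (binsum_step (p N.+1)); apply: eq_bigr => K _.
by rewrite mulr1 -hp // -ltnS.
Qed.

(** Falling factorials are the convenient moments: the factor K of K C(N, K) = N C(N-1, K-1) is
    absorbed by shifting p along the diagonal, and the total mass of the j-fold shift is p(j, j). *)
Lemma binsum_ffact p N j : pascal_rec p ->
  binsum p N (fun K => (K ^_ j)%:R) = (N ^_ j)%:R * p j j.
Proof.
elim: j p N => [|j IH] p N hp.
  by rewrite ffactn0 mul1r -(binsum1 N hp); apply: eq_binsum => K; rewrite ffactn0.
have hp' : pascal_rec (fun n k => p n.+1 k.+1) by move=> n k kn; exact: hp.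
case: N => [|N]; first by rewrite /binsum big_ord1 /= mulr0 mul0r.
rewrite ffactnS natrM -mulrA -(IH _ N hp') /binsum big_ord_recl ffactnS mul0n mulr0 add0r.
rewrite mulr_sumr; apply: eq_bigr => K _; rewrite lift0 ffactnS /=.
have -> : 'C(N.+1, K.+1)%:R * p N.+1 K.+1 * (K.+1 * K ^_ j)%:R =
  (K.+1 * 'C(N.+1, K.+1))%:R * p N.+1 K.+1 * (K ^_ j)%:R by rewrite !natrM; ring.
by rewrite -mul_bin_diag natrM -!mulrA.
Qed.

Lemma natr_ffact K j : ((K ^_ j.+1)%:R : R) = (K ^_ j)%:R * (K%:R - j%:R).
Proof.
have [jK|Kj] := leqP j K; first by rewrite ffactnSr natrM natrB.
by rewrite !ffact_small ?mul0r // ltnW.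
Qed.

Lemma binsum_sqr p N d : pascal_rec p ->
  binsum p N (fun K => (K%:R - N%:R * d) ^+ 2) =
  N%:R * (N%:R - 1) * p 2 2 + N%:R * p 1 1 - 2 * (N%:R * d) * (N%:R * p 1 1)
  + (N%:R * d) ^+ 2 * p 0 0.
Proof.
move=> hp; set a := N%:R * d.
rewrite (@eq_binsum _ _ _ (fun K => (K ^_ 2)%:R + ((1 - 2 * a) * (K ^_ 1)%:R + a ^+ 2 * (K ^_ 0)%:R))).
  rewrite !binsumD !binsumZ !(binsum_ffact _ _ hp) !natr_ffact ffactn0.
  by ring.
by move=> K; rewrite !natr_ffact ffactn0; ring.
Qed.

Lemma binsum_mean p N d : pascal_rec p ->
  binsum p N (fun K => K%:R - N%:R * d) = N%:R * (p 1%N 1%N - d * p 0%N 0%N).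
Proof.
move=> hp; rewrite (@eq_binsum _ _ _ (fun K => (K ^_ 1)%:R + (- (N%:R * d)) * (K ^_ 0)%:R)).
  by rewrite binsumD binsumZ !(binsum_ffact _ _ hp) !natr_ffact ffactn0; ring.
by move=> K; rewrite !natr_ffact ffactn0; ring.
Qed.

(* With D = p 1 1 - d * p 0 0, the variable K - N d has mean N D, so its second
   moment is at least (N D)^2 / p 0 0. *)
Lemma pascal_mean p d : (forall n k, (k <= n)%N -> 0 <= p n k) -> pascal_rec p ->
  (forall e, 0 < e -> exists2 N, (0 < N)%N &
     binsum p N (fun K => (K%:R - N%:R * d) ^+ 2) <= e * N%:R ^+ 2) ->
  p 1%N 1%N = d * p 0%N 0%N.
Proof.
move=> p0 hp small; have := p0 0%N 0%N isT; rewrite le_eqVlt => /orP[/eqP p00|p00].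
  have := hp 0%N 0%N isT; rewrite -p00 mulr0 => /esym/eqP; rewrite paddr_eq0 ?p0 //.
  by move=> /andP[_ /eqP].
set D := p 1%N 1%N - d * p 0%N 0%N; suff : D = 0 by move/eqP; rewrite subr_eq0 => /eqP.
apply/eqP; rewrite -sqrf_eq0; apply: contraT => D0.
have Dp : 0 < D ^+ 2 by rewrite lt_def D0 sqr_ge0.
have e0 : 0 < D ^+ 2 / p 0%N 0%N / 2 by rewrite !divr_gt0.
have [N N0 hN] := small _ e0; have Np : 0 < (N%:R : R) by rewrite ltr0n.
pose c := N%:R * D / p 0%N 0%N.
have : 0 <= binsum p N (fun K => ((K%:R - N%:R * d) - c) ^+ 2).
  by apply: binsum_ge0 => // K; exact: sqr_ge0.
rewrite (@eq_binsum _ _ _ (fun K => (K%:R - N%:R * d) ^+ 2 +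
    ((- 2 * c) * (K%:R - N%:R * d) + c ^+ 2 * 1))); last by move=> K; ring.
rewrite !binsumD !binsumZ binsum1 // binsum_mean // -/D.
set S := binsum _ _ _ in hN *; move=> hS.
have E : S + (-2 * c * (N%:R * D) + c ^+ 2 * p 0%N 0%N) = S - N%:R ^+ 2 * (D ^+ 2 / p 0%N 0%N).
  by rewrite /c; field; rewrite gt_eqF.
rewrite E in hS.
have h2 : 0 < N%:R ^+ 2 * (D ^+ 2 / p 0%N 0%N) := (mulr_gt0 (exprn_gt0 2 Np) (divr_gt0 Dp p00)).
by have : D ^+ 2 / p 0%N 0%N / 2 * N%:R ^+ 2 = N%:R ^+ 2 * (D ^+ 2 / p 0%N 0%N) / 2; [ring|lra].
Qed.

Definition bern d n k : R := d ^+ k * (1 - d) ^+ (n - k).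

Lemma bern_rec d : pascal_rec (bern d).
Proof.
move=> n k kn; rewrite /bern subSn // subSS !exprS; ring.
Qed.

Lemma bern_ge0 d n k : 0 <= d <= 1 -> 0 <= bern d n k.
Proof.
by move=> /andP[d0 d1]; rewrite mulr_ge0 ?exprn_ge0 // subr_ge0.
Qed.

Lemma binsum_bern_sqr d N : binsum (bern d) N (fun K => (K%:R - N%:R * d) ^+ 2) =
  N%:R * (d * (1 - d)).
Proof.
rewrite (binsum_sqr _ _ (bern_rec d)) /bern !subnn !expr0 expr1 !mulr1; ring.
Qed.

(** Domination transfers the Bernoulli variance N d (1 - d), up to the factor c, and this is
    negligible against N^2 as [pascal_mean] requires. *)
Lemma pascal_dominated p1 p2 d c : 0 <= d <= 1 -> 0 <= c ->
  (forall n k, (k <= n)%N -> 0 <= p1 n k) -> (forall n k, (k <= n)%N -> 0 <= p2 n k) ->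
  pascal_rec p1 ->
  (forall n k, (k <= n)%N -> p1 n k + p2 n k = c * bern d n k) ->
  p1 1%N 1%N = d * p1 0%N 0%N.
Proof.
move=> /andP[d0 d1] c0 p10 p20 hp1 psum; apply: pascal_mean => // e e0.
have [N hN] : exists N : nat, c / e < N%:R.
  by exists (Num.bound (c / e)); apply: archi_boundP; rewrite divr_ge0 // ltW.
have ce : c < e * N.+1%:R.
  rewrite mulrC -ltr_pdivrMr //; apply: lt_trans hN _; by rewrite ltr_nat.
exists N.+1 => //.
apply: (@le_trans _ _ (c * (N.+1%:R * (d * (1 - d))))).
  rewrite -binsum_bern_sqr /binsum mulr_sumr; apply: ler_sum => K _.
  rewrite [leRHS]mulrA; apply: ler_wpM2r; first exact: sqr_ge0.
  rewrite [leRHS]mulrCA; apply: ler_wpM2l; first exact: ler0n.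
  by rewrite -psum ?lerDl ?p20 // -ltnS.
have N0 : 0 < (N.+1%:R : R) by rewrite ltr0n.
have dd : d * (1 - d) <= 1 by nra.
have dd0 : 0 <= d * (1 - d) by nra.
apply: (@le_trans _ _ (c * N.+1%:R)).
  by rewrite ler_wpM2l // ger_pMr.
by rewrite expr2 mulrA ler_pM2r // ltW.
Qed.

Lemma binsum_bern_fourth d N : 0 <= d <= 1 ->
  binsum (bern d) N (fun K => (K%:R - N%:R * d) ^+ 4) <= 4 * N%:R ^+ 2.
Proof.
move=> /andP[d0 d1]; set a := N%:R * d.
(* (K - a)^4 in falling factorials; 1, 6, 7, 1 are the Stirling numbers expanding K^4. *)
rewrite (@eq_binsum _ _ _ (fun K => (K ^_ 4)%:R + ((6 - 4 * a) * (K ^_ 3)%:R +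
   ((7 - 12 * a + 6 * a ^+ 2) * (K ^_ 2)%:R + ((1 - 4 * a + 6 * a ^+ 2 - 4 * a ^+ 3) * (K ^_ 1)%:R +
    a ^+ 4 * (K ^_ 0)%:R))))); last first.
  by move=> K; rewrite !natr_ffact ffactn0; ring.
rewrite !binsumD !binsumZ !(binsum_ffact _ _ (bern_rec d)) !natr_ffact ffactn0.
rewrite /bern !subnn !expr0 !mulr1 /a.
set n : R := N%:R; set v := d * (1 - d).
have v1 : v <= 1 / 4 by have := sqr_ge0 (d - 1 / 2); rewrite /v; nra.
have v0 : 0 <= v by rewrite /v; nra.
have n0 : 0 <= n by rewrite ler0n.
have nn : n <= n ^+ 2.
  by rewrite -natrX ler_nat; case: (N) => // m; rewrite -mulnn leq_pmulr.
(* The exact fourth central moment of the binomial law, with v the variance of one step. Its two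
   terms are at most 3 n^2 and n^2, whence the constant 4. *)
rewrite [leLHS](_ : _ = 3 * n ^+ 2 * v ^+ 2 + n * v * (1 - 6 * v)); last by rewrite /v; ring.
have h1 : n ^+ 2 * v ^+ 2 <= n ^+ 2 by rewrite ler_piMr ?exprn_ge0 // expr_le1 //; lra.
have h2 : n * v * (1 - 6 * v) <= n.
  have h3 : v * (1 - 6 * v) <= 1 by nra.
  by rewrite -mulrA ler_piMr.
by rewrite -mulrA; lra.
Qed.

End Pascal.

Lemma down_ex m : (0 < ncells m)%N -> exists l, add_cell l m.
Proof.
move=> m0; have s0 : (0 < size (val m))%N.
  rewrite lt0n; apply: contraTneq m0; rewrite /ncells.
  by case: (val m).
have [|l [_ lm]] := @yrem_ex m (size (val m)).-1; last by exists l.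
by rewrite /removable prednK // yrow_size // yrow_gt0 prednK.
Qed.

(** * Extreme harmonic functions *)

Section Extreme.
Variable R : realType.
Local Notation C := R[i].
Implicit Types (phi : nat -> ydiag -> R) (f : ydiag -> R) (d t : R).

Definition slow_eq phi phi' := forall n l, (ncells l <= n)%N -> phi n l = phi' n l.

Definition slow_extreme phi := forall phi1 phi2 t, slow_harmonic phi1 -> slow_harmonic phi2 ->
  0 < t < 1 -> slow_eq phi (fun n l => t * phi1 n l + (1 - t) * phi2 n l) -> slow_eq phi1 phi2.

Definition young_extreme f := forall f1 f2 t, young_harmonic f1 -> young_harmonic f2 ->
  0 < t < 1 -> (forall l, f l = t * f1 l + (1 - t) * f2 l) -> f1 = f2.

Lemma slow_eq_char phi phi' psi : slow_eq phi phi' -> slow_char phi psi -> slow_char phi' psi.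
Proof.
by move=> e h n x xn; rewrite (h n) //; apply: eq_slow_sum => l ln; rewrite e.
Qed.

Lemma slow_char_mix phi1 phi2 psi1 psi2 t : slow_char phi1 psi1 -> slow_char phi2 psi2 ->
  slow_char (fun n l => t * phi1 n l + (1 - t) * phi2 n l)
    (fun x => t%:C%C * psi1 x + (1 - t)%:C%C * psi2 x).
Proof.
move=> h1 h2 n x xn; rewrite (h1 n) // (h2 n) // /slow_sum !mulr_sumr -big_split.
apply: eq_bigr => k _; rewrite !mulr_sumr -big_split; apply: eq_bigr => l _.
by rewrite [in RHS]rmorphD [in RHS]mulrDl /= !mulrA -!rmorphM.
Qed.

Lemma young_char_mix f1 f2 chi1 chi2 t : young_char f1 chi1 -> young_char f2 chi2 ->
  young_char (fun l => t * f1 l + (1 - t) * f2 l)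
    (fun x => t%:C%C * chi1 x + (1 - t)%:C%C * chi2 x).
Proof.
move=> h1 h2 n x xn; rewrite (h1 n) // (h2 n) // !mulr_sumr -big_split.
by apply: eq_bigr => l _; rewrite [in RHS]rmorphD [in RHS]mulrDl /= !mulrA -!rmorphM.
Qed.

Lemma indecomposable_slow_extreme phi psi : slow_char phi psi ->
  indecomposable_character psi -> slow_extreme phi.
Proof.
move=> hp [_ hi] phi1 phi2 t h1 h2 t01 e.
have [psi1 c1] := slow_char_ex h1; have [psi2 c2] := slow_char_ex h2.
have E : psi = (fun x => t%:C%C * psi1 x + (1 - t)%:C%C * psi2 x).
  exact: slow_char_fun (slow_eq_char e hp) (slow_char_mix t c1 c2).
have E12 : psi1 = psi2.
  apply: (hi _ _ t) => //; [exact: slow_char_character c1|exact: slow_char_character c2|].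
  by move=> x; rewrite E.
move=> n l ln; rewrite E12 in c1; exact: slow_char_coef c1 c2 ln.
Qed.

Lemma slow_extreme_indecomposable phi psi : slow_harmonic phi -> slow_char phi psi ->
  slow_extreme phi -> indecomposable_character psi.
Proof.
move=> hh hp he; split; first exact: slow_char_character hp.
move=> psi1 psi2 t c1 c2 t01 E.
have [phi1 h1 p1] := slow_char_exists c1; have [phi2 h2 p2] := slow_char_exists c2.
have E' : psi = (fun x => t%:C%C * psi1 x + (1 - t)%:C%C * psi2 x) by exact/funext.
have hm := slow_char_mix t p1 p2; rewrite -E' in hm.
have e12 : slow_eq phi1 phi2.
  by apply: (he _ _ t) => // n l ln; exact: slow_char_coef hp hm ln.
exact: slow_char_fun (slow_eq_char e12 p1) p2.
Qed.

Lemma indecomposable_young_extreme f chi : young_char f chi ->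
  indecomposable_character chi -> young_extreme f.
Proof.
move=> hp [_ hi] f1 f2 t h1 h2 t01 e.
have [chi1 c1 d1] := young_char_ex h1; have [chi2 c2 d2] := young_char_ex h2.
have hm := young_char_mix t c1 c2.
have ef : f = (fun l => t * f1 l + (1 - t) * f2 l) by exact/funext.
rewrite -ef in hm; have E := young_char_fun hp hm.
have E12 : chi1 = chi2 by apply: (hi _ _ t) => // x; rewrite E.
by rewrite E12 in c1; exact: young_char_coef c1 c2.
Qed.

Lemma young_extreme_indecomposable f chi : is_character chi -> young_char f chi ->
  young_extreme f -> indecomposable_character chi.
Proof.
move=> hc hp he; split=> // chi1 chi2 t c1 c2 t01 E.
have [f1 h1 p1] := young_char_exists c1; have [f2 h2 p2] := young_char_exists c2.
have E' : chi = (fun x => t%:C%C * chi1 x + (1 - t)%:C%C * chi2 x) by exact/funext.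
have hm := young_char_mix t p1 p2; rewrite -E' in hm.
have e12 : f1 = f2.
  apply: (he _ _ t) => // l.
  by rewrite (young_char_coef hp hm).
by rewrite e12 in p1; exact: young_char_fun p1 p2.
Qed.

Definition prodphi d f n l : R := f l * bern d n (ncells l).

Lemma sum_ups_prodphi d f n l : young_harmonic f ->
  \sum_(m <- ups l) prodphi d f n m = f l * bern d n (ncells l).+1.
Proof.
move=> [_ _ fh]; rewrite [in RHS]fh mulr_suml big_seq [RHS]big_seq.
by apply: eq_bigr => m /ups_ncells; rewrite /prodphi => ->.
Qed.

Lemma prodphi_harmonic d f : 0 <= d <= 1 -> young_harmonic f -> slow_harmonic (prodphi d f).
Proof.
move=> d01 hf; have [f0 f1 fh] := hf; split=> [n l ln||n l ln].
- by rewrite mulr_ge0 ?bern_ge0.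
- by rewrite /prodphi f1 mul1r /bern subnn !expr0 mulr1.
by rewrite sum_ups_prodphi // /prodphi (bern_rec d ln) mulrDr.
Qed.

Lemma prodphi_1 d f : young_harmonic f -> prodphi d f 1 ydiag0 = 1 - d.
Proof. by move=> [_ f1 _]; rewrite /prodphi f1 mul1r /bern expr0 mul1r expr1. Qed.

Lemma prodphi_inj d d' f f' : young_harmonic f -> young_harmonic f' ->
  slow_eq (prodphi d f) (prodphi d' f') -> d = d' /\ (d != 0 -> f = f').
Proof.
move=> hf hf' e; have dd : d = d'.
  by have := e 1%N ydiag0 isT; rewrite !prodphi_1 // => /(congr1 (fun x => 1 - x)); rewrite !subKr.
split=> // d0; apply/funext => l; have := e (ncells l) l (leqnn _).
rewrite /prodphi -dd /bern subnn expr0 mulr1 => /mulIf; apply.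
exact: expf_neq0.
Qed.

(* At d = 0 only the empty diagram carries mass. *)
Lemma prodphi0 f f' : young_harmonic f -> young_harmonic f' -> slow_eq (prodphi 0 f) (prodphi 0 f').
Proof.
move=> [_ f1 _] [_ f1' _] n l _; rewrite /prodphi /bern expr0n.
case: (eqVneq (ncells l) 0%N) => [l0|_]; last by rewrite !mul0r !mulr0.
have -> : l = ydiag0 by apply/eqP; have := mem_yseq 0 l; rewrite yseq0 inE l0 eqxx.
by rewrite f1 f1'.
Qed.

Lemma slow_geometric phi d : slow_harmonic phi ->
  (forall n l, (ncells l <= n)%N -> phi n.+1 l = (1 - d) * phi n l) ->
  d != 0 -> exists2 f, young_harmonic f & slow_eq phi (prodphi d f).
Proof.
move=> [p0 p1 ph] hg d0.
have geo n l : (ncells l <= n)%N -> phi n l = (1 - d) ^+ (n - ncells l) * phi (ncells l) l.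
  elim: n => [|n IH]; first by rewrite leqn0 => /eqP ->; rewrite subnn expr0 mul1r.
  rewrite leq_eqVlt => /orP[/eqP ->|]; first by rewrite subnn expr0 mul1r.
  by rewrite ltnS => ln; rewrite hg // IH // subSn // exprS mulrA.
pose f l := phi (ncells l) l / d ^+ ncells l.
have up l : d * phi (ncells l) l = \sum_(m <- ups l) phi (ncells l).+1 m.
  have := ph (ncells l) l (leqnn _); rewrite hg // => h.
  by rewrite -[LHS](addrK ((1 - d) * phi (ncells l) l)) {1}mulrBl mul1r; move: h; lra.
(* No sign is assumed for d: it is read off from harmonicity at the empty diagram, where the value
   is 1. *)
have dpos l : 0 < phi (ncells l) l -> 0 < d.
  move=> pl; have : 0 <= d * phi (ncells l) l.
    by rewrite up big_seq sumr_ge0 // => m /ups_ncells mE; apply: p0; rewrite mE.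
  by rewrite pmulr_lge0 // le_eqVlt eq_sym (negPf d0).
have d_gt0 : 0 < d by apply: (dpos ydiag0); rewrite p1 ltr01.
exists f; last first.
  move=> n l ln; rewrite geo // /prodphi /f /bern mulrA divfK ?expf_neq0 // mulrC //.
split.
- by move=> l; rewrite /f divr_ge0 ?p0 // exprn_ge0 // ltW.
- by rewrite /f p1 expr0 divr1.
move=> l; rewrite {1}/f; apply: (mulfI (expf_neq0 (ncells l).+1 d0)).
have -> : d ^+ (ncells l).+1 * (phi (ncells l) l / d ^+ ncells l) = d * phi (ncells l) l.
  by rewrite exprS mulrAC -!mulrA mulVf ?expf_neq0 // mulr1.
rewrite up mulr_sumr big_seq [RHS]big_seq; apply: eq_bigr => m /ups_ncells mE.
by rewrite /f mE mulrC divfK ?expf_neq0.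
Qed.

(** Every vertex other than the root has a predecessor whose value is a sum containing its own.
    There is no normalization, since the lemma serves to show that a component vanishing at the root
    is zero. *)
Lemma slow_le_root phi : (forall n l, (ncells l <= n)%N -> 0 <= phi n l) ->
  (forall n l, (ncells l <= n)%N -> phi n l = phi n.+1 l + \sum_(m <- ups l) phi n.+1 m) ->
  forall n l, (ncells l <= n)%N -> phi n l <= phi 0%N ydiag0.
Proof.
move=> p0 ph; elim=> [|n IH] m.
  by rewrite leqn0 => m0; have := mem_yseq 0 m; rewrite yseq0 inE m0 => /eqP ->.
have pos l : (ncells l <= n)%N -> 0 <= \sum_(m <- ups l) phi n.+1 m.
  by move=> ln; rewrite big_seq sumr_ge0 // => u /ups_ncells uE; apply: p0; rewrite uE.
rewrite leq_eqVlt => /orP[/eqP mn|]; last first.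
  by rewrite ltnS => mn; apply: le_trans (IH _ mn); rewrite (ph n) // lerDl pos.
have [|l lm] := @down_ex m; first by rewrite mn.
have ln : ncells l = n by have /add_cellP[_] := lm; rewrite mn => -[].
apply: le_trans (IH l _); last by rewrite ln.
rewrite [leRHS]ph ?ln // (big_rem m) ?mem_ups //= addrCA lerDl addr_ge0 //.
  by apply: p0; rewrite ln.
rewrite big_seq sumr_ge0 // => u /mem_rem/ups_ncells uE; apply: p0.
by rewrite uE ln.
Qed.

Lemma slow_extreme_geometric phi : slow_harmonic phi -> slow_extreme phi ->
  exists2 d, 0 <= d <= 1 &
    forall n l, (ncells l <= n)%N -> phi n.+1 l = (1 - d) * phi n l.
Proof.
move=> [p0 p1 ph] he; set q := phi 1%N ydiag0; exists (1 - q); last move=> n l ln.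
  have q0 : 0 <= q by exact: p0.
  have : q <= 1.
    rewrite -p1 (ph 0%N ydiag0 isT) lerDl big_seq sumr_ge0 // => m /ups_ncells mE.
    by apply: p0; rewrite mE.
  by lra.
rewrite subKr; have q0 : 0 <= q by exact: p0.
pose s n l := phi n.+1 l; pose r n l := \sum_(m <- ups l) phi n.+1 m.
have s0 n' l' : (ncells l' <= n')%N -> 0 <= s n' l'.
  by move=> ln'; apply: p0; exact: leqW.
have r0 n' l' : (ncells l' <= n')%N -> 0 <= r n' l'.
  by move=> ln'; rewrite /r big_seq sumr_ge0 // => m /ups_ncells mE; apply: p0; rewrite mE.
have sh n' l' : (ncells l' <= n')%N -> s n' l' = s n'.+1 l' + \sum_(m <- ups l') s n'.+1 m.
  by move=> ln'; rewrite /s ph // leqW.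
have rh n' l' : (ncells l' <= n')%N -> r n' l' = r n'.+1 l' + \sum_(m <- ups l') r n'.+1 m.
  move=> ln'; rewrite /r -big_split big_seq [RHS]big_seq; apply: eq_bigr => m /ups_ncells mE.
  by rewrite ph // mE.
have pE n' l' : (ncells l' <= n')%N -> phi n' l' = s n' l' + r n' l' by exact: ph.
have sq : s 0%N ydiag0 = q by [].
have sE : phi n.+1 l = s n l by [].
clearbody s r.
have rq : r 0%N ydiag0 = 1 - q by rewrite -p1 (pE 0%N ydiag0 isT) -sq addrC addKr.
have q1 : q <= 1 by rewrite -subr_ge0 -rq r0.
(* For q equal to 0 or 1 one of the two components cannot be normalized, but it vanishes by
   [slow_le_root]. *)
have [q00|q00] := eqVneq q 0.
  rewrite sE q00 mul0r; apply/eqP; rewrite eq_le s0 // andbT -[leRHS]q00 -sq.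
  exact: (slow_le_root s0 sh ln).
have [q11|q11] := eqVneq q 1.
  rewrite sE q11 mul1r -[LHS]addr0 (pE n l ln); congr (_ + _); apply/eqP; rewrite eq_sym eq_le r0 // andbT.
  have -> : 0 = r 0%N ydiag0 by rewrite rq q11 subrr.
  exact: (slow_le_root r0 rh ln).
have qp : 0 < q by rewrite lt_def q00.
have qm : 0 < 1 - q by rewrite subr_gt0 lt_def eq_sym q11.
have h1 : slow_harmonic (fun n l => q^-1 * s n l).
  split=> [n' l' ln'||n' l' ln']; first by rewrite mulr_ge0 ?s0 // invr_ge0.
    by rewrite sq mulVf.
  by rewrite sh // mulrDr mulr_sumr.
have h2 : slow_harmonic (fun n l => (1 - q)^-1 * r n l).
  split=> [n' l' ln'||n' l' ln']; first by rewrite mulr_ge0 ?r0 // invr_ge0 ltW.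
    by rewrite rq mulVf // lt0r_neq0.
  by rewrite rh // mulrDr mulr_sumr.
have e := he _ _ q h1 h2 _ _ n l ln.
have : q^-1 * s n l = (1 - q)^-1 * r n l.
  apply: e; first by rewrite qp -subr_gt0.
  by move=> n' l' ln'; rewrite !mulrA mulfV // mulfV ?gt_eqF // !mul1r pE.
move=> E; rewrite (pE n l ln); have -> : r n l = (1 - q) * (q^-1 * s n l).
  by rewrite E mulrA mulfV ?gt_eqF // mul1r.
by rewrite sE; field.
Qed.

End Extreme.

(** * Products with Bernoulli functions are exactly the extreme functions *)

Section Product.
Variable R : realType.
Implicit Types (phi : nat -> ydiag -> R) (f g : ydiag -> R) (d t : R).

Definition upsum g l : R := \sum_(m <- ups l) g m.

Definition itup j g : ydiag -> R := iter j upsum g.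

Lemma itupS j g l : itup j.+1 g l = \sum_(m <- ups l) itup j g m.
Proof. by []. Qed.

Lemma itupSr j g l : itup j.+1 g l = itup j (upsum g) l.
Proof. by rewrite /itup iterSr. Qed.

Lemma eq_itup j g g' l : (forall m, ncells m = (ncells l + j)%N -> g m = g' m) ->
  itup j g l = itup j g' l.
Proof.
elim: j l => [|j IH] l h; first by apply: h; rewrite addn0.
rewrite !itupS big_seq [RHS]big_seq; apply: eq_bigr => m /ups_ncells mE.
by apply: IH => u uE; apply: h; rewrite uE mE addSnnS.
Qed.

Lemma itup_ge0 j g l : (forall m, ncells m = (ncells l + j)%N -> 0 <= g m) -> 0 <= itup j g l.
Proof.
elim: j l => [|j IH] l h; first by apply: h; rewrite addn0.
rewrite itupS big_seq sumr_ge0 // => m /ups_ncells mE.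
by apply: IH => u uE; apply: h; rewrite uE mE addSnnS.
Qed.

Lemma itupD j g g' l : itup j (fun m => g m + g' m) l = itup j g l + itup j g' l.
Proof.
elim: j l => // j IH l; rewrite !itupS -big_split; apply: eq_bigr => m _.
exact: IH.
Qed.

Lemma itupZ j a g l : itup j (fun m => a * g m) l = a * itup j g l.
Proof.
elim: j l => // j IH l; rewrite !itupS mulr_sumr; apply: eq_bigr => m _.
exact: IH.
Qed.

(** Reduction to the Pascal graph: seen from (n, l), the sums over upward paths with j added cells
    depend on (N, j) only, and they inherit harmonicity. *)
Lemma itup_rec phi n l : slow_harmonic phi -> (ncells l <= n)%N ->
  pascal_rec (fun N j => itup j (phi (n + N)%N) l).
Proof.
move=> [_ _ ph] ln N j jN; rewrite itupSr -itupD addnS.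
by apply: eq_itup => m mE; rewrite ph // mE leq_add.
Qed.

Lemma itup_prodphi d f n l N j : young_harmonic f -> (ncells l <= n)%N -> (j <= N)%N ->
  itup j (prodphi d f (n + N)%N) l = prodphi d f n l * bern d N j.
Proof.
move=> [_ _ fh] ln jN.
have fj : itup j f l = f l.
  elim: {jN} j l {ln} => // j IH l; rewrite itupS [RHS]fh.
  by apply: eq_bigr => m _; rewrite IH.
rewrite (eq_itup (g' := fun m => bern d (n + N) (ncells l + j) * f m)) => [|m mE].
  rewrite itupZ fj /prodphi /bern mulrC -mulrA; congr (_ * _).
  have -> : (n + N - (ncells l + j) = (n - ncells l) + (N - j))%N.
    by rewrite subnDA addnC -addnBA // addnC -addnBA // addnC.
  by rewrite !exprD; ring.
by rewrite /prodphi mE mulrC.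
Qed.

(** Constancy in n leaves nothing for the upper neighbours in the harmonicity equation, so only the
    empty diagram carries mass. *)
Lemma slow_constant phi f : slow_harmonic phi ->
  (forall n l, (ncells l <= n)%N -> phi n.+1 l = (1 - 0) * phi n l) ->
  young_harmonic f -> slow_eq phi (prodphi 0 f).
Proof.
move=> [p0 p1 ph] g hf n l ln.
have g' n' l' : (ncells l' <= n')%N -> phi n'.+1 l' = phi n' l'.
  by move=> /g ->; rewrite subr0 mul1r.
case: (eqVneq (ncells l) 0%N) => [l0|l0].
  have -> : l = ydiag0 by apply/eqP; have := mem_yseq 0 l; rewrite yseq0 inE l0 eqxx.
  rewrite /prodphi; have [_ -> _] := hf; rewrite mul1r /bern expr0 mul1r subr0 expr1n.
  by elim: n {ln} => // n IH; rewrite g'.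
rewrite /prodphi /bern expr0n (negPf l0) mul0r mulr0.
have [|u ul] := @down_ex l; first by rewrite lt0n.
have uE : ncells l = (ncells u).+1 by have /add_cellP[] := ul.
case: n ln => [|n] ln; first by move: l0; rewrite -leqn0 ln.
have un : (ncells u <= n)%N by rewrite -ltnS -uE.
have := ph n u un; rewrite g' // => /eqP.
rewrite -{1}[phi n u]addr0 (inj_eq (addrI _)) eq_sym big_seq psumr_eq0 => [/allP h|m /ups_ncells mE].
  by have := h l; rewrite mem_ups ul => /(_ isT)/eqP.
by apply: p0; rewrite mE.
Qed.

(** Seen from each (n, l) through [itup], a summand is dominated by a multiple of a Bernoulli
    function, so it decays by the factor 1 - d. Hence both summands are products, and the
    extremality of f concludes; at d = 0 both are carried by the empty diagram. *)
Lemma prodphi_extreme d f : 0 <= d <= 1 -> young_harmonic f -> young_extreme f ->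
  slow_extreme (prodphi d f).
Proof.
move=> d01 hf fe phi1 phi2 t h1 h2 /andP[t0 t1] e.
have t1' : 0 < 1 - t by rewrite subr_gt0.
have key s s' psi psi' : 0 < s -> 0 < s' -> slow_harmonic psi -> slow_harmonic psi' ->
    slow_eq (prodphi d f) (fun n l => s * psi n l + s' * psi' n l) ->
    forall n l, (ncells l <= n)%N -> psi n.+1 l = (1 - d) * psi n l.
  move=> s0 s0' h h' e' n l ln.
  have hrec := itup_rec h ln; have [p0 _ ph] := h; have [p0' _ _] := h'.
  pose p1 N j := s * itup j (psi (n + N)%N) l.
  have : p1 1%N 1%N = d * p1 0%N 0%N.
    apply: (@pascal_dominated _ _ (fun N j => s' * itup j (psi' (n + N)%N) l) _ (prodphi d f n l)) => //.
    - by rewrite mulr_ge0 ?bern_ge0 //; case: hf.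
    - move=> N j jN; rewrite mulr_ge0 ?(ltW s0) // itup_ge0 // => m mE.
      by apply: p0; rewrite mE leq_add.
    - move=> N j jN; rewrite mulr_ge0 ?(ltW s0') // itup_ge0 // => m mE.
      by apply: p0'; rewrite mE leq_add.
    - by move=> N j jN; rewrite /p1 hrec // mulrDr.
    move=> N j jN; rewrite /p1 -!itupZ -itupD -(itup_prodphi d hf ln jN).
    by apply/esym/eq_itup => m mE; rewrite e' // mE leq_add.
  rewrite /p1 mulrCA => /(mulfI (lt0r_neq0 s0)); rewrite addn1 addn0 /= => hd.
  have := ph n l ln; rewrite -/(upsum _ _) hd => E.
  by move: E; lra.
have g1 := key _ _ _ _ t0 t1' h1 h2 e.
have g2 : forall n l, (ncells l <= n)%N -> phi2 n.+1 l = (1 - d) * phi2 n l.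
  by apply: (key _ _ _ _ t1' t0 h2 h1) => n l ln; rewrite e // addrC.
have [d0|d0] := eqVneq d 0.
  subst d.
  by move=> n l ln; rewrite (slow_constant h1 g1 hf) // (slow_constant h2 g2 hf).
have [f1 hf1 e1] := slow_geometric h1 g1 d0; have [f2 hf2 e2] := slow_geometric h2 g2 d0.
have e12 : f1 = f2.
  apply: (fe _ _ t) => //; first by rewrite t0.
  move=> l; have := e (ncells l) l (leqnn _); rewrite e1 // e2 // /prodphi.
  have b0 : bern d (ncells l) (ncells l) != 0 by rewrite /bern subnn expr0 mulr1 expf_neq0.
  by move: (bern _ _ _) b0 => b b0; rewrite !mulrA -mulrDl => /(mulIf b0).
by move=> n l ln; rewrite e1 // e2 // e12.
Qed.

Lemma single_row_ex k : exists l, ncells l = k /\ (size (val l) <= 1)%N.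
Proof.
have [l hl] : exists l, yrow l =1 (fun i => if i == 0%N then k else 0%N).
  by apply: (@yof_ex _ 1) => i //; case: i.
have sl : (size (val l) <= 1)%N by rewrite leqNgt -yrow_gt0 hl.
by exists l; split=> //; rewrite (ncells_sum sl) big_ord1 hl.
Qed.

Lemma single_row_eq l m : (size (val l) <= 1)%N -> (size (val m) <= 1)%N ->
  ncells l = ncells m -> l = m.
Proof.
move=> sl sm; rewrite (ncells_sum sl) (ncells_sum sm) !big_ord1 => E.
by apply: ydiag_ext => -[|i] //; rewrite !yrow_size //; [apply: leq_trans sm _|apply: leq_trans sl _].
Qed.

(* At d = 0 any extreme f will do, and this one is the easiest to exhibit. *)
Definition rowf (l : ydiag) : R := if (size (val l) <= 1)%N then 1 else 0.

Lemma sum_ups_row g l : (size (val l) <= 1)%N ->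
  (forall m, (1 < size (val m))%N -> g m = 0) ->
  exists m, [/\ m \in ups l, (size (val m) <= 1)%N & \sum_(u <- ups l) g u = g m].
Proof.
move=> sl g0; have [m [mk sm]] := single_row_ex (ncells l).+1; exists m.
have mu : m \in ups l.
  rewrite mem_ups; apply/add_cellP; split=> // i.
  case: i => [|i]; last by rewrite (yrow_size (leq_trans sl _)).
  by move: mk; rewrite (ncells_sum sl) (ncells_sum sm) !big_ord1 => ->; exact: leqnSn.
have uu : uniq (ups l) by rewrite filter_uniq ?yseq_uniq.
split=> //; rewrite (big_rem m) //= big_seq big1 ?addr0 // => u.
rewrite mem_rem_uniq // inE => /andP[um /ups_ncells uE].
apply: g0; rewrite ltnNge; apply: contra um => su.
by apply/eqP/single_row_eq => //; rewrite uE mk.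
Qed.

Lemma rowf_harmonic : young_harmonic rowf.
Proof.
split=> [l||l].
- by rewrite /rowf; case: ifP.
- by [].
case: (leqP (size (val l)) 1) => sl.
  have [|m [_ sm ->]] := @sum_ups_row rowf l sl; first by move=> m; rewrite ltnNge /rowf => /negPf ->.
  by rewrite /rowf sl sm.
rewrite {1}/rowf leqNgt sl /= big_seq big1 // => m; rewrite mem_ups => /add_cellP[lm _].
by rewrite /rowf leqNgt (leq_trans sl (yle_size lm)).
Qed.

(** A summand vanishes off the one-row diagrams, which form a single path of the Young graph;
    harmonicity propagates its value 1 along that path. *)
Lemma rowf_extreme : young_extreme rowf.
Proof.
have key f1 f2 s s' : young_harmonic f1 -> young_harmonic f2 -> 0 < s -> 0 < s' ->
    (forall l, rowf l = s * f1 l + s' * f2 l) -> f1 = rowf.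
  move=> [p0 p1 ph] [p0' _ _] s0 s0' e.
  have z m : (1 < size (val m))%N -> f1 m = 0.
    move=> sm; have := e m; rewrite {1}/rowf leqNgt sm /= => /esym/eqP.
    rewrite paddr_eq0 ?mulr_ge0 ?(ltW s0) ?(ltW s0') // => /andP[/eqP h _].
    by apply/eqP; move/eqP: h; rewrite mulf_eq0 gt_eqF.
  apply/funext => l; rewrite /rowf; case: leqP => [sl|/z //].
  move kE : (ncells l) => k; elim: k l sl kE => [|k IH] l sl lk.
    by rewrite -p1; congr f1; apply: single_row_eq.
  have [u [uk su]] := single_row_ex k; rewrite -(IH u su uk) (ph u).
  have [m [mu sm ->]] := sum_ups_row su z; congr f1; apply: single_row_eq => //.
  by rewrite lk (ups_ncells mu) uk.
move=> f1 f2 t h1 h2 /andP[t0 t1] e; have t1' : 0 < 1 - t by rewrite subr_gt0.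
rewrite (key f1 f2 t (1 - t)) // (key f2 f1 (1 - t) t) // => l.
by rewrite e addrC.
Qed.

Lemma slow_extreme_prod phi : slow_harmonic phi -> slow_extreme phi ->
  exists d f, [/\ 0 <= d <= 1, young_harmonic f, young_extreme f & slow_eq phi (prodphi d f)].
Proof.
move=> h he; have [d d01 hg] := slow_extreme_geometric h he; exists d.
have [d0|d0] := eqVneq d 0.
  exists rowf; split=> //; [exact: rowf_harmonic|exact: rowf_extreme|].
  by subst d; exact: slow_constant h hg rowf_harmonic.
have [f hf e] := slow_geometric h hg d0; exists f; split=> //.
move=> f1 f2 t h1 h2 t01 ef.
have e12 : slow_eq (prodphi d f1) (prodphi d f2).
  apply: (he _ _ t) => //; [exact: prodphi_harmonic|exact: prodphi_harmonic|].
  by move=> n l ln; rewrite e // /prodphi ef mulrDl !mulrA.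
by have [_ /(_ d0)] := prodphi_inj h1 h2 e12.
Qed.

End Product.

Import numFieldNormedType.Exports.
Local Open Scope classical_set_scope.
Local Open Scope ring_scope.

(** * Central measures on path spaces *)

Section Cylinders.
Variables (R : realType) (G : bgraph) (nb : G -> seq G).
Hypotheses (nb_uniq : forall v, uniq (nb v))
  (mem_nb : forall v w, (w \in nb v) = edge v w)
  (level_root : level (root : G) = 0%N)
  (level_edge : forall v w : G, edge v w -> level w = (level v).+1)
  (reach : forall v : G, exists p, fpath_to v p).
Implicit Types (t u : ipath G) (p q r : seq G) (v w : G).

Notation gpath := (path (@edge G) root).
Notation glast := (last (root : G)).

Definition prefix_of t n : seq G := mkseq (fun i => t i.+1) n.

Lemma ipath0 t : t 0%N = root.
Proof. by have /asboolP[] := valP t. Qed.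

Lemma ipath_edge t n : edge (t n) (t n.+1).
Proof. by have /asboolP[_ /(_ n)] := valP t. Qed.

Lemma cylinderE p t : cylinder p t <-> prefix_of t (size p) = p.
Proof.
have e n : mkseq t n.+1 = root :: prefix_of t n.
  by rewrite /mkseq /= ipath0 -[1%N]addn0 iotaDl -map_comp.
by rewrite /cylinder /= e; split=> [[]|->].
Qed.

Lemma prefix_ofS t n : prefix_of t n.+1 = rcons (prefix_of t n) (t n.+1).
Proof. exact: mkseqS. Qed.

Lemma size_prefix_of t n : size (prefix_of t n) = n.
Proof. exact: size_mkseq. Qed.

Lemma last_prefix_of t n : glast (prefix_of t n) = t n.
Proof. by case: n => [|n]; rewrite ?prefix_ofS ?last_rcons ?ipath0. Qed.

Lemma path_prefix_of t n : gpath (prefix_of t n).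
Proof.
elim: n => // n IH; rewrite prefix_ofS rcons_path IH last_prefix_of.
exact: ipath_edge.
Qed.

Lemma take_prefix_of t m n : (m <= n)%N -> take m (prefix_of t n) = prefix_of t m.
Proof. by move=> mn; rewrite /prefix_of /mkseq -map_take take_iota (minn_idPl mn). Qed.

Lemma level_last p : gpath p -> level (glast p) = size p.
Proof.
elim/last_ind: p => [|p w IH]; first by rewrite level_root.
by rewrite rcons_path last_rcons size_rcons => /andP[/IH <- /level_edge].
Qed.

Lemma fpath_size v p : fpath_to v p -> size p = level v.
Proof. by case=> /level_last <- ->. Qed.

Lemma cylinder_path p t : cylinder p t -> gpath p.
Proof. by move/cylinderE <-; exact: path_prefix_of. Qed.

Lemma cylinder_last p t : cylinder p t -> t (size p) = glast p.
Proof. by move/cylinderE => {2}<-; rewrite last_prefix_of. Qed.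

Lemma cylinder_npath p : ~~ gpath p -> cylinder p = set0.
Proof. by move=> np; rewrite -subset0 => t /cylinder_path; rewrite (negPf np). Qed.

Lemma cylinder_nil : cylinder [::] = [set: ipath G].
Proof. by apply/seteqP; split=> // t _; apply/cylinderE. Qed.

Lemma cylinder_root : cylinder [:: root] = set0 :> set (ipath G).
Proof.
by apply: cylinder_npath; apply/negP => /level_last /=; rewrite level_root.
Qed.

Lemma cylinder_rcons p w t :
  cylinder (rcons p w) t <-> cylinder p t /\ t (size p).+1 = w.
Proof.
rewrite !cylinderE size_rcons prefix_ofS; split=> [/rcons_inj[]|[-> ->]] //.
Qed.

Lemma cylinder_sub p q t : (size p <= size q)%N -> cylinder q t ->
  cylinder p t <-> take (size p) q = p.
Proof. by rewrite !cylinderE => pq <-; rewrite take_prefix_of. Qed.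

Lemma cylinderI p q : (size p <= size q)%N ->
  cylinder p `&` cylinder q = if take (size p) q == p then cylinder q else set0.
Proof.
move=> pq; apply/seteqP; split=> [t [tp tq]|t].
  by have /(cylinder_sub pq tq) -> := tp; rewrite eqxx.
by case: eqP => // e tq; split=> //; apply/(cylinder_sub pq tq).
Qed.

Lemma cylinders_setI : setI_closed (@cylinders G).
Proof.
suff H p q : (size p <= size q)%N -> cylinders (cylinder p `&` cylinder q).
  move=> _ _ [p _ <-] [q _ <-]; have [/H//|/ltnW/H] := leqP (size p) (size q).
  by rewrite setIC.
move=> /cylinderI ->; case: ifP => _; first by exists q.
by exists [:: root] => //; exact: cylinder_root.
Qed.

Lemma measurable_cylinder p : measurable (cylinder p : set (path_space G)).
Proof. by apply: sub_sigma_algebra; exists p. Qed.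

Lemma cylinder_measure_unique (m1 m2 : {measure set (path_space G) -> \bar R}) :
  (m1 setT < +oo)%E -> (forall p, m1 (cylinder p) = m2 (cylinder p)) ->
  forall A, measurable A -> m1 A = m2 A.
Proof.
move=> foo m12 A mA.
apply: (@measure_unique _ R (path_space G) (@cylinders G) (fun=> cylinder [::])) => //.
- exact: cylinders_setI.
- by move=> _; exists [::].
- by rewrite cylinder_nil; apply/seteqP; split=> // t _; exists 0%N.
- by move=> _ [p _ <-].
- by move=> _; rewrite cylinder_nil.
Qed.

Lemma measurable_next p (s : seq G) :
  measurable ([set t : ipath G | cylinder p t /\ t (size p).+1 \in s] : set (path_space G)).
Proof.
elim: s => [|w s IH].
  by rewrite (_ : mkset _ = set0) //; apply/seteqP; split=> t //= [].
rewrite (_ : mkset _ = cylinder (rcons p w) `|`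
    [set t : ipath G | cylinder p t /\ t (size p).+1 \in s]).
  by apply: measurableU => //; exact: measurable_cylinder.
apply/seteqP; split=> t /=.
  move=> [tp]; rewrite inE => /orP[/eqP e|]; last by right.
  by left; apply/cylinder_rcons.
case=> [/cylinder_rcons[tp ->]|[tp ts]]; split=> //; first exact: mem_head.
by rewrite inE ts orbT.
Qed.

Lemma measure_next (mu : {measure set (path_space G) -> \bar R}) p (s : seq G) : uniq s ->
  mu [set t : ipath G | cylinder p t /\ t (size p).+1 \in s] =
  (\sum_(w <- s) mu (cylinder (rcons p w)))%E.
Proof.
elim: s => [_|w s IH /= /andP[ws us]].
  rewrite big_nil (_ : mkset _ = set0) ?measure0 //.
  by apply/seteqP; split=> t //= [].
rewrite big_cons -IH // -measureU.
- congr (mu _); apply/seteqP; split=> t /=.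
    move=> [tp]; rewrite inE => /orP[/eqP e|]; last by right.
    by left; apply/cylinder_rcons.
  case=> [/cylinder_rcons[tp ->]|[tp ts]]; split=> //; first exact: mem_head.
  by rewrite inE ts orbT.
- exact: measurable_cylinder.
- exact: measurable_next.
- rewrite -subset0 => t [/cylinder_rcons[_ /= e] [_]].
  by rewrite e (negPf ws).
Qed.

Lemma measure_step (mu : {measure set (path_space G) -> \bar R}) p :
  mu (cylinder p) = (\sum_(w <- nb (glast p)) mu (cylinder (rcons p w)))%E.
Proof.
rewrite -measure_next //; congr (mu _); apply/seteqP; split=> [t tp|t []] //.
by split=> //; rewrite mem_nb -(cylinder_last tp) ipath_edge.
Qed.

Definition harmonic (phi : G -> R) :=
  [/\ forall v, 0 <= phi v, phi root = 1 &
      forall v, phi v = \sum_(w <- nb v) phi w].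

Definition extreme (phi : G -> R) := forall phi1 phi2 (t : R),
  harmonic phi1 -> harmonic phi2 -> 0 < t < 1 ->
  (forall v, phi v = t * phi1 v + (1 - t) * phi2 v) -> phi1 =1 phi2.

Definition law (M : probability (path_space G) R) (phi : G -> R) :=
  forall p, gpath p -> M (cylinder p) = (phi (glast p))%:E.

Lemma law_F M phi v : law M phi -> M (F_ v) = (phi v)%:E.
Proof.
by move=> hM; have [pp pv] := xgetPex [::] (reach v); rewrite /F_ hM // pv.
Qed.

Lemma law_central M phi : law M phi -> central M.
Proof. by move=> hM v p q [pp <-] [pq e]; rewrite !hM // e. Qed.

Lemma central_law M : central M ->
  law M (fun v => fine (M (F_ v))) /\ harmonic (fun v => fine (M (F_ v))).
Proof.
move=> cM; have hM : law M (fun v => fine (M (F_ v))).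
  move=> p pp; rewrite fineK; last by apply: fin_num_measure; exact: measurable_cylinder.
  by apply: (cM (glast p)) => //; apply: (xgetPex _ (reach _)).
split=> //; split=> [v||v].
- by rewrite fine_ge0.
- by apply: EFin_inj; rewrite -(hM [::]) // cylinder_nil probability_setT.
- have [p [pp <-]] := reach v; apply: EFin_inj; rewrite -hM // measure_step.
  rewrite -sumEFin; apply: eq_big_seq => w; rewrite mem_nb => e.
  by have := hM (rcons p w); rewrite rcons_path pp last_rcons; apply.
Qed.

Lemma law_unique M1 M2 phi : law M1 phi -> law M2 phi ->
  forall A, measurable A -> M1 A = M2 A.
Proof.
move=> h1 h2; apply: cylinder_measure_unique => [|p].
  by rewrite [X in (X < _)%E](probability_setT M1) ltry.
have [pp|np] := boolP (gpath p); last by rewrite cylinder_npath // !measure0.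
by transitivity ((phi (glast p))%:E); [exact: h1|rewrite -h2].
Qed.

(** * Exchange of initial segments and ergodicity *)

Section Swap.
Variables (M : probability (path_space G) R) (phi : G -> R).
Hypothesis hM : law M phi.
Variables (v : G) (p q : seq G).
Hypotheses (hp : fpath_to v p) (hq : fpath_to v q).

Let sizes : size p = size q.
Proof. by rewrite (fpath_size hp) (fpath_size hq). Qed.

(** Paths outside the cylinder of q are left alone, so that the map is total; it is only used on
    that cylinder. *)
Definition swap_seq t (n : nat) : G :=
  if asbool (cylinder q t) && (n <= size q)%N then nth root (root :: p) n else t n.

Lemma swap_seq_ipath t : is_ipath (swap_seq t).
Proof.
apply/asboolP; rewrite /swap_seq; split; first by case: ifP => //; rewrite ipath0.
move=> n; case: asboolP => [tq|_] /=; last exact: ipath_edge.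
have [pp lp] := hp; have [lt|le] := ltnP n (size q).
  by rewrite (ltnW lt) /=; apply: (pathP root pp); rewrite sizes.
case: leqP => [ge|_]; last exact: ipath_edge.
have en : n = size q by apply/eqP; rewrite eqn_leq ge le.
suff -> : nth root (root :: p) n = t n by exact: ipath_edge.
by rewrite en (cylinder_last tq) -sizes -last_nth lp; case: hq.
Qed.

Definition swap t : ipath G := exist _ (swap_seq t) (swap_seq_ipath t).

Lemma swapE t n : swap t n = swap_seq t n.
Proof. by []. Qed.

Lemma swap_tail t : tail_equiv t (swap t).
Proof.
by exists (size q).+1 => n hn; rewrite swapE /swap_seq leqNgt hn andbF.
Qed.

Lemma swap_out t : ~ cylinder q t -> swap t = t.
Proof. by move=> nq; apply/val_inj/funext => n; rewrite /= /swap_seq asboolF. Qed.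

Lemma swap_prefix t n : cylinder q t -> (size q <= n)%N ->
  prefix_of (swap t) n = p ++ drop (size q) (prefix_of t n).
Proof.
move=> tq qn; apply: (@eq_from_nth _ root).
  by rewrite size_cat size_drop !size_prefix_of sizes subnKC.
rewrite size_prefix_of => i lin; rewrite nth_mkseq // nth_cat.
rewrite swapE /swap_seq (asboolT tq) /= sizes; case: ltnP => // le.
rewrite nth_drop subnKC // nth_mkseq //.
Qed.

(** Both intersections are cylinders, of sequences ending at the same vertex unless they are empty
    or the full cylinders of p and q; centrality makes their measures equal. *)
Lemma swap_cylinder r : exists r1 r2,
  [/\ cylinder p `&` cylinder r = cylinder r1,
      cylinder q `&` swap @^-1` (cylinder r) = cylinder r2 &
      M (cylinder r1) = M (cylinder r2)].
Proof.
have Mpq : M (cylinder p) = M (cylinder q) by exact: law_central hM _ _ _ hp hq.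
have [pr|rp] := leqP (size p) (size r); last first.
  have eqr t : cylinder q t -> cylinder r (swap t) <-> take (size r) p = r.
    move=> tq; rewrite cylinderE -(@take_prefix_of _ _ (size q)); last first.
      by rewrite -sizes ltnW.
    by rewrite swap_prefix // drop_oversize ?size_prefix_of // cats0.
  rewrite setIC (cylinderI (ltnW rp)); case: eqP => e.
    exists p, q; split=> //; apply/seteqP; split=> [t []|t tq] //.
    by split=> //; apply/eqr.
  exists [:: root], [:: root]; rewrite cylinder_root; split=> //.
  by rewrite -subset0 => t [tq /(eqr _ tq)].
have eqr t : cylinder q t -> cylinder r (swap t) <->
    p ++ drop (size q) (prefix_of t (size r)) = r.
  by move=> tq; rewrite cylinderE swap_prefix // -sizes.
rewrite (cylinderI pr); case: eqP => e; last first.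
  exists [:: root], [:: root]; rewrite cylinder_root; split=> //.
  rewrite -subset0 => t [tq /(eqr _ tq) er]; case: e.
  by rewrite -er take_size_cat.
exists r, (q ++ drop (size p) r); split=> //.
  apply/seteqP; split=> t.
    move=> [tq /(eqr _ tq) er]; apply/cylinderE.
    rewrite size_cat size_drop -{1}sizes subnKC //.
    have /cylinderE qE := tq.
    rewrite -(cat_take_drop (size q) (prefix_of t (size r))).
    have -> : drop (size p) r = drop (size q) (prefix_of t (size r)).
      by rewrite -{1}er drop_size_cat.
    by rewrite take_prefix_of ?qE // -sizes.
  have s2 : size (q ++ drop (size p) r) = size r.
    by rewrite size_cat size_drop -sizes subnKC.
  move=> tr; have tq : cylinder q t.
    by apply/(cylinder_sub _ tr); rewrite ?take_size_cat // s2 -sizes.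
  split=> //; apply/(eqr _ tq); move/cylinderE: tr; rewrite s2 => ->.
  by rewrite drop_size_cat // -{1}e cat_take_drop.
have eqp : gpath (q ++ drop (size p) r) = gpath r.
  rewrite -[in RHS](cat_take_drop (size p) r) e !cat_path.
  by case: hp => -> ->; case: hq => -> ->.
have [gr|ngr] := boolP (gpath r).
  rewrite !hM ?eqp //; congr (phi _)%:E.
  rewrite -[in LHS](cat_take_drop (size p) r) e !last_cat.
  by case: hp => _ ->; case: hq => _ ->.
by rewrite !cylinder_npath ?eqp.
Qed.

Lemma measurable_swap : measurable_fun setT (swap : path_space G -> path_space G).
Proof.
apply: (@measurability _ _ (path_space G) (path_space G) setT swap (@cylinders G) erefl).
move=> _ [_ [r _ <-] <-]; rewrite setTI.
have [_ [r2 [_ e _]]] := swap_cylinder r.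
rewrite (_ : _ @^-1` _ = cylinder r2 `|` (cylinder r `\` cylinder q)).
  apply: measurableU; first exact: measurable_cylinder.
  by apply: measurableD; exact: measurable_cylinder.
rewrite -e; apply/seteqP; split=> t /=.
  have [tq|nq] := pselect (cylinder q t) => rt; first by left.
  by right; split=> //; rewrite -(swap_out nq).
by case=> [[]//|[rt /swap_out ->]].
Qed.

(* The event A does not distinguish a path through p from the path through q
   with the same tail, and this exchange of prefixes preserves M. *)
Lemma swap_measure (A : set (path_space G)) : measurable A -> tail_invariant A ->
  M (A `&` cylinder p) = M (A `&` cylinder q).
Proof.
move=> mA hA; have [mp mq] := (measurable_cylinder p, measurable_cylinder q).
pose sw : path_space G -> path_space G := swap.
pose m1 : {measure set (path_space G) -> \bar R} := mrestr M mp.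
pose m2 : {measure set (path_space G) -> \bar R} :=
  measure_function_pushforward__canonical__measure_function_Measure (mrestr M mq) measurable_swap.
suff e : m1 A = m2 A.
  transitivity (M (sw @^-1` A `&` cylinder q)); first exact: e.
  congr (M _).
  apply/seteqP; split=> t [At tq]; split=> //; last first.
    exact: hA (swap_tail t) At.
  apply: hA At; have [N hN] := swap_tail t; exists N => n /hN //.
apply: (@cylinder_measure_unique m1 m2) => //.
  have -> : m1 setT = M (cylinder p) by rewrite -[cylinder p]setTI.
  by apply: le_lt_trans (probability_le1 _ _) _ => //; exact: ltry.
move=> r; have [r1 [r2 [e1 e2 e]]] := swap_cylinder r.
transitivity (M (sw @^-1` cylinder r `&` cylinder q)) => //.
transitivity (M (cylinder r `&` cylinder p)) => //.
by rewrite setIC e1 e setIC -e2.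
Qed.

End Swap.

Lemma extreme_ergodic M phi : law M phi -> extreme phi -> ergodic M.
Proof.
move=> hM xphi.
(* Conditioning M on A gives the harmonic function f. If f is that of M, then M is its own
   conditional measure, which gives A measure 1. *)
have cond (A : set (path_space G)) (mA : measurable A) : tail_invariant A -> M A != 0%E ->
    exists f, [/\ harmonic f, forall v, fine (M (A `&` F_ v)) = fine (M A) * f v &
      f =1 phi -> M A = 1%E].
  (* The default of [mnormalize] is not reached, as the mass of A is finite and nonzero. *)
  move=> hA MA0; pose P : probability _ R := mnormalize (mrestr M mA) M.
  have MAT : mrestr M mA setT = M A by rewrite /mrestr setTI.
  have MAfin : M A \is a fin_num by exact: fin_num_measure.
  have PE B : P B = (M (B `&` A) * (fine (M A))^-1%:E)%E.
    rewrite /P /= /mnormalize; case: ifPn => [/orP[]/eqP e|_].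
    - by case/eqP: MA0; rewrite -MAT; exact: e.
    - have : M A = +oo%E by rewrite -MAT; exact: e.
      by move=> e'; rewrite e' in MAfin.
    - exact: (congr1 (fun e => M (B `&` A) * (fine e)^-1%:E)%E MAT).
  have cP : central P.
    move=> v p q hp hq; rewrite !PE ![_ `&` A]setIC.
    by rewrite (swap_measure hM hp hq mA hA).
  have [lP fP] := central_law cP; eexists; split; [exact: fP| |] => [v|e].
    have mF : measurable (A `&` F_ v).
      by apply: measurableI => //; exact: measurable_cylinder.
    rewrite /= PE fineM ?fin_num_measure // 1?setIC //= mulrC mulfVK //.
    by rewrite fine_eq0.
  have lPphi : law P phi by move=> r pr; rewrite lP // e.
  have := law_unique hM lPphi mA; rewrite PE setIid => ->.
  by rewrite -{1}(fineK MAfin) -EFinM mulfV // fine_eq0.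
move=> A mA hA; have [->|A0] := eqVneq (M A) 0%E; [by left|right].
have hAc : tail_invariant (~` A).
  by move=> t u [N tu] nAt Au; apply: nAt; apply: hA Au; exists N => n /tu.
have [f1 [h1 e1 k1]] := cond A mA hA A0.
have MAE : M A = (fine (M A))%:E by rewrite fineK // fin_num_measure.
have MAC : M (~` A) = (1 - fine (M A))%:E.
  by have := probability_setC M mA; rewrite MAE EFinB => e; exact: e.
set a := fine (M A) in e1 MAE MAC.
have [a1|a1] := eqVneq a 1; first by rewrite MAE a1.
have Ac0 : M (~` A) != 0%E by rewrite MAC eqe subr_eq0 eq_sym.
have [f2 [h2 e2 k2]] := cond _ (measurableC mA) hAc Ac0.
have phiE v : phi v = a * f1 v + (1 - a) * f2 v.
  have mF : measurable (F_ v : set (path_space G)) by exact: measurable_cylinder.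
  have [mAF mCF] : measurable (A `&` F_ v) /\ measurable (~` A `&` F_ v).
    by split; apply: measurableI => //; exact: measurableC.
  have fC : fine (M (~` A)) = 1 - a by rewrite [X in fine X]MAC.
  rewrite -fC -e1 -e2 -fineD ?fin_num_measure //.
  rewrite -measureU //; last by rewrite setIACA setICr set0I.
  by rewrite -setIUl setUv setTI [X in fine X](law_F v hM).
have a01 : 0 < a < 1.
  rewrite !lt_neqAle a1 eq_sym -(inj_eq (@EFin_inj _)) -MAE A0 -lee_fin -MAE /=.
  by rewrite measure_ge0 -lee_fin -MAE probability_le1.
have f12 := xphi _ _ _ h1 h2 a01 phiE.
apply: k1 => v; rewrite phiE -f12 -mulrDl.
by rewrite addrC subrK mul1r.
Qed.

End Cylinders.

(** * Construction of a measure from a harmonic function *)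

Section Existence.
Variables (R : realType) (G : bgraph) (nb : G -> seq G).
Hypotheses (nb_uniq : forall v, uniq (nb v))
  (mem_nb : forall v w, (w \in nb v) = edge v w).
Variable phi : G -> R.
Hypothesis hphi : harmonic nb phi.
Implicit Types (v w : G) (p : seq G) (x a : R) (d : G * R).

Let phi_ge0 v : 0 <= phi v. Proof. by case: hphi. Qed.

(* The point x selects the subinterval of [a, a + sum[ that contains it; the
   default value d is returned only for x outside of this interval. *)
Fixpoint pick_next d (s : seq G) a x : G * R :=
  if s is w :: s' then
    if x < a + phi w then (w, a) else pick_next d s' (a + phi w) x
  else d.

Lemma pick_next_in d s a x : a <= x < a + \sum_(w <- s) phi w ->
  (pick_next d s a x).1 \in s.
Proof.
elim: s a => [|w s IH] a /= /andP[ax]; first by rewrite big_nil; lra.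
rewrite big_cons addrA => xs; case: ltP => h; first exact: mem_head.
by rewrite inE IH ?orbT // h xs.
Qed.

Lemma pick_next_mem d s a x : (pick_next d s a x).1 \in d.1 :: s.
Proof.
elim: s a => [|w s IH] a /=; first exact: mem_head.
case: ifP => _; first by rewrite !inE eqxx orbT.
by have := IH (a + phi w); rewrite !inE => /orP[->//|->]; rewrite !orbT.
Qed.

(** b is the left end of the subinterval assigned to w; it does not depend on x. *)
Lemma pick_nextP d s a w : uniq s -> w \in s ->
  exists b, [/\ a <= b, b + phi w <= a + \sum_(u <- s) phi u &
    forall x, a <= x < a + \sum_(u <- s) phi u ->
      ((pick_next d s a x).1 = w <-> b <= x < b + phi w) /\
      ((pick_next d s a x).1 = w -> (pick_next d s a x).2 = b)].
Proof.
elim: s a => // u s IH a /= /andP[us uqs].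
have s0 : 0 <= \sum_(u <- s) phi u by apply: sumr_ge0 => *; exact: phi_ge0.
rewrite inE big_cons addrA; have [-> _|wu /= ws] := eqVneq w u.
  exists a; split=> [//||x /andP[ax xs]]; first by rewrite lerDl.
  case: ltP => h /=; first by rewrite ax.
  have := @pick_next_in d s (a + phi u) x; rewrite h xs => /(_ isT) hin.
  have nu : (pick_next d s (a + phi u) x).1 <> u by move=> e; rewrite e (negPf us) in hin.
  by split=> [|/nu//]; split=> [/nu//|/andP[]].
have [b [ab bs bP]] := IH (a + phi u) uqs ws; have pu := phi_ge0 u.
exists b; split=> [|//|x /andP[ax xs]]; first lra.
case: ltP => h /=; last by apply: bP; rewrite h xs.
have uw : u <> w by move=> e; rewrite e eqxx in wu.
split=> [|/uw//]; split=> [/uw//|/andP[bx _]].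
by move: (le_trans ab bx); rewrite leNgt h.
Qed.

(** A state is a vertex with the left end of its interval, whose length is the value of [phi] there.
    The default is some neighbour of the vertex, so that every x yields a path. *)
Definition next_state x d : G * R :=
  pick_next (xchoose (edge_ex d.1), d.2) (nb d.1) d.2 x.

Definition state x n : G * R := iter n (next_state x) (root, 0).

Definition state_vertex x (n : nat) : G := (state x n).1.

Lemma state_ipath x : is_ipath (state_vertex x).
Proof.
apply/asboolP; rewrite /state_vertex; split=> // n; rewrite /state iterS /next_state.
set d := iter n _ _.
have := pick_next_mem (xchoose (edge_ex d.1), d.2) (nb d.1) d.2 x.
by rewrite inE mem_nb => /orP[/eqP ->|] //; exact: xchooseP (edge_ex d.1).
Qed.

Definition real_path x : ipath G := exist _ (state_vertex x) (state_ipath x).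

(** The preimage of a cylinder is a half-open interval of the prescribed length, which yields both
    measurability and the law. *)
Lemma real_path_cylinder p : path edge root p -> exists b,
  [/\ 0 <= b, b + phi (last root p) <= 1 & forall x, 0 <= x < 1 ->
    (cylinder p (real_path x) <-> b <= x < b + phi (last root p)) /\
    (cylinder p (real_path x) -> (state x (size p)).2 = b)].
Proof.
have [_ phi1 phiS] := hphi.
elim/last_ind: p => [_|p w IH].
  exists 0; rewrite /= phi1 add0r; split=> [||x x01]; [lra|lra|].
  by split=> //; rewrite x01 cylinder_nil.
rewrite rcons_path last_rcons => /andP[/IH [a [a0 a1 aP]]].
rewrite -mem_nb; set v := last root p in a1 aP *.
move=> /(@pick_nextP (xchoose (edge_ex v), a) _ a w (nb_uniq v)) [b []].
rewrite -phiS => ab bv bP; have pw := phi_ge0 w.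
exists b; split=> [||x x01]; [lra|lra|].
have [h1 h2] := aP x x01; rewrite size_rcons.
have st : cylinder p (real_path x) ->
    state x (size p).+1 = pick_next (xchoose (edge_ex v), a) (nb v) a x.
  move=> xp; rewrite /state iterS -/(state x (size p)) /next_state h2 //.
  by have e : (state x (size p)).1 = v := cylinder_last xp; rewrite e.
split; last first.
  move=> /cylinder_rcons[xp e]; have /bP [_ k] := h1.1 xp.
  by rewrite st // k // -st.
split=> [/cylinder_rcons[xp e]|xb].
  by apply/(bP x (h1.1 xp)).1; rewrite -st.
have xa : a <= x < a + phi v by lra.
have xp := h1.2 xa; apply/cylinder_rcons; split=> //.
by move/(bP x xa).1: xb; rewrite -st.
Qed.

(* A value in [0, 1[ for every real, so that the path is defined on all of R. *)
Definition clamp x : R := if 0 <= x < 1 then x else 0.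

Lemma measurable_real_path :
  measurable_fun setT (fun x : measurableTypeR R => real_path (clamp x) : path_space G).
Proof.
apply: (@measurability _ _ _ (path_space G) setT _ (@cylinders G) erefl).
move=> _ [_ [p _ <-] <-]; rewrite setTI.
have [pp|np] := boolP (path edge root p); last by rewrite cylinder_npath ?preimage_set0.
have [b [b0 b1 bP]] := real_path_cylinder pp.
have c0 x : ~~ (0 <= x < 1) -> clamp x = 0 by rewrite /clamp => /negPf ->.
have c1 x : 0 <= x < 1 -> clamp x = x by rewrite /clamp => ->.
(* Points outside of [0, 1[ are clamped to 0, so they lie in the preimage exactly when the path of 0
   is in the cylinder. *)
have [z|z] := pselect (cylinder p (real_path 0)).
  rewrite (_ : _ @^-1` _ = `[b, b + phi (last root p)[ `|` ~` `[0, 1[).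
    by apply: measurableU; [|apply: measurableC].
  apply/seteqP; split=> x /=; rewrite !in_itv /=; have [x01|x01] := boolP (0 <= x < 1).
  - by rewrite c1 // => /(bP x x01).1; left.
  - by move=> _; right; exact/negP.
  - by rewrite c1 // => -[/(bP x x01).1|].
  - by rewrite c0.
rewrite (_ : _ @^-1` _ = `[b, b + phi (last root p)[%classic).
  exact: measurable_itv.
apply/seteqP; split=> x /=; rewrite !in_itv /=; have [x01|x01] := boolP (0 <= x < 1).
- by rewrite c1 // => /(bP x x01).1.
- by rewrite c0.
- by rewrite c1 // => /(bP x x01).1.
- by move: x01; rewrite negb_and => /orP[] h xb; exfalso; move: h; lra.
Qed.

Theorem harmonic_law : exists M : probability (path_space G) R, law M phi.
Proof.
have m01 : measurable (`[0, 1[ : set (measurableTypeR R)) by exact: measurable_itv.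
pose mu : {measure set (path_space G) -> \bar R} :=
  measure_function_pushforward__canonical__measure_function_Measure
    (mrestr lebesgue_measure m01) measurable_real_path.
have muE p : path edge root p -> mu (cylinder p) = (phi (last root p))%:E.
  move=> pp; have [b [b0 b1 bP]] := real_path_cylinder pp.
  transitivity (lebesgue_measure (`[b, b + phi (last root p)[ : set R)).
    congr (lebesgue_measure _); apply/seteqP; split=> x /=; rewrite !in_itv /=.
      by rewrite /clamp => -[xp x01]; move: xp; rewrite x01 => /(bP x x01).1.
    move=> xb; have x01 : 0 <= x < 1 by lra.
    by split=> //; rewrite /clamp x01; apply/(bP x x01).1.
  rewrite lebesgue_measure_itv /= lte_fin ltrDl lt_neqAle phi_ge0 andbT eq_sym.
  by case: eqP => [->//|_]; rewrite -EFinB addrC addKr.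
have mu1 : mu setT = 1%E by rewrite -cylinder_nil (muE [::]) //=; case: hphi => _ ->.
(* The mass is already 1; normalization only packages [mu] as a probability. *)
exists (mnormalize mu (dirac point)) => p pp.
rewrite /= /mnormalize mu1 eqe oner_eq0 /=.
by rewrite invr1 mule1; exact: muE.
Qed.

End Existence.

(** Induction on the number of steps left after a finite path, which has finitely many
    continuations. *)
Lemma measurable_vertex (G : bgraph) (nb : G -> seq G)
    (mem_nb : forall v w, (w \in nb v) = edge v w) (Q : pred G) n :
  measurable ([set t : ipath G | Q (t n)] : set (path_space G)).
Proof.
suff H N p : measurable ([set t : ipath G | cylinder p t /\ Q (t (size p + N)%N)]
    : set (path_space G)).
  have := H n [::]; rewrite cylinder_nil (_ : mkset _ = [set t : ipath G | Q (t n)]) //.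
  by apply/seteqP; split=> t //= [].
elim: N p => [|N IH] p.
  have [Qp|Qp] := boolP (Q (last root p)).
    rewrite (_ : mkset _ = cylinder p); first exact: measurable_cylinder.
    by apply/seteqP; split=> t => [[]//|tp]; split; rewrite // addn0 (cylinder_last tp).
  rewrite (_ : mkset _ = set0) //; apply/seteqP; split=> t //= [tp].
  by rewrite addn0 (cylinder_last tp) (negPf Qp).
rewrite (_ : mkset _ = \bigcup_(w in [set` nb (last root p)])
    [set t : ipath G | cylinder (rcons p w) t /\ Q (t (size (rcons p w) + N)%N)]).
  by apply: fin_bigcup_measurable => [|w _]; [exact: finite_seq|exact: IH].
apply/seteqP; split=> t /=.
  move=> [tp Qt]; exists (t (size p).+1).
    by rewrite /= mem_nb -(cylinder_last tp) ipath_edge.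
  by split; [apply/cylinder_rcons|rewrite size_rcons addSnnS].
by case=> w _ [/cylinder_rcons[tp _]]; rewrite size_rcons addSnnS.
Qed.

(** * The Pascal graph *)

Section PascalGraph.
Variable R : realType.
Implicit Types (v w : pascal_graph) (t : ipath pascal_graph) (d : R).
Local Notation PG := pascal_graph.

(* The root stands for the nonexistent vertices (n, k) with n < k. *)
Definition pascal_pt (n k : nat) : PG :=
  insubd pascal_root ((n, k) : nat * nat).

Definition pascal_nb v : seq PG :=
  [:: pascal_pt (val v).1.+1 (val v).2; pascal_pt (val v).1.+1 (val v).2.+1].

Lemma val_pascal_pt n k : (k <= n)%N -> val (pascal_pt n k) = (n, k).
Proof. by move=> kn; apply: (insubdK pascal_root); exact: kn. Qed.

Lemma pascal_ptE v : pascal_pt (val v).1 (val v).2 = v.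
Proof.
apply: val_inj; rewrite val_pascal_pt; last exact: (valP v).
by case: (val v).
Qed.

Lemma pascal_pt_inj n k v : (k <= n)%N -> (pascal_pt n k == v) = (val v == (n, k)).
Proof. by move=> kn; rewrite -val_eqE eq_sym val_pascal_pt. Qed.

Lemma mem_pascal_nb v w : (w \in pascal_nb v) = edge v w.
Proof.
have := valP v; rewrite /= => kn; rewrite !inE ![w == _]eq_sym !pascal_pt_inj // 1?leqW //.
rewrite -!pair_eqE /=. by rewrite /pascal_edge andb_orr.
Qed.

Lemma pascal_nb_uniq v : uniq (pascal_nb v).
Proof.
have kn : ((val v).2 <= (val v).1)%N := valP v.
rewrite /= inE andbT pascal_pt_inj 1?leqW // val_pascal_pt //.
by rewrite -pair_eqE /= eqxx (gtn_eqF (ltnSn _)).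
Qed.

Lemma pascal_level_root : level (root : PG) = 0%N. Proof. by []. Qed.

Lemma pascal_level_edge v w : edge v w -> level w = (level v).+1.
Proof. by case/andP=> /eqP. Qed.

Lemma pascal_reach v : exists p, fpath_to v p.
Proof.
case: v => -[n k] /= kn; elim: n => [|n IH] in k kn *.
  by exists [::]; split=> //; apply: val_inj; move: kn; case: k.
case: k kn => [|k] kn.
  have [p [pp e]] := IH 0%N isT.
  exists (rcons p (exist _ (n.+1, 0%N) kn)); split; last by rewrite last_rcons.
  by rewrite rcons_path pp e /= /pascal_edge /= !eqxx.
have [p [pp e]] := IH k kn.
exists (rcons p (exist _ (n.+1, k.+1) kn)); split; last by rewrite last_rcons.
by rewrite rcons_path pp e /= /pascal_edge /= !eqxx orbT.
Qed.

Lemma pascal_harmonicP (phi : PG -> R) : harmonic pascal_nb phi ->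
  [/\ forall n k, (k <= n)%N -> 0 <= phi (pascal_pt n k), phi (pascal_pt 0 0) = 1 &
      pascal_rec (fun n k => phi (pascal_pt n k))].
Proof.
case=> h0 h1 hS; split=> [n k _||n k kn]; first exact: h0.
  by rewrite (pascal_ptE root).
by rewrite hS /pascal_nb big_cons big_seq1 val_pascal_pt.
Qed.

Lemma bern_harmonic d : 0 <= d <= 1 ->
  harmonic pascal_nb (fun v => bern d (val v).1 (val v).2).
Proof.
move=> d01; split=> [v||v]; first exact: bern_ge0.
  by rewrite /bern /= expr0 mulr1.
have kn : ((val v).2 <= (val v).1)%N := valP v.
rewrite /pascal_nb big_cons big_seq1 (bern_rec d kn) !val_pascal_pt //.
exact: leqW.
Qed.

Lemma pascal_mean_shift (phi : PG -> R) d :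
  (forall n k, (k <= n)%N -> phi (pascal_pt n.+1 k.+1) = d * phi (pascal_pt n k)) ->
  harmonic pascal_nb phi -> forall v, phi v = bern d (val v).1 (val v).2.
Proof.
move=> hd /pascal_harmonicP[_ h1 hS] v; rewrite -{1}(pascal_ptE v).
have := valP v; case: (val v) => n k /=; elim: n k => [|n IH] [|k] //= kn.
- by rewrite h1 /bern expr0 mulr1.
- have := hS n 0%N isT; rewrite hd // IH // => /eqP; rewrite -subr_eq => /eqP <-.
  by rewrite /bern !subn0 exprS; ring.
- by rewrite hd // IH // /bern subSS exprS mulrA.
Qed.

Lemma bern_extreme d : 0 <= d <= 1 ->
  extreme pascal_nb (fun v => bern d (val v).1 (val v).2).
Proof.
move=> d01; have [d0 d1] := andP d01.
suff H (phi1 phi2 : PG -> R) (t : R) : harmonic pascal_nb phi1 ->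
    harmonic pascal_nb phi2 -> 0 < t < 1 ->
    (forall v, bern d (val v).1 (val v).2 = t * phi1 v + (1 - t) * phi2 v) ->
    forall v, phi1 v = bern d (val v).1 (val v).2.
  move=> phi1 phi2 t h1 h2 t01 e v; rewrite (H _ _ _ h1 h2 t01 e v).
  have t01' : 0 < 1 - t < 1 by lra.
  rewrite (H _ _ _ h2 h1 t01') // => u; rewrite e; ring.
move=> h1 h2 t01 e; apply: pascal_mean_shift => // n k kn.
have [t0 t1] : 0 <= t /\ 0 <= 1 - t by lra.
have tn0 : t != 0 by apply/eqP; lra.
have [[p10 _ p1S] [p20 _ _]] := (pascal_harmonicP h1, pascal_harmonicP h2).
apply: (mulfI tn0); rewrite mulrCA.
have := @pascal_dominated R (fun m j => t * phi1 (pascal_pt (n + m) (k + j)))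
  (fun m j => (1 - t) * phi2 (pascal_pt (n + m) (k + j))) d (bern d n k).
rewrite !addn1 !addn0; apply=> //.
- exact: bern_ge0.
- by move=> m j jm; rewrite mulr_ge0 // p10 // leq_add.
- by move=> m j jm; rewrite mulr_ge0 // p20 // leq_add.
- by move=> m j jm; rewrite p1S ?leq_add // mulrDr !addnS.
- move=> m j jm; rewrite -e val_pascal_pt ?leq_add //= /bern.
  rewrite mulrACA -!exprD addnBA // addnC addnBAC // -subnDA.
  by rewrite [(j + k)%N]addnC [(n + m)%N]addnC.
Qed.

(** From the end of p there are C(N, J) paths to the vertex with J increments, all of the same
    measure by centrality; the induction splits off the first step after p. *)
Lemma pascal_count (M : probability (path_space PG) R) (phi : PG -> R) (P : pred nat) N (p : seq PG) :
  harmonic pascal_nb phi -> law M phi -> path edge root p ->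
  let n := (val (last root p : PG)).1 in let k := (val (last root p : PG)).2 in
  M ([set t : ipath PG | P (val (t (n + N)%N)).2] `&` cylinder p) =
  (\sum_(J < N.+1) 'C(N, J)%:R *
     (phi (pascal_pt (n + N) (k + J)) * (P (k + J)%N)%:R))%:E.
Proof.
move=> hphi hM pp n k.
have [m em] : exists m, m = (n + N)%N by exists (n + N)%N.
rewrite -em; pose Q : pred PG := fun v => P (val v).2.
have mQ := measurable_vertex mem_pascal_nb Q m.
have := @measure_step R PG pascal_nb pascal_nb_uniq mem_pascal_nb (mrestr M mQ).
rewrite /mrestr => step.
rewrite setIC /n /k in em *; clear n k; elim: N p pp em => [|N IH] p pp em.
  rewrite big_ord1 bin0 mul1r !addn0.
  have mp : m = size p by rewrite em addn0 -(level_last pascal_level_root pascal_level_edge pp).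
  have e t : cylinder p t -> (val (t m)).2 = (val (last root p)).2.
    by move=> tp; rewrite mp (cylinder_last tp).
  have e2 : pascal_pt m (val (last root p)).2 = last root p.
    by rewrite em addn0 pascal_ptE.
  rewrite e2; case: (boolP (P _)) => Pp.
    rewrite mulr1 -hM //; congr (M _); apply/seteqP; split=> t; first by case.
    by move=> tp; split=> //=; rewrite e.
  rewrite mulr0 -[RHS](@measure0 _ _ _ M); congr (M _).
  by apply/seteqP; split=> t //= [/e -> ]; rewrite (negPf Pp).
have kn : ((val (last root p)).2 <= (val (last root p)).1)%N := valP (last root p).
have rec w : edge (last root p) w ->
    M (cylinder (rcons p w) `&` [set t : ipath PG | P (val (t m)).2]) =
    (\sum_(J < N.+1) 'C(N, J)%:R *
     (phi (pascal_pt m ((val w).2 + J)) * (P ((val w).2 + J)%N)%:R))%:E.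
  move=> ew; rewrite IH ?last_rcons ?rcons_path ?pp //.
  by have := pascal_level_edge ew => /= ->; rewrite em addSnnS.
have := step p; rewrite /pascal_nb big_cons big_seq1 /= => h.
transitivity (M (cylinder p `&` [set t : ipath PG | Q (t m)])); first by [].
have e1 : edge (last root p) (pascal_pt (val (last root p)).1.+1 (val (last root p)).2).
  by rewrite -mem_pascal_nb inE eqxx.
have e2 : edge (last root p) (pascal_pt (val (last root p)).1.+1 (val (last root p)).2.+1).
  by rewrite -mem_pascal_nb !inE eqxx orbT.
rewrite [LHS]h; etransitivity.
  exact: (f_equal2 (fun x y : \bar R => x + y)%E (rec _ e1) (rec _ e2)).
have kn1 := leqW kn; rewrite -EFinD !val_pascal_pt //=; congr _%:E.
rewrite -big_split /=.
rewrite (binsum_step (fun J => phi (pascal_pt m ((val (last root p)).2 + J)) *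
  (P ((val (last root p)).2 + J)%N)%:R)).
by apply: eq_bigr => J _; rewrite -mulrDr addSnnS.
Qed.

End PascalGraph.

(** * Upper limits of events *)

Section BorelCantelli.
Context d (T : measurableType d) (R : realType) (M : probability T R).
Implicit Type E : nat -> set T.

Lemma measurable_lim_sup_set E : (forall n, measurable (E n)) -> measurable (lim_sup_set E).
Proof.
by move=> mE; apply: bigcap_measurable => // n _; apply: bigcup_measurable => k _.
Qed.

(** Convergence almost everywhere implies convergence in probability, by continuity from above along
    the unions of the tails. *)
Lemma lim_sup_set_null_measure E : (forall n, measurable (E n)) ->
  M.-negligible (lim_sup_set E) ->
  forall e, 0 < e -> exists N, forall n, (N <= n)%N -> (M (E n) <= e%:E)%E.
Proof.
move=> mE /(negligibleP _ (measurable_lim_sup_set mE)) M0 e e0.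
have fin : (M (\bigcup_(k >= 0) E k) < +oo)%E.
  apply: le_lt_trans (probability_le1 _ _) (ltry _).
  by apply: bigcup_measurable => k _.
have := lim_sup_set_cvg M E mE fin; rewrite M0.
move=> /fine_cvgP[_ /cvgrPdist_lt /(_ e e0)[N _ hN]]; exists N => n /hN /=.
have mU : measurable (\bigcup_(k >= n) E k) by apply: bigcup_measurable => k _.
rewrite sub0r normrN ger0_norm ?fine_ge0 // => h.
apply: (@le_trans _ _ (M (\bigcup_(k >= n) E k))).
  by apply: le_measure; rewrite ?inE // => t Et; exists n => //=.
by rewrite -(fineK (fin_num_measure M _ mU)) lee_fin ltW.
Qed.

Lemma lim_sup_set_square E c : (forall n, measurable (E n)) ->
  (forall n, (M (E n) <= (c / n.+1%:R ^+ 2)%:E)%E) -> M.-negligible (lim_sup_set E).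
Proof.
move=> mE hE; apply/(negligibleP _ (measurable_lim_sup_set mE)).
have c0 : 0 <= c.
  by have := le_trans (measure_ge0 M (E 0%N)) (hE 0%N); rewrite lee_fin expr1n divr1.
apply: lim_sup_set_cvg0 => //; apply: (@le_lt_trans _ _ (2 * c)%:E); last exact: ltry.
apply: lime_le; first by apply: is_cvg_nneseries => n _ _.
(* The partial sums telescope, because 1/x^2 is at most 2 (1/x - 1/(x+1)) for x >= 1. *)
apply: nearW => n; apply: (@le_trans _ _ (2 * c * (1 - n.+1%:R^-1))%:E); last first.
  by rewrite lee_fin ler_piMr ?mulr_ge0 // gerBl invr_ge0.
elim: n => [|n IH]; first by rewrite big_nil invr1 subrr mulr0.
rewrite big_nat_recr //=; apply: (le_trans (leeD IH (hE n))); rewrite -EFinD lee_fin.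
have -> : (n.+2%:R : R) = n.+1%:R + 1 by rewrite -addn1 natrD.
set x : R := n.+1%:R; have x1 : 1 <= x by rewrite ler1n.
have h : x ^- 2 <= 2 * (x^-1 - (x + 1)^-1).
  have -> : 2 * (x^-1 - (x + 1)^-1) = 2 / (x * (x + 1)) by field; apply/andP; split; apply/eqP; lra.
  rewrite -[_ ^- _]mul1r ler_pdivrMr; last by rewrite exprn_gt0 //; lra.
  by rewrite mulrAC ler_pdivlMr; nra.
move: (ler_wpM2l c0 h); move: (x ^- 2) x^-1 (x + 1)^-1 => z a b. lra.
Qed.

End BorelCantelli.

(** * Bernoulli measures and limit frequencies *)

Section PascalMeasures.
Variable R : realType.
Implicit Types (d e : R) (M : probability (path_space pascal_graph) R).
Local Notation PG := pascal_graph.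

Definition deviates d e (n k : nat) : bool := e < `|k%:R / n%:R - d|.

Definition deviation d e n : set (path_space PG) :=
  [set t : ipath PG | deviates d e n (val (t n)).2].

Lemma measurable_deviation d e n : measurable (deviation d e n).
Proof.
exact: (measurable_vertex mem_pascal_nb (fun v : PG => deviates d e n (val v).2)).
Qed.

(** Markov's inequality for the fourth moment: 4 n^2 over (e n)^4 is summable, whereas the variance
    would only give order 1/n. *)
Lemma bern_deviation d e M n : 0 <= d <= 1 -> 0 < e ->
  law M (fun v : PG => bern d (val v).1 (val v).2) ->
  (M (deviation d e n.+1) <= (4 / e ^+ 4 / n.+1%:R ^+ 2)%:E)%E.
Proof.
move=> d01 e0 hM; have n0 : 0 < (n.+1%:R : R) by [].
have := @pascal_count R M _ (deviates d e n.+1) n.+1 [::] (bern_harmonic d01) hM isT.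
rewrite /= cylinder_nil add0n.
set A := mkset _; rewrite (_ : A `&` _ = deviation d e n.+1); last by rewrite setIT.
move=> ->; rewrite lee_fin.
set x : R := n.+1%:R in n0 *.
apply: (@le_trans _ _ ((e * x) ^- 4 * binsum (bern d) n.+1 (fun K => (K%:R - n.+1%:R * d) ^+ 4))).
  rewrite -binsumZ; apply: ler_sum => K _.
  have Kn : (K <= n.+1)%N by rewrite -ltnS.
  rewrite add0n val_pascal_pt //= -mulrA; apply: ler_wpM2l => //.
  apply: ler_wpM2l; first exact: bern_ge0.
  rewrite mulrC -expr_div_n /deviates -/x; case: ltP => [h|_]; last first.
    by rewrite -[4%N]/(2 * 2)%N exprM sqr_ge0.
  rewrite -[4%N]/(2 * 2)%N exprM -(real_normK (num_real (_ / _))) -exprM.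
  apply: exprn_ege1; rewrite normrM normfV (ger0_norm (ltW (mulr_gt0 e0 n0))).
  rewrite ler_pdivlMr ?mulr_gt0 // mul1r.
  have -> : K%:R - x * d = x * (K%:R / x - d) by field; rewrite gt_eqF.
  by rewrite normrM (ger0_norm (ltW n0)) mulrC ler_pM2l // ltW.
have := binsum_bern_fourth n.+1 d01; rewrite -/x => h.
apply: le_trans (ler_wpM2l _ h) _; first by rewrite invr_ge0 exprn_ge0 // mulr_ge0 ?ltW.
rewrite le_eqVlt; apply/orP; left; apply/eqP; field.
by rewrite !gt_eqF.
Qed.

Lemma bern_pascal_measure d M : 0 <= d <= 1 ->
  law M (fun v : PG => bern d (val v).1 (val v).2) -> pascal_measure d M.
Proof.
move=> d01 hM; split.
  split; first exact: law_central hM.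
  exact: (extreme_ergodic pascal_nb_uniq mem_pascal_nb pascal_level_root pascal_level_edge
    pascal_reach hM (bern_extreme d01)).
(* Tolerances 1/(j+1) suffice. The events start at level 1, since the frequency at level 0 is a
   division by zero. *)
apply: (@negligibleS _ _ _ _ (\bigcup_j lim_sup_set (fun n => deviation d j.+1%:R^-1 n.+1))).
  move=> t /= ncv; apply: contrapT => nU; apply: ncv.
  apply/cvgrPdist_lt => e e0.
  have [j hj] : exists j : nat, j.+1%:R^-1 < e.
    exists (Num.bound e^-1); rewrite invf_plt ?posrE //.
    by apply: lt_trans (archi_boundP _) _; rewrite ?invr_ge0 ?ltW // ltr_nat.
  have /existsNP[N hN] : ~ lim_sup_set (fun n => deviation d j.+1%:R^-1 n.+1) t.
    by move=> h; apply: nU; exists j.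
  exists N.+1 => // -[|n] //= Nn.
  have nd : ~ deviation d j.+1%:R^-1 n.+1 t.
    by move=> dv; apply: hN => _; exists n.
  by rewrite distrC; apply: le_lt_trans hj; rewrite leNgt; apply/negP.
apply: negligible_bigcup => j.
apply: (@lim_sup_set_square _ _ _ M _ (4 / j.+1%:R^-1 ^+ 4)) => [n|n].
  exact: measurable_deviation.
by apply: bern_deviation => //; rewrite invr_gt0.
Qed.

(** The limit frequency holds in probability, hence also for the continuations of a path to (n, k),
    and frequencies are bounded; so the second moment seen from (n, k) is negligible against N^2 and
    [pascal_mean] applies. *)
Lemma pascal_measure_bern d M : 0 <= d <= 1 -> pascal_measure d M ->
  law M (fun v : PG => bern d (val v).1 (val v).2).
Proof.
move=> d01 [[cM _] aeM].
have [hM hphi] := central_law pascal_nb_uniq mem_pascal_nb pascal_reach cM.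
set phi := (fun v => fine _) in hM hphi; have [p0 p1 pS] := pascal_harmonicP hphi.
suff e : forall v, phi v = bern d (val v).1 (val v).2 by move=> q pq; rewrite hM // e.
apply: (pascal_mean_shift _ hphi) => n k kn.
pose p N j := phi (pascal_pt (n + N) (k + j)).
suff : p 1%N 1%N = d * p 0%N 0%N by rewrite /p !addn1 !addn0.
have pr : pascal_rec p by move=> N j jN; rewrite /p pS ?leq_add // !addnS.
have pn N j : (j <= N)%N -> 0 <= p N j by move=> jN; rewrite /p p0 // leq_add.
apply: pascal_mean => // e e0.
(* Chosen so that eps < 1 and 9 eps^2 is at most e/2. *)
pose eps := e / (18 + e).
have eps0 : 0 < eps by rewrite divr_gt0 //; lra.
have eps1 : 18 * eps ^+ 2 <= e.
  have h : eps * (18 + e) = e by rewrite divfK // gt_eqF //; lra.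
  by nra.
have [N0 hN0] : exists N, forall m, (N <= m)%N -> (M (deviation d eps m) <= (e / 2)%:E)%E.
  apply: lim_sup_set_null_measure; last by rewrite divr_gt0.
    by move=> m; exact: measurable_deviation.
  apply: negligibleS aeM => t /= hs cv.
  move/cvgrPdist_lt: cv => /(_ eps eps0)[N _ hN].
  have [m /= Nm] := hs N I; rewrite /deviation /= /deviates distrC => h.
  by have := hN m Nm; rewrite /= ltNge (ltW h).
(* Large enough for the deviation to be improbable and for the starting level n to be at most eps
   N. *)
pose N := (maxn N0 (maxn n (Num.bound (n%:R / eps)))).+1.
have Nn : (n <= N)%N by rewrite /N ltnW // ltnS !leq_max leqnn orbT.
have N0N : (N0 <= N)%N by rewrite /N ltnW // ltnS !leq_max leqnn.
have Neps : n%:R <= eps * N%:R.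
  rewrite mulrC -ler_pdivrMr //; apply: ltW.
  apply: lt_le_trans (archi_boundP _) _; first by rewrite divr_ge0 // ltW.
  by rewrite ler_nat /N ltnW // ltnS !leq_max leqnn !orbT.
have NR : n%:R <= N%:R :> R by rewrite ler_nat.
have NR0 : 0 < N%:R :> R by rewrite ltr0n.
exists N => //; set x : R := N%:R in Neps NR NR0 *.
have [d0 d1] := andP d01.
have sq3 : (3 * eps * x) ^+ 2 = 9 * eps ^+ 2 * x ^+ 2 by ring.
have ge9 : 0 <= 9 * eps ^+ 2 * x ^+ 2 by rewrite -sq3 sqr_ge0.
(* Without deviation J differs from N d by at most (n + N) eps plus n, hence by at most 3 eps N;
   with deviation the difference is still at most N. *)
apply: (@le_trans _ _ (binsum p N (fun J => (9 * eps ^+ 2 * x ^+ 2) * 1 +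
    x ^+ 2 * (deviates d eps (n + N) (k + J))%:R))).
  apply: ler_sum => J _; have JN : (J <= N)%N by rewrite -ltnS.
  apply: ler_wpM2l; first by rewrite mulr_ge0 // pn.
  have Jx : (J%:R : R) <= x by rewrite ler_nat.
  have J0 : 0 <= (J%:R : R) by [].
  have sqx y : `|y| <= x -> y ^+ 2 <= x ^+ 2.
    by move=> yx; rewrite -real_normK ?num_real // ler_sqr ?nnegrE // ltW.
  rewrite /deviates; case: ltP => [_|h].
    rewrite !mulr1; apply: (@le_trans _ _ (x ^+ 2)); last first.
      by rewrite lerDr.
    by apply: sqx; rewrite ler_norml; apply/andP; split; nra.
  rewrite mulr0 addr0 mulr1 -sq3.
  rewrite -real_normK ?num_real // ler_sqr ?nnegrE //; last first.
    exact: mulr_ge0 (mulr_ge0 (ler0n _ 3) (ltW eps0)) (ltW NR0).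
  have nx : (n + N)%:R = n%:R + x by rewrite natrD.
  have nx0 : 0 < n%:R + x by rewrite ltr_wpDl.
  have k0 : 0 <= (k%:R : R) by [].
  have kR : (k%:R : R) <= n%:R by rewrite ler_nat.
  move: h; rewrite natrD nx => h.
  have : `|k%:R + J%:R - (n%:R + x) * d| <= (n%:R + x) * eps.
    have -> : k%:R + J%:R - (n%:R + x) * d = (n%:R + x) * ((k%:R + J%:R) / (n%:R + x) - d).
      by field; rewrite gt_eqF.
    by rewrite normrM gtr0_norm // ler_pM2l.
  by rewrite !ler_norml => /andP[h1 h2]; apply/andP; split; nra.
rewrite binsumD !binsumZ binsum1 //.
have [q [pq qe]] := pascal_reach (pascal_pt n k).
have p00 : p 0%N 0%N <= 1.
  rewrite /p !addn0 -qe -lee_fin -hM //; apply: probability_le1.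
  exact: measurable_cylinder.
have : (M (deviation d eps (n + N) `&` cylinder q) <= (e / 2)%:E)%E.
  apply: (@le_trans _ _ (M (deviation d eps (n + N)))).
    apply: le_measure; rewrite ?inE //; last first.
    - exact: measurable_deviation.
    - by apply: measurableI; [exact: measurable_deviation|exact: measurable_cylinder].
  by apply: hN0; rewrite (leq_trans N0N) // leq_addl.
have := @pascal_count R M phi (deviates d eps (n + N)) N q hphi hM pq.
rewrite qe val_pascal_pt //= => ->; rewrite lee_fin => hs.
have -> : binsum p N (fun J => (deviates d eps (n + N) (k + J))%:R) =
  \sum_(J < N.+1) 'C(N, J)%:R *
     (phi (pascal_pt (n + N) (k + J)) * (deviates d eps (n + N) (k + J))%:R).
  by apply: eq_bigr => J _; rewrite mulrA.
set S := \sum_(_ < _) _ in hs *; have x2 : 0 <= x ^+ 2 := sqr_ge0 x.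
have p00' := pn 0%N 0%N isT.
have hA : 9 * eps ^+ 2 * x ^+ 2 * p 0%N 0%N <= e / 2 * x ^+ 2.
  apply: (@le_trans _ _ (9 * eps ^+ 2 * x ^+ 2)).
    by rewrite ler_piMr.
  by apply: ler_wpM2r => //; lra.
have hB : x ^+ 2 * S <= e / 2 * x ^+ 2 by rewrite mulrC ler_wpM2r.
by lra.
Qed.

Lemma pascal_measure_ex d : 0 <= d <= 1 -> exists2 M, pascal_measure d M &
  law M (fun v : PG => bern d (val v).1 (val v).2).
Proof.
move=> d01; have [M hM] := harmonic_law pascal_nb_uniq mem_pascal_nb (bern_harmonic d01).
by exists M => //; exact: bern_pascal_measure.
Qed.

End PascalMeasures.

(** * The Young graph and the slow Young graph *)

Section YoungGraph.
Variable R : realType.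
Local Notation YG := young_graph.
Implicit Types (f : ydiag -> R) (M : probability (path_space YG) R).

Definition young_nb (l : YG) : seq YG := ups l.

Lemma young_nb_uniq l : uniq (young_nb l).
Proof. by rewrite filter_uniq // yseq_uniq. Qed.

Lemma mem_young_nb (l m : YG) : (m \in young_nb l) = edge l m.
Proof. exact: mem_ups. Qed.

Lemma young_level_root : level (root : YG) = 0%N. Proof. by []. Qed.

Lemma young_level_edge (l m : YG) : edge l m -> level m = (level l).+1.
Proof. by case/andP=> _ /eqP. Qed.

Lemma young_reach (l : YG) : exists p, fpath_to l p.
Proof.
have [n ln] : exists n, ncells l = n by exists (ncells l).
elim: n l ln => [|n IH] l ln.
  have : l \in yseq 0 by rewrite mem_yseq ln.
  by rewrite yseq0 inE => /eqP ->; exists [::].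
have [m ml] : exists m, add_cell m l by apply: down_ex; rewrite ln.
have mn : ncells m = n by have := young_level_edge ml; rewrite /= ln => -[].
have [p [pp e]] := IH m mn; exists (rcons p l).
by split; rewrite ?last_rcons // rcons_path pp e.
Qed.

Lemma young_extremeE f : young_extreme f -> extreme young_nb f.
Proof. by move=> h f1 f2 t h1 h2 t01 e l; rewrite (h f1 f2 t h1 h2 t01 e). Qed.

Lemma young_corresponds M f chi : law M f ->
  corresponds Sn (@chi_Y R) M chi <-> young_char f chi.
Proof.
move=> hM.
have E n s : \sum_(v \in [set v : YG | level v = n]) (fine (M (F_ v)))%:C%C * chi_Y R v s =
    \sum_(l <- yseq n) (f l)%:C%C * irr_character R n l (val s).
  have -> : [set v : YG | level v = n] = [set` yseq n].
    by apply/seteqP; split=> v /=; rewrite mem_yseq => /eqP.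
  rewrite -fsbig_seq ?yseq_uniq // big_seq [RHS]big_seq.
  apply: eq_bigr => l; rewrite mem_yseq => /eqP ln.
  by rewrite (law_F young_reach _ hM) /chi_Y ln.
by split=> h n s sn; rewrite (h n s sn) E.
Qed.

End YoungGraph.

(** * The slow Young graph *)

Section SlowYoungGraph.
Variable R : realType.
Local Notation SG := slow_young_graph.
Implicit Types (phi : nat -> ydiag -> R) (M : probability (path_space SG) R) (v w : SG).

(* The root stands for the nonexistent vertices (n, l) with n < |l|. *)
Definition slow_pt (n : nat) (l : ydiag) : SG :=
  insubd slow_root ((n, l) : nat * ydiag).

Definition slow_nb v : seq SG :=
  slow_pt (val v).1.+1 (val v).2 :: [seq slow_pt (val v).1.+1 m | m <- ups (val v).2].

Lemma val_slow_pt n l : (ncells l <= n)%N -> val (slow_pt n l) = (n, l).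
Proof. by move=> ln; apply: (insubdK slow_root); exact: ln. Qed.

Lemma slow_ptE v : slow_pt (val v).1 (val v).2 = v.
Proof.
apply: val_inj; rewrite val_slow_pt; last exact: (valP v).
by case: (val v).
Qed.

Lemma slow_pt_eq n l w : (ncells l <= n)%N -> w = slow_pt n l <-> val w = (n, l).
Proof.
by move=> ln; split=> [->|e]; [rewrite val_slow_pt|rewrite -(slow_ptE w) e].
Qed.

Lemma mem_slow_nb v w : (w \in slow_nb v) = edge v w.
Proof.
have ln : (ncells (val v).2 <= (val v).1)%N := valP v.
have ln1 := leqW ln; have lu m : m \in ups (val v).2 -> (ncells m <= (val v).1.+1)%N.
  by move/ups_ncells ->.
rewrite inE /=; apply/idP/idP.
  case/orP=> [/eqP/(slow_pt_eq _ ln1) e|/mapP[m mu /(slow_pt_eq _ (lu m mu)) e]].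
    by rewrite /slow_edge e !eqxx.
  by rewrite /slow_edge e eqxx -mem_ups mu orbT.
case/andP=> /eqP e /orP[/eqP e2|]; last rewrite -mem_ups => mu.
  by apply/orP; left; apply/eqP/(slow_pt_eq _ ln1); rewrite -e -e2; case: (val w).
apply/orP; right; apply/mapP; exists (val w).2 => //.
by apply/(slow_pt_eq _ (lu _ mu)); rewrite -e; case: (val w).
Qed.

Lemma slow_nb_uniq v : uniq (slow_nb v).
Proof.
have ln : (ncells (val v).2 <= (val v).1)%N := valP v.
have ln1 := leqW ln; have lu m : m \in ups (val v).2 -> (ncells m <= (val v).1.+1)%N.
  by move/ups_ncells ->.
rewrite /slow_nb cons_uniq; apply/andP; split.
  apply/mapP => -[m mu /(slow_pt_eq _ (lu m mu))]; rewrite val_slow_pt // => -[e].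
  by have := ups_ncells mu; rewrite -e => /n_Sn.
rewrite map_inj_in_uniq; first by rewrite filter_uniq // yseq_uniq.
by move=> m m' mu mu' /(slow_pt_eq _ (lu m' mu')); rewrite val_slow_pt ?lu // => -[].
Qed.

Lemma slow_level_root : level (root : SG) = 0%N. Proof. by []. Qed.

Lemma slow_level_edge v w : edge v w -> level w = (level v).+1.
Proof. by case/andP=> /eqP. Qed.

Lemma slow_reach v : exists p, fpath_to v p.
Proof.
have ln : (ncells (val v).2 <= (val v).1)%N := valP v.
rewrite -(slow_ptE v); move: (val v).1 (val v).2 ln => n l; clear v.
elim: n l => [|n IH] l ln.
  have : l \in yseq 0 by rewrite mem_yseq -leqn0.
  rewrite yseq0 inE => /eqP ->; exists [::]; split=> //=.
  exact/esym/(slow_ptE root).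
have [m [mn e]] : exists m, (ncells m <= n)%N /\ edge (slow_pt n m) (slow_pt n.+1 l).
  move: ln; rewrite leq_eqVlt => /orP[/eqP ln|]; last first.
    by rewrite ltnS => ln; exists l; split; rewrite // /= /slow_edge !val_slow_pt ?leqW //= !eqxx.
  have [m ml] : exists m, add_cell m l by apply: down_ex; rewrite ln.
  have mn : ncells m = n by have := young_level_edge ml; rewrite /= ln => -[].
  by exists m; rewrite mn /= /slow_edge !val_slow_pt ?ln ?mn //= eqxx ml orbT.
have [p [pp pe]] := IH m mn; exists (rcons p (slow_pt n.+1 l)).
by split; rewrite ?last_rcons // rcons_path pp pe.
Qed.

Definition slow_lift phi v : R := phi (val v).1 (val v).2.

Lemma sum_slow_nb (Phi : SG -> R) v :
  \sum_(w <- slow_nb v) Phi w = Phi (slow_pt (val v).1.+1 (val v).2) +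
    \sum_(m <- ups (val v).2) Phi (slow_pt (val v).1.+1 m).
Proof. by rewrite big_cons big_map. Qed.

Lemma slow_lift_harmonic phi : slow_harmonic phi -> harmonic slow_nb (slow_lift phi).
Proof.
move=> [p0 p1 pS]; split=> [v||v]; [exact: p0 (valP v)|exact: p1|].
have ln : (ncells (val v).2 <= (val v).1)%N := valP v.
rewrite sum_slow_nb /slow_lift (pS _ _ ln) val_slow_pt 1?leqW //; congr (_ + _).
rewrite big_seq [RHS]big_seq; apply: eq_bigr => m mu.
by rewrite val_slow_pt // (ups_ncells mu).
Qed.

Lemma slow_harmonic_pt (Phi : SG -> R) : harmonic slow_nb Phi ->
  slow_harmonic (fun n l => Phi (slow_pt n l)).
Proof.
move=> [p0 p1 pS]; split=> [n l _||n l ln]; first exact: p0.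
  by rewrite (slow_ptE root).
by rewrite pS sum_slow_nb val_slow_pt.
Qed.

Lemma slow_lift_extreme phi : slow_extreme phi -> extreme slow_nb (slow_lift phi).
Proof.
move=> h P1 P2 t h1 h2 t01 e v; rewrite -(slow_ptE v).
apply: (h _ _ t (slow_harmonic_pt h1) (slow_harmonic_pt h2) t01 _ _ _ (valP v)).
by move=> n l ln; rewrite -e /slow_lift val_slow_pt.
Qed.

Definition slow_seq n : seq SG := [seq slow_pt n l | l <- flatten [seq yseq k | k <- iota 0 n.+1]].

Lemma mem_slow_diagrams n l :
  (l \in flatten [seq yseq k | k <- iota 0 n.+1]) = (ncells l <= n)%N.
Proof.
apply/flatten_mapP/idP => [[k]|ln].
  by rewrite mem_iota mem_yseq add0n ltnS => kn /eqP ->.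
by exists (ncells l); rewrite ?mem_yseq // mem_iota add0n ltnS.
Qed.

Lemma slow_corresponds M phi psi : law M (slow_lift phi) ->
  corresponds Rn (@chi_slowY R) M psi <-> slow_char phi psi.
Proof.
move=> hM.
have E n x : \sum_(v \in [set v : SG | level v = n])
      (fine (M (F_ v)))%:C%C * chi_slowY R v x =
    slow_sum (fun l => (phi n l)%:C%C) n x.
  have -> : [set v : SG | level v = n] = [set` slow_seq n].
    apply/seteqP; split=> v /=.
      move=> vn; apply/mapP; exists (val v).2; last by rewrite -vn slow_ptE.
      by rewrite mem_slow_diagrams -vn; exact: (valP v).
    by move=> /mapP[l]; rewrite mem_slow_diagrams => ln ->; rewrite val_slow_pt.
  have sl : {in flatten [seq yseq k | k <- iota 0 n.+1] &, injective (slow_pt n)}.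
    move=> l m; rewrite !mem_slow_diagrams => ln mn /(slow_pt_eq _ mn).
    by rewrite val_slow_pt // => -[].
  rewrite -fsbig_seq; last first.
    rewrite map_inj_in_uniq //.
    have : uniq (iota 0 n.+1) by exact: iota_uniq.
    elim: (iota 0 n.+1) => //= k s IH /andP[ks us]; rewrite cat_uniq yseq_uniq IH // andbT.
    apply/hasPn => l /flatten_mapP[j js]; rewrite !mem_yseq => /eqP ->.
    by apply: contraNneq ks => <-.
  rewrite /slow_seq big_map big_flatten big_map /slow_sum.
  rewrite -[iota 0 n.+1]/(index_iota 0 n.+1) big_mkord.
  apply: eq_bigr => k _; rewrite big_seq [RHS]big_seq.
  apply: eq_bigr => l; rewrite mem_yseq => /eqP lk.
  have ln : (ncells l <= n)%N by rewrite lk -ltnS.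
  by rewrite (law_F slow_reach _ hM) /slow_lift /chi_slowY val_slow_pt.
by split=> h n x xn; rewrite (h n x xn) E.
Qed.

End SlowYoungGraph.

(** * The character attached to a pair *)

Section Main.
Variable R : realType.
Local Notation C := R[i].
Implicit Types (f : ydiag -> R) (chi : Sinf -> C) (psi : Rinf -> C).

Lemma product_pathE d f v :
  slow_lift (prodphi d f) v = f (slow_diagram v) *
    bern d (val (slow_to_pascal v)).1 (val (slow_to_pascal v)).2.
Proof. by []. Qed.

Lemma product_law (MY : probability (path_space young_graph) R)
    (MP : probability (path_space pascal_graph) R)
    (MT : probability (path_space slow_young_graph) R) d f :
  law MY f -> law MP (fun v : pascal_graph => bern d (val v).1 (val v).2) ->
  product_measure MY MP MT -> law MT (slow_lift (prodphi d f)).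
Proof.
move=> hY hP [[cT _] hT].
have [lT _] := central_law slow_nb_uniq mem_slow_nb slow_reach cT.
move=> p pp; rewrite lT // hT (law_F young_reach _ hY) (law_F pascal_reach _ hP) -EFinM.
by rewrite product_pathE.
Qed.

(** The laws of the three measures are forced: that of M_Y by the uniqueness of the coefficients of
    [chi], that of M_P by [pascal_measure_bern], and the last one by the product formula.
    Conversely, measures with these laws exist and are ergodic by extremality. *)
Lemma character_of_pairE d f chi psi : 0 <= d <= 1 -> young_harmonic f -> young_extreme f ->
  young_char f chi -> character_of_pair d chi psi <-> slow_char (prodphi d f) psi.
Proof.
move=> d01 hf xf hchi; split=> [[MY [MP [MT [[[cY eY] kY] hP hT kT]]]]|hpsi].
  have [lY _] := central_law young_nb_uniq mem_young_nb young_reach cY.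
  move/(young_corresponds _ lY): kY => kY; rewrite (young_char_coef kY hchi) in lY.
  have lT := product_law lY (pascal_measure_bern d01 hP) hT.
  exact/(slow_corresponds _ lT).
have [MY lY] := harmonic_law young_nb_uniq mem_young_nb hf.
have [MP hP lP] := pascal_measure_ex d01.
have [MT lT] := harmonic_law slow_nb_uniq mem_slow_nb
  (slow_lift_harmonic (prodphi_harmonic d01 hf)).
exists MY, MP, MT; split=> //.
- split; last exact/(young_corresponds _ lY).
  split; first exact: law_central lY.
  exact: (extreme_ergodic young_nb_uniq mem_young_nb young_level_root young_level_edge
    young_reach lY (young_extremeE xf)).
- split; [split; first exact: law_central lT|].
    exact: (extreme_ergodic slow_nb_uniq mem_slow_nb slow_level_root slow_level_edge
      slow_reach lT (slow_lift_extreme (prodphi_extreme d01 hf xf))).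
  move=> v; rewrite (law_F slow_reach _ lT) (law_F young_reach _ lY).
  by rewrite (law_F pascal_reach _ lP) -EFinM product_pathE.
- exact/(slow_corresponds _ lT).
Qed.

Lemma pairs_young d chi : pairs (d, chi) -> exists f,
  [/\ 0 <= d <= 1, young_harmonic f, young_extreme f & young_char f chi].
Proof.
move=> [d01 ichi]; have [f hf fchi] := young_char_exists ichi.1.
by exists f; split=> //; exact: indecomposable_young_extreme fchi ichi.
Qed.

End Main.

Theorem corollary2p11 (R : realType) :
  exists Phi : R * (Sinf -> R[i]) -> (Rinf -> R[i]),
    [/\ (forall (delta : R) (chi : Sinf -> R[i]) (psi : Rinf -> R[i]),
           pairs (delta, chi) ->
           (character_of_pair delta chi psi <-> psi = Phi (delta, chi))),
        set_fun (@pairs R) (@indecomposable_character R Rinf) Phi,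
        set_surj (@pairs R) (@indecomposable_character R Rinf) Phi &
        (forall a b : R * (Sinf -> R[i]), pairs a -> pairs b ->
           (Phi a = Phi b <-> same_pair a b))].
Proof.
(* Quantifying over f frees the choice of the character from the choice of f; outside of [pairs] the
   value is an arbitrary default. *)
have ex (a : R * (Sinf -> R[i])) : exists psi, pairs a -> forall f, young_harmonic f ->
    young_char f a.2 -> slow_char (prodphi a.1 f) psi.
  have [pa|na] := pselect (pairs a); last by exists (fun=> 0).
  case: a pa => d chi pa; have [f [d01 hf xf cf]] := pairs_young pa.
  have [psi hpsi] := slow_char_ex (prodphi_harmonic d01 hf).
  by exists psi => _ g hg cg; rewrite (young_char_coef cg cf).
have [Phi hPhi] := choice ex; exists Phi; split.
- move=> d chi psi pa; have [f [d01 hf xf cf]] := pairs_young pa.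
  have hp := hPhi _ pa f hf cf; split=> [/(character_of_pairE _ d01 hf xf cf) h|->].
    exact: slow_char_fun h hp.
  exact/(character_of_pairE _ d01 hf xf cf).
- move=> [d chi] pa; have [f [d01 hf xf cf]] := pairs_young pa.
  apply: (slow_extreme_indecomposable (prodphi_harmonic d01 hf) (hPhi _ pa f hf cf)).
  exact: prodphi_extreme.
- move=> psi ipsi; have [phi hphi cphi] := slow_char_exists ipsi.1.
  have [d [f [d01 hf xf e]]] := slow_extreme_prod hphi (indecomposable_slow_extreme cphi ipsi).
  have [chi fchi cchi] := young_char_ex hf.
  have pa : pairs (d, chi).
    by split=> //; exact: young_extreme_indecomposable fchi xf.
  exists (d, chi) => //; have h := hPhi _ pa f hf fchi.
  exact: slow_char_fun h (slow_eq_char e cphi).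
- move=> [d chi] [d' chi'] pa pb.
  have [f [d01 hf xf cf]] := pairs_young pa; have [f' [d01' hf' xf' cf']] := pairs_young pb.
  have h := hPhi _ pa f hf cf; have h' := hPhi _ pb f' hf' cf'.
  split=> [e|[->//|[/= d0 d0']]].
    rewrite e in h.
    have [ed ef] : d = d' /\ (d != 0 -> f = f').
      by apply: prodphi_inj => // n l ln; exact: slow_char_coef h h' ln.
    (* The function f is recovered from the product only when d is nonzero; the other case is the
       second clause of [same_pair]. *)
    have [d0|/ef ff] := eqVneq d 0; first by right; rewrite /= -ed.
    by left; rewrite ed; congr pair; rewrite ff in cf; exact: young_char_fun cf cf'.
  rewrite /= d0 in h; rewrite /= d0' in h'; subst d d'.
  exact: slow_char_fun h (slow_eq_char (prodphi0 hf' hf) h').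
Qed.
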